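(* Let $(\xi_k)_{k\in\mathbb{Z}}$ be i.i.d. real random variables with $\mathbb{E}\xi_0=0$, $\mathbb{E}\xi_0^2>0$ and $\mathbb{E}e^{\alpha\xi_0^2}<\infty$ for some $\alpha>0$. Let $(\theta_n)_{n\ge1}$ satisfy $\theta_n\in[0,1)$ and $\theta_n\to1$, and let $(b_n)_{n\ge 1}$ be positive numbers with $b_n\to\infty$ and $\frac{\sqrt n(1-\theta_n)^2}{b_n}\to\infty$. Let $X_{k,n}$ be the stationary autoregressive process with coefficient $\theta_n$ and noise $(\xi_k)$, and let $C^*_{l,n}$ be its empirical covariance at lag $l$ (both defined in the context). Let $M$ be a non-negative integer and, for $0\le l\le M$, let $(a_{l,n})_n$ be a sequence of real numbers with $\lim_{n\to\infty}a_{l,n}=a_l\in\mathbb{R}$, and assume that $a_l\ne0$ for some $0\le l\le M$. Then for any $r>0$, $$\lim_{n\to\infty}\frac{1}{b_n^2}\log\mathbb{P}\left(\frac{(1-\theta_n^2)^{3/2}\sqrt n}{b_n}\left|\sum_{l=0}^Ma_{l,n}\left(C^*_{l,n}-\mathbb{E}C^*_{l,n}\right)\right|\ge r\right)=-\frac{r^2}{2\Sigma^2},$$ where $$\Sigma^2=4\left(\sum_{j=0}^Ma_j\right)^2(\mathbb{E}\xi_0^2)^2.$$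
   Context: For every $n\ge1$, $X_{k,n}=\sum_{p=0}^\infty\theta_n^p\xi_{k-p}$ for $k\ge0$ (with $0^0=1$); this is the stationary solution of $X_{k,n}=\theta_nX_{k-1,n}+\xi_k$. For integers $0\le l<n$, $C^*_{l,n}=\frac{1}{n-l}\sum_{k=1}^{n-l}X_{k+l,n}X_{k,n}$. Conventions: $\log 0=-\infty$, and the right-hand side $-r^2/(2\Sigma^2)$ is read as $-\infty$ when $\Sigma^2=0$. *)

(* Defs.v *)
From HB Require Import structures.
From mathcomp Require Import all_boot all_order all_algebra.
From mathcomp Require Import all_classical all_reals all_analysis.

Set Implicit Arguments.
Unset Strict Implicit.
Unset Printing Implicit Defensive.

Import Order.TTheory GRing.Theory Num.Theory.
Import numFieldNormedType.Exports.

Local Open Scope classical_set_scope.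
Local Open Scope ring_scope.

Definition mutually_independent (d : measure_display) (T : measurableType d)
    (R : realType) (P : probability T R) (I : choiceType)
    (X : I -> {RV P >-> R}) : Prop :=
  forall (s : seq I) (A : I -> set R), uniq s -> (forall i, measurable (A i)) ->
    P (\bigcap_(i in [set` s]) (X i @^-1` A i)) =
    (\prod_(i <- s) P (X i @^-1` A i))%E.

(* Laws are compared on measurable sets only: the values of a measure
   elsewhere are meaningless. *)
Definition identically_distributed (d : measure_display)
    (T : measurableType d) (R : realType) (P : probability T R) (I : Type)
    (X : I -> {RV P >-> R}) : Prop :=
  forall (i j : I) (A : set R), measurable A ->
    distribution P (X i) A = distribution P (X j) A.

Definition iid (d : measure_display) (T : measurableType d) (R : realType)
    (P : probability T R) (I : choiceType) (X : I -> {RV P >-> R}) : Prop :=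
  mutually_independent X /\ identically_distributed X.

(* The limit is pointwise in the outcome [w]; where the series diverges
   (a null set under the hypotheses of the theorem) it takes the value 0. *)
Definition stationary_ar (T : Type) (R : realType) (theta : nat -> R)
    (xi : int -> T -> R) (k n : nat) : T -> R :=
  fun w => limn (series (fun p : nat => theta n ^+ p * xi (k%:Z - p%:Z) w)).

Definition empirical_cov (T : Type) (R : realType) (theta : nat -> R)
    (xi : int -> T -> R) (l n : nat) : T -> R :=
  fun w => (n - l)%:R^-1 *
    \sum_(1 <= k < (n - l).+1)
      (stationary_ar theta xi (k + l) n w * stationary_ar theta xi k n w).

(* - r^2 / (2 Sigma^2), read as -oo when Sigma^2 = 0; [s2] is Sigma^2. *)
Definition gaussian_rate (R : realType) (s2 r : R) : \bar R :=
  if s2 == 0 then -oo%E else (- (r ^+ 2 / (2 * s2)))%:E.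

(* Main.v *)
Require Import Defs.
From HB Require Import structures.
From mathcomp Require Import all_boot all_order all_algebra.
From mathcomp Require Import all_classical all_reals all_analysis.
From mathcomp Require Import measurable_realfun.
From mathcomp Require Import ring lra.

Set Implicit Arguments.
Unset Strict Implicit.
Unset Printing Implicit Defensive.

Import Order.TTheory GRing.Theory Num.Theory.
Import numFieldNormedType.Exports.

Local Open Scope classical_set_scope.
Local Open Scope ring_scope.

(** The proof isolates one martingale that governs all lags at once.

    Write [u = 1 - theta_n], [X] for the stationary process, [var] for the
    variance of the noise and [S_n = \sum_(k < n) X_k xi_(k+1)]
    ([transform]).  Squaring the recursion and summing gives the identity
    [(1 - theta_n^2) \sum_(k < n) X_k^2 = X_0^2 - X_n^2 + 2 theta_n S_n +
    \sum_(k <= n) xi_k^2] ([energy_identity]).  Unfolding the recursion [l]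
    times expresses the empirical covariance at lag [l] in the same way
    ([emp_covE]).  After centring and scaling it equals [2 Z_n] plus an error,
    where [Z_n = sqrt (1 - theta_n^2) S_n / (sqrt n b_n)] ([score]) does not
    depend on [l].  So the weighted sum behaves like [2 (\sum_j a_j) Z_n],
    which explains the value of [Sigma^2].

    The variable [Z_n] has Gaussian deviations at speed [b_n^2] because its
    logarithmic moment generating function does.  Let [phi] be the cumulant of
    the noise.  For [t = lam b_n sqrt (1 - theta_n^2) / sqrt n] ([tilt]) the
    exponential of [t S_n - \sum_k phi (t X_k)] has mean one, the noise
    [xi_(k+1)] being independent of the past.  Now [t X_k] is mostly small and
    [phi s] is close to [var s^2 / 2], so by the energy identity the
    compensator is close to the constant [lam^2 b_n^2 var^2 / 2].  This fails
    only on an event of probability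
    [exp (c1 b_n^2 / u - c0 n u^2)] ([total_cumulant_concentration]), while
    the second moment of [exp (t S_n)] is at most [exp (c b_n^2 / u)].  As
    [n u^3 / b_n^2] tends to infinity, the bad event contributes nothing and
    [E exp (lam b_n^2 Z_n) = exp (b_n^2 (lam^2 var^2 / 2 + o(1)))]
    ([mgf_transform]).  Chernoff's bound and a change of measure turn this
    into tail estimates ([gaussian_upper_tail], [gaussian_lower_tail]).

    The estimates on [X] come from convexity: [u X_(k+1)] is
    [theta_n (u X_k) + u xi_(k+1)], a convex combination.  Hence [(u X_k)^2]
    inherits the exponential moment of the squared noise ([ar_moment]), and
    sums of [X_k^2], or of their excess over a level, are bounded along each
    path by the same sums for the noise ([ar_excess_sum]).

    The errors are boundary terms, centred sums of squares of the noise, and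
    products of [X] with later noises multiplied by [1 - theta_n^2].  All are
    negligible at speed [b_n^2] ([negl], [negl_cov_error]).

    The asymptotic statements are uniform: the three limits in the hypotheses
    are replaced by one largeness parameter [B] ([regime]), and each estimate
    holds for all [n], [theta], [b] in the regime of a large enough [B]. *)

(** * The past of the noise and its independence of the next noise *)

Section past.
Context d (T : measurableType d) (R : realType) (P : probability T R).
Variable xi : int -> {RV P >-> R}.

(** Only finitely many coordinates are constrained, so that independence of
    finite subfamilies applies to a cylinder; the family is stable under
    intersection, hence determines measures on the sigma-algebra it
    generates. *)
Definition past_cylinders (k : nat) : set (set T) :=
  [set C | exists A : nat -> set R, exists N : nat,
     [/\ forall j, measurable (A j), forall j, (N <= j)%N -> A j = setT &
         C = \bigcap_j (xi (k%:Z - j%:Z) @^-1` A j)]].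

(** The sample space with its sigma-algebra reduced to the events known at
    time [k]; being [pastT]-measurable is being adapted. *)
Definition pastT (k : nat) : measurableType (past_cylinders k).-sigma :=
  g_sigma_algebraType (past_cylinders k).

Lemma past_cylinders_measurable k : past_cylinders k `<=` measurable.
Proof.
move=> _ [A [N [mA _ ->]]]; apply: bigcap_measurable; first by exists 0%N.
by move=> j _; exact: measurable_funPTI.
Qed.

Lemma past_cylindersI k : setI_closed (past_cylinders k).
Proof.
move=> _ _ [A [N [mA AT ->]]] [B [M [mB BT ->]]].
exists (fun j => A j `&` B j), (maxn N M); split.
- by move=> j; exact: measurableI.
- by move=> j; rewrite geq_max => /andP[Nj Mj]; rewrite AT// BT// setIT.
- by rewrite -bigcapI; apply: eq_bigcapr => j _; rewrite preimage_setI.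
Qed.

Lemma past_cylindersT k : past_cylinders k setT.
Proof.
exists (fun=> setT), 0%N; split => //.
by apply/esym; rewrite -subTset => w _ j _.
Qed.

Lemma measurable_past k (A : set T) :
  measurable (A : set (pastT k)) -> measurable A.
Proof.
apply: smallest_sub; first exact: sigma_algebra_measurable.
exact: past_cylinders_measurable.
Qed.

Lemma measurable_fun_past d' (T' : measurableType d') k (f : T -> T') :
  measurable_fun [set: pastT k] f -> measurable_fun [set: T] f.
Proof.
move=> mf _ B mB; apply: (@measurable_past k).
exact: (mf measurableT).
Qed.

Lemma measurable_past_xi k (i : int) : (i <= k%:Z) ->
  measurable_fun [set: pastT k] (xi i).
Proof.
move=> ik _ B mB; rewrite setTI; apply: sub_sigma_algebra.
have [j ij] : exists j : nat, i = k%:Z - j%:Z.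
  exists `|k%:Z - i|%N; rewrite gez0_abs ?subr_ge0//.
  by rewrite opprB addrC subrK.
exists (fun l => if l == j then B else setT), j.+1; split.
- by move=> l; case: ifP.
- by move=> l jl; rewrite gtn_eqF.
- apply/seteqP; split => w /=.
    by move=> Bw l _ /=; case: eqP => // ->; rewrite -ij.
  by move=> /(_ j I) /=; rewrite eqxx -ij.
Qed.

Hypothesis xi_iid : iid xi.

Lemma past_cylinders_indep k C B : past_cylinders k C -> measurable B ->
  P (C `&` xi k.+1%:Z @^-1` B) = (P C * P (xi k.+1%:Z @^-1` B))%E.
Proof.
move=> [A [N [mA AT ->]]] mB.
pose s := [seq k%:Z - j%:Z | j <- iota 0 N].
pose A' (i : int) := if i == k.+1%:Z then B else A `|k%:Z - i|%N.
have A'j j : A' (k%:Z - j%:Z) = A j.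
  rewrite /A' opprB addrC subrK absz_nat.
  case: eqP => // /eqP; rewrite subr_eq -PoszD eqz_nat => /eqP.
  by rewrite addSn => /eqP; rewrite -addnS -{1}(addn0 k) eqn_add2l.
have mA' i : measurable (A' i) by rewrite /A'; case: ifP.
have us : uniq s.
  rewrite map_inj_uniq ?iota_uniq// => j j' /addrI/eqP.
  by rewrite eqr_opp eqz_nat => /eqP.
have ns : k.+1%:Z \notin s.
  apply/mapP => -[j _] /eqP; rewrite eq_sym subr_eq -PoszD eqz_nat.
  by rewrite addSn -addnS -{1}(addn0 k) eqn_add2l.
have CE : \bigcap_j (xi (k%:Z - j%:Z) @^-1` A j) =
    \bigcap_(i in [set` s]) (xi i @^-1` A' i).
  apply/seteqP; split => w /= h.
    by move=> _ /= /mapP[j _ ->]; rewrite A'j; exact: h.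
  move=> j _ /=; have [jN|Nj] := ltnP j N; last by rewrite AT.
  rewrite -A'j; apply: h => /=; apply/mapP; exists j => //.
  by rewrite mem_iota add0n.
rewrite CE.
have [ind _] := xi_iid.
rewrite (ind s A' us mA').
have us' : uniq (k.+1%:Z :: s) by rewrite /= ns.
have := ind _ A' us' mA'.
rewrite big_cons {2}/A' eqxx muleC => <-; congr (P _).
apply/seteqP; split => w /=.
  move=> [h1 h2] i; rewrite /= inE => /orP[/eqP->|]; first by rewrite /A' eqxx.
  exact: h1.
move=> h; split; first by move=> i /= si; apply: h; rewrite /= inE si orbT.
by have /= := h k.+1%:Z; rewrite /A' eqxx; apply; rewrite inE eqxx.
Qed.

(** Both sides are finite measures in [A] that agree on the cylinders. *)
Lemma past_indep k (A : set T) B :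
  measurable (A : set (pastT k)) -> measurable B ->
  P (A `&` xi k.+1%:Z @^-1` B) = (P A * P (xi k.+1%:Z @^-1` B))%E.
Proof.
move=> mA mB.
have mXB : measurable (xi k.+1%:Z @^-1` B) by exact: measurable_funPTI.
pose m1 : {measure set T -> \bar R} := mrestr P mXB.
have q0 : 0 <= fine (P (xi k.+1%:Z @^-1` B)) by exact: fine_ge0.
pose m2 : {measure set T -> \bar R} := mscale (NngNum q0) P.
have m2E C : m2 C = (P C * P (xi k.+1%:Z @^-1` B))%E.
  by rewrite /m2/= /mscale/= fineK ?fin_num_measure// muleC.
rewrite -m2E -[LHS]/(m1 A).
apply: (g_sigma_algebra_measure_unique (past_cylinders k)
  (@past_cylinders_measurable k) (fun=> setT)) => //.
- by move=> _; exact: past_cylindersT.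
- by apply/seteqP; split => // w _; exists 0%N.
- exact: past_cylindersI.
- by move=> C cC; rewrite m2E -past_cylinders_indep.
- move=> _; rewrite /m1/= /mrestr setTI.
  by apply: le_lt_trans (probability_le1 P mXB) _; rewrite ltry.
Qed.

(** Integrating out the next noise with the past frozen: by independence the
    law of [(w, xi_{k+1} w)], with [w] seen through the past, is a product.
    This takes the place of conditional expectation throughout. *)
Lemma ge0_integral_past k (h : pastT k * R -> \bar R) :
  measurable_fun setT h -> (forall z, 0 <= h z)%E ->
  (\int[P]_w h (w, xi k.+1%:Z w) =
   \int[P]_w \int[distribution P (xi 0)]_x h (w, x))%E.
Proof.
move=> mh h0.
have mid : measurable_fun [set: T] (id : T -> pastT k).
  by move=> _ A mA; rewrite setTI; exact: measurable_past mA.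
pose idX : {mfun T >-> pastT k} :=
  HB.pack (id : T -> pastT k) (isMeasurableFun.Build _ _ _ _ _ mid).
pose J (w : T) : pastT k * R := (w, xi k.+1%:Z w).
have mJ : measurable_fun [set: T] J by apply/measurable_fun_pair.
pose JX : {mfun T >-> (pastT k * R)%type} :=
  HB.pack J (isMeasurableFun.Build _ _ _ _ _ mJ).
have JE : forall X : set (pastT k * R), measurable X ->
    (distribution P idX \x distribution P (xi 0))%E X = distribution P JX X.
  apply: product_measure_unique => A B mA mB.
  transitivity (P A * distribution P (xi k.+1%:Z) B)%E.
    exact: past_indep.
  by congr (_ * _)%E; exact: xi_iid.2.
transitivity (\int[distribution P JX]_z h z)%E.
  by rewrite ge0_integral_distribution.
transitivity (\int[distribution P idX \x distribution P (xi 0)]_z h z)%E.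
  by apply: eq_measure_integral => X mX _; exact/esym/JE.
rewrite fubini_tonelli1//.
rewrite ge0_integral_distribution//.
- exact: measurable_fun_fubini_tonelli_F.
- by move=> w; apply: integral_ge0.
Qed.

End past.

(** * Exponential moments along the filtration of the noise *)

Section exponential_supermartingale.
Context d (T : measurableType d) (R : realType) (P : probability T R).
Variable xi : int -> {RV P >-> R}.
Local Notation pastT := (pastT xi).

Definition mexp (f : T -> R) : \bar R := (\int[P]_w (expR (f w))%:E)%E.

Lemma mexp_ge0 f : (0 <= mexp f)%E.
Proof. by apply: integral_ge0 => w _; rewrite lee_fin expR_ge0. Qed.

Lemma measurable_mexp (f : T -> R) : measurable_fun setT f ->
  measurable_fun setT (fun w => (expR (f w))%:E).
Proof. by move=> mf; apply/measurable_EFinP; exact: measurableT_comp. Qed.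

Lemma le_mexp (f g : T -> R) :
  measurable_fun setT f -> measurable_fun setT g ->
  (forall w, f w <= g w) -> (mexp f <= mexp g)%E.
Proof.
move=> mf mg fg; apply: ge0_le_integral => //.
- exact: measurable_mexp.
- exact: measurable_mexp.
- by move=> w _; rewrite lee_fin ler_expR.
Qed.

Lemma measurable_fun_past_le d' (T' : measurableType d') k k' (f : T -> T') :
  (k <= k')%N -> measurable_fun [set: pastT k] f ->
  measurable_fun [set: pastT k'] f.
Proof.
move=> kk' mf _ B mB; have := mf measurableT B mB; rewrite !setTI.
apply: smallest_sub; first exact: (@sigma_algebra_measurable _ (pastT k')).
move=> _ [A [N [mA _ ->]]]; apply: (@bigcap_measurable _ (pastT k')).
  by exists 0%N.
move=> j _; rewrite -[_ @^-1` _]setTI.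
apply: (@measurable_past_xi _ _ _ _ _ k' (k%:Z - j%:Z)) => //.
by rewrite lerBlDr -PoszD lez_nat (leq_trans kk')// leq_addr.
Qed.

Lemma measurable_past_pair k (h : pastT k * R -> R) :
  measurable_fun setT h ->
  measurable_fun [set: pastT k.+1] (fun w => h (w, xi k.+1%:Z w)).
Proof.
move=> mh.
apply: (measurableT_comp mh).
apply/measurable_fun_pair.
  by apply: measurable_fun_past_le (leqnSn k) _; exact: measurable_id.
exact: measurable_past_xi.
Qed.

Hypothesis xi_iid : iid xi.
Local Notation mu := (distribution P (xi 0)).

Lemma mexp_step k (L : T -> R) (h : pastT k * R -> R) :
  measurable_fun [set: pastT k] L -> measurable_fun setT h ->
  mexp (fun w => L w + h (w, xi k.+1%:Z w)) =
  (\int[P]_w ((expR (L w))%:E * \int[mu]_x (expR (h (w, x)))%:E))%E.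
Proof.
move=> mL mh; pose g (z : pastT k * R) := (expR (L z.1 + h z))%:E.
rewrite /mexp -[LHS]/(\int[P]_w g (w, xi k.+1%:Z w))%E.
have mg : measurable_fun setT g.
  apply/measurable_EFinP; apply: measurableT_comp => //.
  apply: measurable_funD => //.
  by apply: (measurableT_comp mL); exact: measurable_fst.
rewrite ge0_integral_past//; last by move=> z; rewrite lee_fin expR_ge0.
apply: eq_integral => w _; rewrite /g/=.
under eq_integral do rewrite expRD EFinM.
rewrite ge0_integralZl//.
- apply/measurable_EFinP; apply: measurableT_comp => //.
  by apply: (measurableT_comp mh); exact: measurable_pair1.
Qed.

Section iterate.
Variables (L : T -> R) (h : nat -> T * R -> R).
Hypothesis mL : measurable_fun [set: pastT 0] L.
Hypothesis mh : forall k, measurable_fun setT (h k : pastT k * R -> R).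

Let S n w := L w + \sum_(0 <= k < n) h k (w, xi k.+1%:Z w).

Let SS n w : S n.+1 w = S n w + h n (w, xi n.+1%:Z w).
Proof. by rewrite /S big_nat_recr//= addrA. Qed.

Let mS n : measurable_fun [set: pastT n] (S n).
Proof.
elim: n => [|n ih].
  rewrite (_ : S 0%N = L)//; apply/funext => w.
  by rewrite /S big_geq// addr0.
rewrite (_ : S n.+1 = fun w => S n w + h n (w, xi n.+1%:Z w)); last first.
  by apply/funext => w; rewrite SS.
apply: measurable_funD; last exact: measurable_past_pair.
exact: measurable_fun_past_le (leqnSn n) ih.
Qed.

(** The exponential supermartingale inequality: integrate out the noises one
    at a time, from the last to the first. *)
Lemma mexp_sum_le n :
  (forall k w, (k < n)%N -> \int[mu]_x (expR (h k (w, x)))%:E <= 1)%E ->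
  (mexp (fun w => (L w + \sum_(0 <= k < n) h k (w, xi k.+1%:Z w))%R) <=
   mexp L)%E.
Proof.
rewrite -/(S n); elim: n => [|n ih] h1.
  rewrite [X in mexp X](_ : _ = L)//; apply/funext => w.
  by rewrite /S big_geq// addr0.
rewrite [X in mexp X](_ : _ = fun w => S n w + h n (w, xi n.+1%:Z w)); last first.
  by apply/funext => w; exact: SS.
have le1 : (mexp (S n) <= mexp L)%E by apply: ih => k w kn; exact/h1/ltnW.
apply: le_trans le1; rewrite mexp_step//.
have mSn : measurable_fun [set: T] (S n) by exact: (measurable_fun_past (@mS n)).
apply: ge0_le_integral => //.
- move=> w _; apply: mule_ge0; first by rewrite lee_fin expR_ge0.
  by apply: integral_ge0 => x _; rewrite lee_fin expR_ge0.
- apply: emeasurable_funM; first exact: measurable_mexp.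
  apply: (@measurable_fun_past _ _ _ _ xi _ _ n).
  apply: (@measurable_fun_fubini_tonelli_F _ _ (pastT n) R R mu
    (fun z => (expR (h n z))%:E)) => //.
  by apply/measurable_EFinP; apply: measurableT_comp.
- exact: measurable_mexp.
- move=> w _; rewrite -[leRHS]mule1 lee_wpmul2l ?lee_fin ?expR_ge0//.
  exact: h1.
Qed.

Lemma mexp_sum_eq n :
  (forall k w, (k < n)%N -> \int[mu]_x (expR (h k (w, x)))%:E = 1)%E ->
  mexp (fun w => L w + \sum_(0 <= k < n) h k (w, xi k.+1%:Z w)) = mexp L.
Proof.
rewrite -/(S n); elim: n => [|n ih] h1.
  rewrite [X in mexp X](_ : _ = L)//; apply/funext => w.
  by rewrite /S big_geq// addr0.
rewrite [X in mexp X](_ : _ = fun w => S n w + h n (w, xi n.+1%:Z w)); last first.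
  by apply/funext => w; exact: SS.
rewrite mexp_step// -[RHS]ih; last by move=> k w kn; exact/h1/ltnW.
by apply: eq_integral => w _; rewrite h1// mule1.
Qed.

End iterate.
End exponential_supermartingale.
Arguments mexp {d T R} P f%_R.

(** * Elementary inequalities for the exponential *)

Section exponential_inequalities.
Variable R : realType.
Implicit Types x y s : R.

Lemma expR_taylor1 y : `|expR y - 1 - y| <= y ^+ 2 * expR `|y|.
Proof.
have h0 : 0 <= expR y - 1 - y by have := expR_ge1Dx y; lra.
rewrite ger0_norm//.
have hN := expR_ge1Dx (- y).
have e1 : (1 - y) * expR y <= 1.
  by rewrite -[leRHS](expRxMexpNx_1 y) mulrC ler_wpM2l ?expR_ge0.
have h1 : expR y - 1 - y <= y * (expR y - 1) by nra.
apply: (le_trans h1); have [y0|y0] := leP 0 y.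
  rewrite ger0_norm//.
  have : expR y - 1 <= y * expR y by move: e1; rewrite mulrBl mul1r; lra.
  by move=> h2; rewrite expr2 -mulrA; apply: ler_wpM2l.
have hh : 1 <= expR `|y| by rewrite -expR0 ler_expR.
have h3 : 1 - expR y <= - y by have := expR_ge1Dx y; lra.
apply: (@le_trans _ _ (y ^+ 2)); first by rewrite expr2; nra.
by rewrite ler_peMr// sqr_ge0.
Qed.

(** By the mean value theorem, from the first-order bound. *)
Lemma expR_taylor2 y :
  `|expR y - 1 - y - y ^+ 2 / 2| <= `|y| ^+ 3 * expR `|y|.
Proof.
pose f (z : R) : R := expR z - 1 - z - z ^+ 2 / 2.
have df (z : R) : is_derive z 1 f (expR z - 1 - z).
  rewrite /f; apply: is_derive_eq.
  rewrite !scaler1 !subr0 /GRing.scale/=; lra.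
have cf : continuous f.
  by move=> z; apply/differentiable_continuous/derivable1_diffP.
have f0 : f 0 = 0 by rewrite /f expR0; lra.
rewrite -/(f y); have [c cy fE] : exists2 c, `|c| <= `|y| & f y = (expR c - 1 - c) * y.
  have [y0|y0] := leP 0 y.
    have [c + e] := @MVT_segment R f _ 0 y y0 (fun x _ => df x)
      (continuous_subspaceT cf).
    rewrite in_itv/= => /andP[c0 cy]; exists c; first by rewrite !ger0_norm.
    by move: e; rewrite f0 !subr0.
  have [c + e] := @MVT_segment R f _ y 0 (ltW y0) (fun x _ => df x)
    (continuous_subspaceT cf).
  rewrite in_itv/= => /andP[yc c0]; exists c.
    by rewrite !ler0_norm// ?lerN2// ltW.
  by move: e; rewrite f0 sub0r => /eqP; rewrite eqr_oppLR sub0r mulrN opprK => /eqP.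
rewrite fE normrM exprSr mulrAC ler_wpM2r//.
apply: (le_trans (expR_taylor1 c)); apply: ler_pM => //.
- by rewrite sqr_ge0.
- by rewrite -(real_normK (num_real c)) lerXn2r.
- by rewrite ler_expR.
Qed.

(** Convexity of the exponential between [0] and [y]. *)
Lemma expR_convex0 (t y : R) : 0 <= t <= 1 -> expR (t * y) <= 1 - t + t * expR y.
Proof.
move=> /andP[t0 t1].
have h1 : (1 + (y - t * y)) * expR (t * y) <= expR y.
  have -> : expR y = expR (y - t * y) * expR (t * y) by rewrite -expRD subrK.
  by apply: ler_wpM2r; [exact: expR_ge0|exact: expR_ge1Dx].
have h2 : (1 - t * y) * expR (t * y) <= 1.
  rewrite -[leRHS](expRxMexpNx_1 (t * y)) mulrC; apply: ler_wpM2l; first exact: expR_ge0.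
  by have := expR_ge1Dx (- (t * y)).
nra.
Qed.

Lemma expR_max0 y : expR (Num.max y 0) <= 1 + expR y.
Proof.
by rewrite /Num.max; case: ifP => _; rewrite ?expR0 ?lerDl ?lerDr ?expR_ge0.
Qed.

Lemma expRN_le x : 0 < x -> expR (- x) <= x^-1.
Proof.
move=> x0; rewrite expRN lef_pV2 ?posrE ?expR_gt0//.
by apply: le_trans (expR_ge1Dx _); rewrite lerDr.
Qed.

Lemma constant_factor_le_expR (c eps : R) : 0 <= c -> 0 < eps -> exists2 B : R, 1 <= B &
  forall b, B <= b -> c <= expR (eps * b ^+ 2).
Proof.
move=> c0 eps0; exists (Num.max 1 (c / eps)); first by rewrite le_max lexx.
move=> b; rewrite ge_max => /andP[b1 cb].
have bb : b <= b ^+ 2 by rewrite expr2 ler_peMr// (le_trans ler01).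
have h : c <= eps * b ^+ 2.
  by rewrite mulrC -ler_pdivrMr//; exact: le_trans bb.
by apply: (le_trans h); apply: le_trans (expR_ge1Dx _); rewrite lerDr.
Qed.

End exponential_inequalities.

(** * Exponential moments of the noise *)

Section integrable_real.
Context d (T : measurableType d) (R : realType).
Variable mu : {measure set T -> \bar R}.
Implicit Types f g : T -> R.

Lemma integrable_addr f g : mu.-integrable setT (EFin \o f) ->
  mu.-integrable setT (EFin \o g) ->
  mu.-integrable setT (EFin \o (fun x => f x + g x)).
Proof. by move=> hf hg; have := integrableD measurableT hf hg. Qed.

Lemma integrable_mulr (c : R) f : mu.-integrable setT (EFin \o f) ->
  mu.-integrable setT (EFin \o (fun x => c * f x)).
Proof. by move=> hf; have := integrableZl measurableT c hf. Qed.

End integrable_real.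

Section noise_law.
Variables (R : realType) (mu : probability R R) (al : R).
Hypothesis al_gt0 : 0 < al.
Hypothesis exp_fin : (\int[mu]_x (expR (al * x ^+ 2))%:E < +oo)%E.
Hypothesis mean0 : (\int[mu]_x x%:E = 0)%E.

Local Notation E f := (\int[mu]_x (f x)).

Let C := E (fun x => expR (al * x ^+ 2)).

Let muT : fine (mu setT) = 1.
Proof. by rewrite (@probability_setT _ _ _ mu). Qed.

Let meas_pow n : measurable_fun setT (fun x : R => x ^+ n).
Proof. exact: exprn_measurable. Qed.

Let meas_gauss : measurable_fun setT (fun x : R => expR (al * x ^+ 2)).
Proof. by apply: measurableT_comp => //; exact: measurable_funM. Qed.

Let int_gauss : mu.-integrable setT (EFin \o (fun x => expR (al * x ^+ 2))).
Proof.
apply/integrableP; split; first exact/measurable_EFinP.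
by under eq_integral do rewrite /= ger0_norm ?expR_ge0//.
Qed.

Lemma integrable_gauss (f : R -> R) (c : R) : measurable_fun setT f ->
  (forall x, `|f x| <= c * expR (al * x ^+ 2)) ->
  mu.-integrable setT (EFin \o f).
Proof.
move=> mf fc.
apply: (@le_integrable _ _ _ mu _ measurableT _
    (fun x => c%:E * (expR (al * x ^+ 2))%:E)%E).
- exact/measurable_EFinP.
- move=> x _ /=; rewrite lee_fin; apply: (le_trans (fc x)).
  exact: ler_norm.
- exact: integrableZl.
Qed.

Let Ecst (c : R) : E (fun=> c) = c.
Proof. by rewrite Rintegral_cst// [X in _ * X]muT mulr1. Qed.

Let C_ge1 : 1 <= C.
Proof.
have -> : 1 = E (fun=> 1) :> R.
  by rewrite Rintegral_cst// mul1r; exact/esym/muT.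
apply: le_Rintegral => //.
- exact: finite_measure_integrable_cst.
- by move=> x _; rewrite -expR0 ler_expR mulr_ge0 ?sqr_ge0// ltW.
Qed.

Let EC (f : R -> R) : mu.-integrable setT (EFin \o f) ->
  (\int[mu]_x (f x)%:E)%E = (E f)%:E.
Proof. by move=> intf; rewrite fineK//; exact: integrable_fin_num. Qed.

Let lin_gauss (s x : R) : s * x <= s ^+ 2 / (4 * al) + al * x ^+ 2.
Proof.
rewrite -subr_ge0.
have -> : s ^+ 2 / (4 * al) + al * x ^+ 2 - s * x =
   al * (x - s / (2 * al)) ^+ 2 by field; rewrite gt_eqF.
by rewrite mulr_ge0 ?sqr_ge0// ltW.
Qed.

Let meas_lin s : measurable_fun setT (fun x : R => expR (s * x)).
Proof. by apply: measurableT_comp => //; exact: measurable_funM. Qed.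

Let int_lin s : mu.-integrable setT (EFin \o (fun x => expR (s * x))).
Proof.
apply: (@integrable_gauss _ (expR (s ^+ 2 / (4 * al)))) => // x.
by rewrite ger0_norm ?expR_ge0// -expRD ler_expR.
Qed.

Let int_id : mu.-integrable setT (EFin \o (fun x : R => x)).
Proof.
apply: (@integrable_gauss _ (expR (1 / (4 * al)))) => // x.
rewrite -expRD; apply: (@le_trans _ _ (expR `|x|)).
  by apply: le_trans (expR_ge1Dx _); rewrite lerDr.
by rewrite ler_expR; have := lin_gauss 1 `|x|; rewrite mul1r real_normK ?num_real// expr1n.
Qed.

Let int_cst (c : R) : mu.-integrable setT (EFin \o (fun _ : R => c)).
Proof. exact: finite_measure_integrable_cst. Qed.

Let Emean : E (fun x => x) = 0.
Proof. by rewrite /Rintegral mean0. Qed.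

Definition mgf s := E (fun x => expR (s * x)).

(** Jensen for a centred law, through [1 + x <= exp x]. *)
Lemma mgf_ge1 s : 1 <= mgf s.
Proof.
have -> : 1 = E (fun x => 1 + s * x) :> R.
  rewrite RintegralD//; last exact: (integrable_mulr s int_id).
  rewrite RintegralZl// Emean mulr0 addr0.
  by rewrite Rintegral_cst// mul1r; exact/esym/muT.
apply: le_Rintegral => //.
- by apply: integrable_addr => //; exact: (integrable_mulr s int_id).
- by move=> x _; exact: expR_ge1Dx.
Qed.

Definition cumulant s := ln (mgf s).

Lemma cumulant_ge0 s : 0 <= cumulant s.
Proof. exact: ln_ge0 (mgf_ge1 s). Qed.

Let mgf_gt0 s : 0 < mgf s. Proof. exact: lt_le_trans ltr01 (mgf_ge1 s). Qed.

Lemma mgf_cumulant s :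
  (\int[mu]_x (expR (s * x - cumulant s))%:E = 1)%E.
Proof.
under eq_integral do rewrite expRD EFinM.
rewrite ge0_integralZr//; last exact/measurable_EFinP.
rewrite EC// -/(mgf s) -EFinM expRN lnK ?posrE//.
by rewrite divff ?gt_eqF.
Qed.

(** A Fubini argument gives measurability of the parametric integral. *)
Lemma measurable_cumulant : measurable_fun setT cumulant.
Proof.
apply: (measurableT_comp (@measurable_ln R)).
apply: (@measurableT_comp _ _ _ _ _ _ fine) => //.
apply: (@measurable_fun_fubini_tonelli_F _ _ R R R mu
  (fun z => (expR (z.1 * z.2))%:E)) => //.
by apply/measurable_EFinP; apply: measurableT_comp => //; exact: measurable_funM.
Qed.

Local Notation var := (E (fun x => x ^+ 2)).

Let exp3 (x : R) : `|x| ^+ 3 * expR `|x| <= 6 * expR al^-1 * expR (al * x ^+ 2).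
Proof.
have h1 : `|x| ^+ 3 <= 6 * expR `|x|.
  have := @expR_ge1Dxn R `|x| 2 (normr_ge0 x).
  have -> : (3`!)%:R = 6 :> R by rewrite !factS fact0.
  by lra.
apply: (@le_trans _ _ (6 * expR `|x| * expR `|x|)).
  by rewrite ler_wpM2r ?expR_ge0.
rewrite -!mulrA ler_wpM2l// -!expRD ler_expR.
have := lin_gauss 2 `|x|; rewrite real_normK ?num_real//.
have -> : 2 ^+ 2 / (4 * al) = al^-1 by field; rewrite gt_eqF.
lra.
Qed.

Let D := 6 * expR al^-1 * C.

Let D_ge0 : 0 <= D.
Proof. by rewrite !mulr_ge0 ?expR_ge0// (le_trans ler01 C_ge1). Qed.

Let int_sq : mu.-integrable setT (EFin \o (fun x : R => x ^+ 2)).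
Proof.
apply: (@integrable_gauss _ al^-1) => // x.
rewrite ger0_norm ?sqr_ge0// mulrC ler_pdivlMr// mulrC.
by apply: le_trans (expR_ge1Dx _); rewrite lerDr.
Qed.

Lemma variance_ge0 : 0 <= var.
Proof. by apply: Rintegral_ge0 => x _; rewrite sqr_ge0. Qed.

(** The mean vanishes, and the third-order remainder is dominated by
    [exp (al x^2)]. *)
Let mgf_taylor s : `|s| <= 1 ->
  `|mgf s - 1 - var * s ^+ 2 / 2| <= D * `|s| ^+ 3.
Proof.
move=> s1.
pose g x := expR (s * x) - 1 - s * x - (s * x) ^+ 2 / 2.
have gE x : g x = expR (s * x) + (- 1) * 1 + (- s) * x + (- s ^+ 2 / 2) * x ^+ 2.
  by rewrite /g; field.
have intg : mu.-integrable setT (EFin \o g).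
  rewrite (_ : g = fun x => expR (s * x) + (- 1) * 1 + (- s) * x + (- s ^+ 2 / 2) * x ^+ 2).
    by do 3 (apply: integrable_addr; last exact: integrable_mulr).
  by apply/funext => x; rewrite gE.
have Eg : E g = mgf s - 1 - var * s ^+ 2 / 2.
  under eq_Rintegral do rewrite gE.
  have i1 := integrable_mulr (-1) (int_cst 1).
  have i2 := integrable_mulr (-s) int_id.
  have i3 := integrable_mulr (- s ^+ 2 / 2) int_sq.
  have i01 := integrable_addr (int_lin s) i1.
  have i02 := integrable_addr i01 i2.
  rewrite RintegralD// RintegralD// RintegralD// !RintegralZl//.
  rewrite Emean Rintegral_cst// [X in _ * (1 * X)]muT -/(mgf s).
  by field.
have gD x : `|g x| <= `|s| ^+ 3 * (6 * expR al^-1 * expR (al * x ^+ 2)).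
  apply: (le_trans (expR_taylor2 _)); rewrite normrM exprMn -[leLHS]mulrA.
  rewrite ler_wpM2l ?exprn_ge0//.
  apply: le_trans (exp3 x); rewrite ler_wpM2l ?exprn_ge0// ler_expR.
  by rewrite ler_piMl.
rewrite -Eg; apply: (le_trans (le_normr_Rintegral measurableT intg)).
rewrite mulrC -[D]/(6 * expR al^-1 * C) -!RintegralZl//; last exact: integrable_mulr.
apply: le_Rintegral => //.
- exact: integrable_norm.
- by do 2 apply: integrable_mulr.
Qed.

Let ln_le (m : R) : 0 <= m -> m - m ^+ 2 <= ln (1 + m) <= m.
Proof.
move=> m0; apply/andP; split; last by apply: le_ln1Dx; lra.
have p : 0 < 1 + m by lra.
have /le_ln1Dx : -1 < (1 + m)^-1 - 1.
  by rewrite ltrBrDl subrr invr_gt0.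
rewrite addrC subrK lnV ?posrE// lerNl; apply: le_trans.
have q : (1 + m)^-1 * (1 + m) = 1 by rewrite mulVf// gt_eqF.
have q0 : 0 < (1 + m)^-1 by rewrite invr_gt0.
nra.
Qed.

Let B := var / 2 + D.

Let B_ge0 : 0 <= B.
Proof. by rewrite addr_ge0 ?divr_ge0 ?variance_ge0. Qed.

Let mgf_le s : `|s| <= 1 -> mgf s - 1 <= B * s ^+ 2.
Proof.
move=> s1; have := mgf_taylor s1; rewrite ler_norml => /andP[_ h].
have : D * `|s| ^+ 3 <= D * s ^+ 2.
  have -> : s ^+ 2 = `|s| ^+ 2 by rewrite real_normK ?num_real.
  by rewrite ler_wpM2l// [leLHS]exprS ler_piMl ?exprn_ge0.
rewrite /B; lra.
Qed.

(** Near [0] this is the Taylor expansion; for [|s| >= 1] it follows from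
    [s x <= s^2 / (4 al) + al x^2]. *)
Lemma cumulant_quadratic : exists2 K, 0 < K & forall s, cumulant s <= K * s ^+ 2.
Proof.
have lnC : 0 <= ln C by rewrite ln_ge0.
have al4 : 0 < (4 * al)^-1 by rewrite invr_gt0 mulr_gt0.
have B0 := B_ge0.
exists (B + (4 * al)^-1 + ln C); first lra.
move=> s; have [s1|s1] := leP `|s| 1.
  have m0 : 0 <= mgf s - 1 by rewrite subr_ge0 mgf_ge1.
  have /andP[_ ] := ln_le m0; rewrite addrC subrK -/(cumulant s) => h.
  apply: (le_trans h); apply: (le_trans (mgf_le s1)).
  by rewrite ler_wpM2r ?sqr_ge0//; lra.
have s2 : 1 <= s ^+ 2 by rewrite -(real_normK (num_real s)) exprn_ege1// ltW.
have h : mgf s <= expR (s ^+ 2 / (4 * al)) * C.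
  rewrite -RintegralZl//; apply: le_Rintegral => //.
    exact: integrable_mulr.
  by move=> x _; rewrite -expRD ler_expR.
have C0 : 0 < C by exact: lt_le_trans ltr01 C_ge1.
have : cumulant s <= ln (expR (s ^+ 2 / (4 * al)) * C).
  have p1 : mgf s \is Num.pos by rewrite posrE.
  have p2 : expR (s ^+ 2 / (4 * al)) * C \is Num.pos.
    by rewrite posrE mulr_gt0// expR_gt0.
  by rewrite /cumulant (ler_ln p1 p2).
rewrite lnM ?posrE ?expR_gt0// expRK => h'; apply: (le_trans h').
have : ln C <= ln C * s ^+ 2 by rewrite ler_peMr.
have : 0 <= B * s ^+ 2 by rewrite mulr_ge0// sqr_ge0.
by rewrite !mulrDl [s ^+ 2 / _]mulrC; lra.
Qed.

(** From the expansion of [mgf] and [m - m^2 <= ln (1 + m) <= m]. *)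
Lemma cumulant_taylor eps : 0 < eps -> exists2 eta, 0 < eta &
  forall s, `|s| <= eta -> `|cumulant s - var * s ^+ 2 / 2| <= eps * s ^+ 2.
Proof.
move=> eps0; have p : 0 < D + B ^+ 2 + 1.
  by have := D_ge0; have := sqr_ge0 B; lra.
exists (Num.min 1 (eps / (D + B ^+ 2 + 1))); first by rewrite lt_min ltr01 divr_gt0.
move=> s; rewrite le_min => /andP[s1 se].
have m0 : 0 <= mgf s - 1 by rewrite subr_ge0 mgf_ge1.
have /andP[] := ln_le m0; rewrite [1 + _]addrC subrK -/(cumulant s) => h1 h2.
have h3 := mgf_le s1; have := mgf_taylor s1.
rewrite -(real_normK (num_real s)) in h3 *.
set u := `|s| in s1 se h3 *.
have u0 : 0 <= u by rewrite /u.
move: se; rewrite ler_pdivlMr// => se.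
have h4 : (mgf s - 1) ^+ 2 <= B ^+ 2 * u * u ^+ 2.
  apply: (@le_trans _ _ ((B * u ^+ 2) ^+ 2)).
    by rewrite lerXn2r// nnegrE// mulr_ge0// sqr_ge0.
  have -> : (B * u ^+ 2) ^+ 2 = B ^+ 2 * u * u ^+ 2 * u by ring.
  by rewrite ler_piMr// !mulr_ge0 ?sqr_ge0.
have h5 : (D + B ^+ 2) * u * u ^+ 2 <= eps * u ^+ 2.
  by rewrite ler_wpM2r ?sqr_ge0//; lra.
rewrite !ler_norml => /andP[h6 h7].
have e3 : D * u ^+ 3 = D * u * u ^+ 2 by ring.
have h8 : 0 <= B ^+ 2 * u * u ^+ 2 by rewrite !mulr_ge0 ?sqr_ge0.
by apply/andP; split; lra.
Qed.

Let EFin_le (f : R -> R) (c : R) : mu.-integrable setT (EFin \o f) ->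
  E f <= c -> (\int[mu]_x (f x)%:E <= c%:E)%E.
Proof. by move=> intf fc; rewrite EC// lee_fin. Qed.

Let int_sqexp s : s <= al -> mu.-integrable setT (EFin \o (fun x => expR (s * x ^+ 2))).
Proof.
move=> sal; apply: (@integrable_gauss _ 1).
  by apply: measurableT_comp => //; exact: measurable_funM.
move=> x; rewrite ger0_norm ?expR_ge0// mul1r ler_expR.
by rewrite ler_wpM2r ?sqr_ge0.
Qed.

(** Convexity of [s |-> exp (s x^2)] between [0] and [al]. *)
Lemma gaussian_moment_small s : 0 <= s <= al ->
  (\int[mu]_x (expR (s * x ^+ 2))%:E <= (expR (C / al * s))%:E)%E.
Proof.
move=> /andP[s0 sal]; apply: EFin_le; first exact: int_sqexp.
have h : E (fun x => expR (s * x ^+ 2)) <= (1 - s / al) + s / al * C.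
  have -> : (1 - s / al) + s / al * C =
      E (fun x => (1 - s / al) + s / al * expR (al * x ^+ 2)).
    rewrite RintegralD//; last exact: integrable_mulr.
    by rewrite RintegralZl// Ecst.
  apply: le_Rintegral => //.
  - exact: int_sqexp.
  - by apply: integrable_addr => //; exact: integrable_mulr.
  move=> x _; have := @expR_convex0 R (s / al) (al * x ^+ 2).
  rewrite mulrA divfK ?gt_eqF//; apply.
  by apply/andP; split; [rewrite divr_ge0// ltW|rewrite ler_pdivrMr// mul1r].
apply: (le_trans h); apply: le_trans (expR_ge1Dx _).
have -> : C / al * s = s / al * C by ring.
have : 0 <= s / al by rewrite divr_ge0 // ltW.
lra.
Qed.

(** From [exp (max y 0) <= 1 + exp y]; the point is that the bound tends to
    [1] exponentially fast in the level [H]. *)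
Lemma gaussian_moment_excess H :
  (\int[mu]_x (expR (al * Num.max (x ^+ 2 - H) 0))%:E <=
   (expR (C * expR (- (al * H))))%:E)%E.
Proof.
have mf : measurable_fun setT (fun x : R => expR (al * Num.max (x ^+ 2 - H) 0)).
  apply: measurableT_comp => //; apply: measurable_funM => //.
  by apply: measurable_maxr => //; exact: measurable_funB.
have le1 (x : R) : expR (al * Num.max (x ^+ 2 - H) 0) <=
    1 + expR (- (al * H)) * expR (al * x ^+ 2).
  have -> : al * Num.max (x ^+ 2 - H) 0 = Num.max (al * (x ^+ 2 - H)) 0.
    by rewrite maxr_pMr ?mulr0// ltW.
  apply: (le_trans (expR_max0 _)).
  by rewrite -expRD lerD2l ler_expR; lra.
have int2 := integrable_addr (int_cst 1)
  (integrable_mulr (expR (- (al * H))) int_gauss).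
apply: EFin_le.
  apply: (le_integrable measurableT _ _ int2); first exact/measurable_EFinP.
  move=> x _; by rewrite /= lee_fin !ger0_norm ?expR_ge0 ?addr_ge0 ?mulr_ge0 ?expR_ge0.
apply: le_trans (expR_ge1Dx _).
have -> : 1 + C * expR (- (al * H)) =
    E (fun x => 1 + expR (- (al * H)) * expR (al * x ^+ 2)).
  rewrite RintegralD//; last exact: integrable_mulr.
  by rewrite RintegralZl// Ecst mulrC.
apply: le_Rintegral => //.
apply: (le_integrable measurableT _ _ int2); first exact/measurable_EFinP.
move=> x _; by rewrite /= lee_fin !ger0_norm ?expR_ge0 ?addr_ge0 ?mulr_ge0 ?expR_ge0.
Qed.

(** Bernstein's condition for the centred squares: the first-order term of
    the exponential integrates to zero. *)
Lemma square_bernstein : exists2 K, 0 < K & forall s, `|s| <= al / 2 ->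
  (\int[mu]_x (expR (s * (x ^+ 2 - var)))%:E <= (expR (K * s ^+ 2))%:E)%E.
Proof.
pose A := 8 / al ^+ 2 * expR (al * var).
have A0 : 0 < A by rewrite mulr_gt0 ?divr_gt0 ?exprn_gt0 ?expR_gt0.
have C0 : 0 < C by exact: lt_le_trans ltr01 C_ge1.
exists (A * C); first exact: mulr_gt0.
move=> s sal.
have s1 : s <= al by have a0 := al_gt0; have := ler_norm s; lra.
have int1 : mu.-integrable setT (EFin \o (fun x : R => expR (s * (x ^+ 2 - var)))).
  rewrite (_ : (fun _ => _) = fun x => expR (- (s * var)) * expR (s * x ^+ 2)).
    by apply: integrable_mulr; exact: int_sqexp.
  by apply/funext => x; rewrite -expRD; congr expR; ring.
have sq (y : R) : y ^+ 2 * expR `|s * y| <= 8 / al ^+ 2 * expR (al * `|y|).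
  have h1 : (al / 2 * `|y|) ^+ 2 / 2 <= expR (al / 2 * `|y|).
    have h := @expR_ge1Dxn R (al / 2 * `|y|) 1.
    have : 1 + (al / 2 * `|y|) ^+ 2 / (2`!)%:R <= expR (al / 2 * `|y|).
      by apply: h; rewrite mulr_ge0// divr_ge0// ltW.
    by rewrite (_ : (2`!)%:R = 2 :> R)//; lra.
  have h2 : y ^+ 2 <= 8 / al ^+ 2 * expR (al / 2 * `|y|).
    rewrite -(real_normK (num_real y)) mulrAC ler_pdivlMr ?exprn_gt0//.
    by move: h1; rewrite !exprMn; lra.
  have h3 : expR `|s * y| <= expR (al / 2 * `|y|).
    by rewrite ler_expR normrM ler_wpM2r.
  apply: (le_trans (ler_pM (sqr_ge0 _) (expR_ge0 _) h2 h3)).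
  by rewrite -[leLHS]mulrA -expRD ler_wpM2l ?divr_ge0 ?sqr_ge0// ler_expR; lra.
have le1 (x : R) : expR (s * (x ^+ 2 - var)) <=
    (1 + s * (- var)) + (s * x ^+ 2) + s ^+ 2 * (A * expR (al * x ^+ 2)).
  have := expR_taylor1 (s * (x ^+ 2 - var)); rewrite ler_norml => /andP[_].
  suff : (s * (x ^+ 2 - var)) ^+ 2 * expR `|s * (x ^+ 2 - var)| <=
    s ^+ 2 * (A * expR (al * x ^+ 2)) by lra.
  rewrite exprMn -mulrA ler_wpM2l ?sqr_ge0//; apply: (le_trans (sq _)).
  have hv : `|x ^+ 2 - var| <= var + x ^+ 2.
    by apply: (le_trans (ler_normB _ _)); rewrite !ger0_norm ?sqr_ge0 ?variance_ge0// addrC.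
  have : expR (al * `|x ^+ 2 - var|) <= expR (al * var) * expR (al * x ^+ 2).
    by rewrite -expRD ler_expR -mulrDr ler_wpM2l// ltW.
  by move=> h; rewrite /A -[leRHS]mulrA ler_wpM2l// divr_ge0// sqr_ge0.
apply: EFin_le => //.
apply: le_trans (expR_ge1Dx _).
have i1 := integrable_mulr s int_sq.
have i2 := integrable_addr (int_cst (1 + s * (- var))) i1.
have i3 := integrable_mulr A int_gauss.
have i4 := integrable_mulr (s ^+ 2) i3.
have -> : 1 + A * C * s ^+ 2 =
    E (fun x => (1 + s * (- var)) + (s * x ^+ 2) + s ^+ 2 * (A * expR (al * x ^+ 2))).
  rewrite RintegralD// RintegralD// Ecst !RintegralZl//.
  by rewrite -/C mulrN subrK mulrC.
by apply: le_Rintegral => //; exact: integrable_addr.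
Qed.

Lemma gaussian_moment_ge1 : 1 <= C. Proof. exact: C_ge1. Qed.

(** The bounds on the law of the noise under one constant, which becomes the
    only parameter of the later estimates besides [al]. *)
Lemma noise_bounds : exists2 K, 0 < K & [/\ forall s, cumulant s <= K * s ^+ 2,
  forall s, 0 <= s <= al ->
    (\int[mu]_x (expR (s * x ^+ 2))%:E <= (expR (K * s))%:E)%E,
  forall H, (\int[mu]_x (expR (al * Num.max (x ^+ 2 - H) 0))%:E <=
    (expR (K * expR (- (al * H))))%:E)%E &
  forall s, `|s| <= al / 2 ->
    (\int[mu]_x (expR (s * (x ^+ 2 - var)))%:E <= (expR (K * s ^+ 2))%:E)%E].
Proof.
have [K1 K10 h1] := cumulant_quadratic.
have [K2 K20 h2] := square_bernstein.
have C0 : 0 < C by exact: lt_le_trans ltr01 C_ge1.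
have C1 : 0 < C / al by rewrite divr_gt0.
exists (K1 + K2 + C + C / al); first lra.
split.
- by move=> s; apply: (le_trans (h1 s)); rewrite ler_wpM2r ?sqr_ge0//; lra.
- move=> s hs; apply: (le_trans (gaussian_moment_small hs)).
  by case/andP: hs => s0 _; rewrite lee_fin ler_expR ler_wpM2r//; lra.
- move=> H; apply: (le_trans (gaussian_moment_excess H)).
  by rewrite lee_fin ler_expR ler_wpM2r ?expR_ge0//; lra.
- move=> s hs; apply: (le_trans (h2 s hs)).
  by rewrite lee_fin ler_expR ler_wpM2r ?sqr_ge0//; lra.
Qed.

End noise_law.

(** * Measurability of pointwise limits *)

Section measurable_limit.
Context d (T : measurableType d) (R : realType).
Variable g : nat -> T -> R.
Hypothesis mg : forall n, measurable_fun setT (g n).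

Definition cvg_set : set T := [set w | cvgn (fun n => g n w)].

(** The Cauchy criterion, with countably many conditions. *)
Lemma cvg_setE : cvg_set =
  \bigcap_m \bigcup_N \bigcap_(i in [set i | (N <= i)%N])
    [set w | `|g i w - g N w| <= m.+1%:R^-1].
Proof.
apply/seteqP; split => w /=.
  move=> /cvg_ex[/= l gl] m _.
  have e0 : 0 < (m.+1%:R^-1 / 2 : R) by rewrite divr_gt0// invr_gt0.
  have /cvgrPdist_le/(_ _ e0) [N _ hN] := gl.
  exists N => // i /= Ni.
  have h1 := hN i Ni; have h2 := hN N (leqnn N).
  have -> : g i w - g N w = (l - g N w) - (l - g i w) by ring.
  apply: (le_trans (ler_normB _ _)).
  by rewrite [leRHS]splitr lerD.
move=> h; apply: cauchy_cvg; apply: cauchy_exP => e e0.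
have [m me] : exists m : nat, m.+1%:R^-1 < e.
  by have [m _ hm] := near_infty_natSinv_lt (PosNum e0); exists m; exact: (hm m (leqnn m)).
have [N _ hN] := h m I; exists (g N w); exists N => // i /= Ni.
rewrite /ball/= distrC; apply: le_lt_trans me; exact: hN.
Qed.

Lemma measurable_cvg_set : measurable cvg_set.
Proof.
rewrite cvg_setE; apply: bigcap_measurable; first by exists 0%N.
move=> m _; apply: bigcup_measurable => N _.
apply: bigcap_measurable; first by exists N => /=.
move=> i _; rewrite -[X in measurable X]setTI.
apply: (@measurable_fun_le _ T R setT (fun w => `|g i w - g N w|) (cst m.+1%:R^-1)) => //.
by apply: measurableT_comp => //; exact: measurable_funB.
Qed.

(** Where the sequence diverges [limn] takes its default value [0], so the
    truncated sequence converges everywhere to it. *)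
Lemma cvg_indic_limn w :
  (\1_cvg_set w * g n w) @[n --> \oo] --> limn (fun n => g n w).
Proof.
have [wD|wD] := boolP (w \in cvg_set).
  rewrite indicE wD; under eq_fun do rewrite mul1r.
  by move: wD; rewrite inE.
rewrite indicE (negbTE wD); under eq_fun do rewrite mul0r.
rewrite dvgP; last by move=> h; move: wD; rewrite notin_setE; apply.
exact: cvg_cst.
Qed.

Lemma measurable_fun_limn : measurable_fun setT (fun w => limn (fun n => g n w)).
Proof.
apply: (@measurable_fun_cvg _ T R setT (fun n w => \1_cvg_set w * g n w)).
  move=> n; apply: measurable_funM => //.
  exact: measurable_indic measurable_cvg_set.
by move=> w _; exact: cvg_indic_limn.
Qed.

End measurable_limit.

(** * The stationary autoregressive process *)

Section ar_sequences.
Variable R : realType.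
Implicit Types x e : nat -> R.

(** [th x + e = th x + (1 - th) (e / (1 - th))] is a convex combination, and
    the excess of the square over [A] is a convex function. *)
Lemma ar_excess_step (th x e A : R) : 0 <= th < 1 ->
  Num.max ((th * x + e) ^+ 2 - A) 0 <=
  th * Num.max (x ^+ 2 - A) 0 +
    (1 - th)^-1 * Num.max (e ^+ 2 - (1 - th) ^+ 2 * A) 0.
Proof.
move=> /andP[th0 th1]; set u := 1 - th.
have u0 : 0 < u by rewrite /u; lra.
have ui : 0 <= u^-1 by rewrite invr_ge0 ltW.
have m1 : x ^+ 2 - A <= Num.max (x ^+ 2 - A) 0 by rewrite le_max lexx.
have m2 : 0 <= Num.max (x ^+ 2 - A) 0 by rewrite le_max lexx orbT.
have m3 : e ^+ 2 - u ^+ 2 * A <= Num.max (e ^+ 2 - u ^+ 2 * A) 0 by rewrite le_max lexx.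
have m4 : 0 <= Num.max (e ^+ 2 - u ^+ 2 * A) 0 by rewrite le_max lexx orbT.
rewrite ge_max; apply/andP; split; last by rewrite addr_ge0 ?mulr_ge0.
apply: (@le_trans _ _ (th * (x ^+ 2 - A) + u^-1 * (e ^+ 2 - u ^+ 2 * A))); last first.
  by rewrite lerD// ler_wpM2l.
rewrite -subr_ge0.
have -> : th * (x ^+ 2 - A) + u^-1 * (e ^+ 2 - u ^+ 2 * A) - ((th * x + e) ^+ 2 - A)
  = th / u * (u * x - e) ^+ 2.
  have -> : th = 1 - u by rewrite /u; ring.
  by field; rewrite gt_eqF.
by rewrite mulr_ge0 ?sqr_ge0 ?divr_ge0// ltW.
Qed.

(** The excess contracts at rate [th], so each unit of it that the noise
    creates is counted at most [1 / (1 - th)] times. *)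
Lemma ar_excess_sum (th A : R) x e n : 0 <= th < 1 -> 0 <= A ->
  (forall k, x k.+1 = th * x k + e k) ->
  \sum_(0 <= k < n.+1) Num.max (x k ^+ 2 - A) 0 <=
  (1 - th)^-1 * x 0%N ^+ 2 + ((1 - th) ^+ 2)^-1 *
    \sum_(0 <= k < n) Num.max (e k ^+ 2 - (1 - th) ^+ 2 * A) 0.
Proof.
move=> th01 A0 xe; have /andP[th0 th1] := th01; set u := 1 - th.
have u0 : 0 < u by rewrite /u; lra.
pose p k := Num.max (x k ^+ 2 - A) 0.
pose q k := Num.max (e k ^+ 2 - u ^+ 2 * A) 0.
have p0 k : 0 <= p k by rewrite le_max lexx orbT.
have pq k : p k.+1 <= th * p k + u^-1 * q k by rewrite /p xe; exact: ar_excess_step.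
have main : u * \sum_(0 <= k < n.+1) p k + th * p n <=
    p 0%N + u^-1 * \sum_(0 <= k < n) q k.
  elim: n => [|n ih].
    by rewrite big_nat1 big_geq// /u; lra.
  rewrite big_nat_recr//= [in leRHS]big_nat_recr//= !mulrDr.
  have := pq n; have : u * p n.+1 + th * p n.+1 = p n.+1 by rewrite /u; ring.
  by move: ih; lra.
have px : p 0%N <= x 0%N ^+ 2 by rewrite ge_max sqr_ge0 andbT gerBl.
have le1 : u * \sum_(0 <= k < n.+1) p k <= x 0%N ^+ 2 + u^-1 * \sum_(0 <= k < n) q k.
  by have : 0 <= th * p n by [rewrite mulr_ge0]; lra.
rewrite -(ler_pM2l u0); apply: (le_trans le1).
by rewrite mulrDr !mulrA divff ?gt_eqF// mul1r expr2 invfM mulrA divff ?gt_eqF// mul1r.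
Qed.

End ar_sequences.

Section ar_process.
Context d (T : measurableType d) (R : realType) (P : probability T R).
Variable xi : int -> {RV P >-> R}.
Hypothesis xi_iid : iid xi.
Local Notation mu := (distribution P (xi 0)).
Local Notation pastT := (pastT xi).

Lemma ge0_integral_noise i (f : R -> \bar R) :
  measurable_fun setT f -> (forall x, 0 <= f x)%E ->
  (\int[P]_w f (xi i w) = \int[mu]_x f x)%E.
Proof.
move=> mf f0; rewrite -(@ge0_integral_distribution _ _ _ _ _ P (xi i))//.
by apply: eq_measure_integral => A mA _; exact: xi_iid.2.
Qed.

Variables (al C : R).
Hypothesis al_gt0 : 0 < al.
Hypothesis noiseC : (\int[mu]_x (expR (al * x ^+ 2))%:E <= C%:E)%E.

Let mgauss (c : R) : measurable_fun setT (fun x : R => expR (c * x ^+ 2)).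
Proof. by apply: measurableT_comp => //; exact: measurable_funM. Qed.

Lemma noise_moment i : (mexp P (fun w => (al * xi i w ^+ 2)%R) <= C%:E)%E.
Proof.
rewrite /mexp (@ge0_integral_noise i (fun x => (expR (al * x ^+ 2))%:E))//.
by apply/measurable_EFinP; exact: mgauss.
Qed.

Variable th : R.
Hypothesis th01 : 0 <= th < 1.

Definition ar_trunc (N : nat) (i : int) (w : T) : R :=
  \sum_(0 <= p < N) th ^+ p * xi (i - p%:Z) w.

(** [stationary_ar] for a coefficient that does not vary with [n]. *)
Definition ar (k : nat) (w : T) : R :=
  limn (fun N => ar_trunc N k%:Z w).

Lemma ar_truncS N i w :
  ar_trunc N.+1 i w = th * ar_trunc N (i - 1) w + xi i w.
Proof.
rewrite /ar_trunc big_nat_recl//= expr0 mul1r subr0 addrC; congr (_ + _).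
rewrite mulr_sumr; apply: eq_bigr => p _; rewrite exprS -mulrA.
by rewrite -addrA -opprD -PoszD add1n.
Qed.

Lemma measurable_past_trunc k (i : int) N : i <= k%:Z ->
  measurable_fun [set: pastT k] (ar_trunc N i).
Proof.
move=> ik; apply: measurable_sum => p; apply: measurable_funM => //.
apply: measurable_past_xi; apply: le_trans ik.
by rewrite gerBl.
Qed.

Lemma measurable_past_ar k i : (i <= k)%N -> measurable_fun [set: pastT k] (ar i).
Proof.
move=> ik; apply: (@measurable_fun_limn _ (pastT k)) => N.
by apply: measurable_past_trunc; rewrite lez_nat.
Qed.

Lemma measurable_ar k : measurable_fun setT (ar k).
Proof. exact: (measurable_fun_past (measurable_past_ar (leqnn k))). Qed.

Lemma measurable_trunc i N : measurable_fun setT (ar_trunc N i).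
Proof.
by apply: measurable_sum => p; apply: measurable_funM.
Qed.

Definition ar_good : set T := cvg_set (fun N => ar_trunc N 0).

Lemma measurable_ar_good : measurable ar_good.
Proof. by apply: measurable_cvg_set => N; exact: measurable_trunc. Qed.

Let ar_cvg_step k w (l : R) : ar_trunc N k%:Z w @[N --> \oo] --> l ->
  ar_trunc N k.+1%:Z w @[N --> \oo] --> th * l + xi k.+1%:Z w.
Proof.
move=> kl; rewrite -(cvg_shiftS (fun N => ar_trunc N k.+1%:Z w)) /=.
have -> : (fun N => ar_trunc N.+1 k.+1 w) =
    (fun N => th * ar_trunc N k w + xi k.+1 w).
  by apply/funext => N; rewrite ar_truncS intS addrAC subrr add0r.
by apply: cvgD; [exact: cvgMl_tmp|exact: cvg_cst].
Qed.

Lemma ar_good_cvg k w : ar_good w -> ar_trunc N k%:Z w @[N --> \oo] --> ar k w.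
Proof.
move=> gw; elim: k => [|k ih]; first exact: gw.
apply: cvgP; exact: ar_cvg_step ih.
Qed.

Lemma ar_rec k w : ar_good w -> ar k.+1 w = th * ar k w + xi k.+1%:Z w.
Proof.
by move=> gw; have := ar_cvg_step (@ar_good_cvg k w gw); apply: cvg_lim.
Qed.

(** The geometric weights make [(1 - th)^2 X_k^2] at most an average of the
    squared noises, so it inherits their exponential moment by convexity. *)
Lemma trunc_moment N i :
  (mexp P (fun w => (al * ((1 - th) ^+ 2 * ar_trunc N i w ^+ 2))%R) <= C%:E)%E.
Proof.
have /andP[th0 th1] := th01; set u := 1 - th.
have u0 : 0 < u by rewrite /u; lra.
have mt N' i' : measurable_fun setT (fun w => al * (u ^+ 2 * ar_trunc N' i' w ^+ 2)).
  do 2 apply: measurable_funM => //.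
  by apply: measurable_funX; exact: measurable_trunc.
have mx i' : measurable_fun setT (fun w => al * xi i' w ^+ 2).
  by apply: measurable_funM => //; exact: measurable_funX.
elim: N i => [|N ih] i.
  have <- : mexp P (fun=> 0) = mexp P (fun w => al * (u ^+ 2 * ar_trunc 0 i w ^+ 2)).
    by congr mexp; apply/funext => w; rewrite /ar_trunc big_geq// expr0n !mulr0.
  apply: le_trans (noise_moment i); apply: le_mexp => // w.
  by rewrite mulr_ge0 ?sqr_ge0// ltW.
have pt w : expR (al * (u ^+ 2 * ar_trunc N.+1 i w ^+ 2)) <=
    th * expR (al * (u ^+ 2 * ar_trunc N (i - 1) w ^+ 2)) +
    u * expR (al * xi i w ^+ 2).
  set t := ar_trunc N (i - 1) w; set x := xi i w.
  have h1 : u ^+ 2 * ar_trunc N.+1 i w ^+ 2 <= th * (u ^+ 2 * t ^+ 2) + u * x ^+ 2.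
    rewrite ar_truncS -/t -/x -subr_ge0.
    have -> : th * (u ^+ 2 * t ^+ 2) + u * x ^+ 2 - u ^+ 2 * (th * t + x) ^+ 2 =
      th * u * (u * t - x) ^+ 2 by rewrite /u; ring.
    by rewrite mulr_ge0 ?sqr_ge0// mulr_ge0// ltW.
  set y := al * (u ^+ 2 * t ^+ 2); set z := al * x ^+ 2.
  have h2 : expR (al * (u ^+ 2 * ar_trunc N.+1 i w ^+ 2)) <= expR (th * (y - z)) * expR z.
    rewrite -expRD ler_expR; apply: (le_trans (ler_wpM2l (ltW al_gt0) h1)).
    by rewrite /y /z /u; lra.
  apply: (le_trans h2).
  apply: (le_trans (ler_wpM2r (expR_ge0 _) (@expR_convex0 R th (y - z) _))).
    by rewrite th0 ltW.
  by rewrite mulrDl -mulrA -expRD subrK /u addrC.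
have le1 : (mexp P (fun w => (al * (u ^+ 2 * ar_trunc N.+1 i w ^+ 2))%R) <=
   \int[P]_w (th%:E * (expR (al * (u ^+ 2 * ar_trunc N (i - 1) w ^+ 2)))%:E +
    u%:E * (expR (al * xi i w ^+ 2))%:E))%E.
  apply: ge0_le_integral => //.
  - exact: measurable_mexp.
  - by apply: emeasurable_funD; apply: measurable_funeM; exact: measurable_mexp.
  - by move=> w _; rewrite -!EFinM -EFinD lee_fin.
apply: (le_trans le1); rewrite ge0_integralD//; last 4 first.
- by move=> w _; rewrite mule_ge0 ?lee_fin ?expR_ge0.
- by apply: measurable_funeM; exact: measurable_mexp.
- by move=> w _; rewrite mule_ge0 ?lee_fin ?expR_ge0 ?ltW.
- by apply: measurable_funeM; exact: measurable_mexp.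
rewrite !ge0_integralZl_EFin ?(ltW u0)//; try exact: measurable_mexp.
apply: (@le_trans _ _ (th%:E * C%:E + u%:E * C%:E)%E).
  by apply: leeD; apply: lee_wpmul2l; rewrite ?lee_fin ?(ltW u0)//; [exact: ih|exact: noise_moment].
by rewrite -!EFinM -EFinD lee_fin /u; lra.
Qed.

(** Fatou's lemma carries the bound from the truncated series to the
    limit. *)
Lemma ar_moment k :
  (mexp P (fun w => (al * ((1 - th) ^+ 2 * ar k w ^+ 2))%R) <= C%:E)%E.
Proof.
pose D : set T := cvg_set (fun N => ar_trunc N k%:Z).
have mD : measurable D by apply: measurable_cvg_set => N; exact: measurable_trunc.
pose f N w := expR (al * ((1 - th) ^+ 2 * (\1_D w * ar_trunc N k%:Z w) ^+ 2)).
have mf N : measurable_fun setT (fun w => (f N w)%:E).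
  apply: measurable_mexp; do 2 apply: measurable_funM => //.
  apply: measurable_funX; apply: measurable_funM; last exact: measurable_trunc.
  exact: measurable_indic.
have fl w : (f N w)%:E @[N --> \oo] -->
    (expR (al * ((1 - th) ^+ 2 * ar k w ^+ 2)))%:E.
  apply/fine_cvgP; split; first exact: nearW.
  have h : \1_D w * ar_trunc N k%:Z w @[N --> \oo] --> ar k w.
    exact: cvg_indic_limn.
  have h2 : al * ((1 - th) ^+ 2 * (\1_D w * ar_trunc N k%:Z w) ^+ 2) @[N --> \oo] -->
      al * ((1 - th) ^+ 2 * ar k w ^+ 2).
    do 2 apply: cvgMl_tmp.
    by under eq_fun do rewrite expr2; rewrite expr2; apply: cvgM.
  have h3 := cvg_comp _ _ h2 (@continuous_expR R _).
  exact: h3.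
have -> : mexp P (fun w => al * ((1 - th) ^+ 2 * ar k w ^+ 2)) =
    (\int[P]_w limn_einf (fun N => (f N w)%:E))%E.
  apply: eq_integral => w _.
  by have [-> _] := cvg_limn_einf_sup (fl w).
apply: (le_trans (fatou P measurableT mf _)).
  by move=> N w _; rewrite lee_fin expR_ge0.
rewrite limn_einf_lim; apply: lime_le; first exact: is_cvg_einfs.
apply: nearW => N.
apply: (@le_trans _ _ (\int[P]_w (f N w)%:E)%E).
  by apply: ereal_inf_lbound; exists N => /=.
apply: le_trans (trunc_moment N k%:Z); apply: le_mexp.
- do 2 apply: measurable_funM => //.
  apply: measurable_funX; apply: measurable_funM; last exact: measurable_trunc.
  exact: measurable_indic.
- do 2 apply: measurable_funM => //.
  by apply: measurable_funX; exact: measurable_trunc.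
move=> w; rewrite ler_wpM2l ?(ltW al_gt0)// ler_wpM2l ?sqr_ge0//.
rewrite indicE; case: (w \in D); first by rewrite mul1r.
by rewrite mul0r expr0n sqr_ge0.
Qed.

(** [|x| <= 1 + x^2] is dominated by the integrable [exp (al x^2)], so the
    series converges absolutely almost surely. *)
Lemma ar_good_ae : P (~` ar_good) = 0%E.
Proof.
have /andP[th0 th1] := th01.
pose G w := (\sum_(0 <= p <oo) (th ^+ p * expR (al * xi (0 - p%:Z) w ^+ 2))%:E)%E.
have c0 p w : (0 <= (th ^+ p * expR (al * xi (0 - p%:Z) w ^+ 2))%:E)%E.
  by rewrite lee_fin mulr_ge0 ?exprn_ge0// expR_ge0.
have mxi p : measurable_fun setT
    (fun w => (th ^+ p * expR (al * xi (0 - p%:Z) w ^+ 2))%:E).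
  apply/measurable_EFinP; apply: measurable_funM => //.
  apply: measurableT_comp => //; apply: measurable_funM => //.
  exact: measurable_funX.
have mG : measurable_fun setT G by apply: ge0_emeasurable_sum.
have C0 : (0 <= C%:E)%E by apply: le_trans (noise_moment 0); exact: mexp_ge0.
have Gfin : (\int[P]_w G w < +oo)%E.
  rewrite integral_nneseries//.
  apply: (@le_lt_trans _ _ (\sum_(0 <= p <oo) (C * th ^+ p)%:E)%E).
    apply: lee_nneseries => [p _ _|p _]; first by apply: integral_ge0.
    under eq_integral do rewrite EFinM.
    rewrite ge0_integralZl//; last first.
      by rewrite lee_fin exprn_ge0.
      apply/measurable_EFinP; apply: measurableT_comp => //.
      by apply: measurable_funM => //; exact: measurable_funX.
    rewrite mulrC EFinM lee_wpmul2l ?lee_fin ?exprn_ge0//.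
    exact: noise_moment.
  have := @cvg_geometric_series R C th _.
  rewrite ger0_norm// => /(_ th1) cg.
  rewrite (_ : (fun _ => _) = EFin \o series (geometric C th)); last first.
    by apply/funext => n; rewrite /= /series/= -sumEFin.
  rewrite (cvg_lim _ (_ : _ --> (C * (1 - th)^-1)%:E))//; last first.
    by apply/fine_cvgP; split; [exact: nearW|exact: cg].
  exact: ltry.
have iG : P.-integrable setT G.
  apply/integrableP; split => //.
  by under eq_integral do rewrite gee0_abs ?nneseries_ge0//.
have [N [mN PN NG]] := integrable_ae measurableT iG.
apply: (@subset_measure0 _ _ _ P _ N) => //.
  by apply: measurableC; exact: measurable_ar_good.
apply: subset_trans NG => w /= + /(_ I) Gw; apply.
rewrite /ar_good /cvg_set/=.
pose a p : R := th ^+ p * xi (0 - p%:Z) w.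
apply: (@normed_cvg _ _ a).
pose c := Num.max 1 al^-1.
pose e p : R := th ^+ p * expR (al * xi (0 - p%:Z) w ^+ 2).
have ce : cvgn (series e).
  apply: nondecreasing_is_cvgn.
    apply: nondecreasing_series => p _ _.
    by rewrite mulr_ge0 ?exprn_ge0// expR_ge0.
  exists (fine (G w)) => _ [n _ <-].
  rewrite -lee_fin fineK// /series/= -sumEFin.
  by apply: nneseries_lim_ge => p _ _; exact: c0.
apply: (@series_le_cvg _ _ (fun p => c * e p)) => //.
- by move=> p /=; exact: normr_ge0.
- by move=> p /=; rewrite mulr_ge0 /e ?mulr_ge0 ?exprn_ge0 ?expR_ge0 ?le_max ?ler01.
- move=> p; rewrite /= /a /e normrM ger0_norm ?exprn_ge0// mulrCA.
  rewrite ler_wpM2l ?exprn_ge0//.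
  set x := xi _ w.
  have h1 := expR_ge1Dx (al * x ^+ 2).
  have h2 : 1 <= c by rewrite le_max lexx.
  have h3 : 1 <= c * al by rewrite -ler_pdivrMr// div1r le_max lexx orbT.
  have h4 : `|x| <= 1 + x ^+ 2.
    rewrite -(real_normK (num_real x)); have := sqr_ge0 (`|x| - 1); have := normr_ge0 x.
    by rewrite expr2 [_ ^+ 2]expr2; nra.
  apply: (le_trans h4); apply: (@le_trans _ _ (c * (1 + al * x ^+ 2))).
    by rewrite mulrDr mulr1 lerD// mulrA ler_peMl// sqr_ge0.
  by rewrite ler_wpM2l// (le_trans ler01).
- exact: (@is_cvg_seriesZ R e c ce).
Qed.

End ar_process.

(** * Exponential bounds at a fixed sample size *)

Lemma le_of_eq (disp : Order.disp_t) (T : porderType disp) (x y : T) :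
  x = y -> (x <= y)%O.
Proof. by move=> ->. Qed.

Section mexp_theory.
Context d (T : measurableType d) (R : realType) (P : probability T R).
Implicit Types f g : T -> R.

Lemma mexp0 : mexp P (fun=> 0) = 1%E.
Proof.
rewrite /mexp expR0 integral_cst// mul1e.
exact: probability_setT.
Qed.

Lemma mexpDr f (c : R) : measurable_fun setT f ->
  mexp P (fun w => f w + c) = (mexp P f * (expR c)%:E)%E.
Proof.
move=> mf; rewrite /mexp; under eq_integral do rewrite expRD EFinM.
by rewrite ge0_integralZr ?lee_fin ?expR_ge0//; exact: measurable_mexp.
Qed.

Lemma le_mexp_ae (D : set T) f g : measurable_fun setT f -> measurable_fun setT g ->
  measurable D -> P (~` D) = 0%E -> (forall w, D w -> f w <= g w) ->
  (mexp P f <= mexp P g)%E.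
Proof.
move=> mf mg mD PD fg; apply: ae_ge0_le_integral => //.
- exact: measurable_mexp.
- exact: measurable_mexp.
- exists (~` D); split => //; first exact: measurableC.
  by move=> w /= h Dw; apply: h => _; rewrite lee_fin ler_expR fg.
Qed.

Lemma chernoff_bound f (x c : R) : measurable_fun setT f -> (mexp P f <= c%:E)%E ->
  (P [set w | (x <= f w)%R] <= (c * expR (- x))%:E)%E.
Proof.
move=> mf fc; pose A := [set w | x <= f w].
have mA : measurable A.
  by rewrite -[A]setTI; apply: measurable_fun_le.
have h : ((expR x)%:E * P A <= c%:E)%E.
  apply: le_trans fc; have -> : P A = (\int[P]_w (\1_A w)%:E)%E by rewrite integral_indic// setIT.
  rewrite -ge0_integralZl_EFin ?expR_ge0//; last first.
  - by apply/measurable_EFinP; exact: measurable_indic.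
  apply: ge0_le_integral => //.
  - by apply: measurable_funeM; apply/measurable_EFinP; exact: measurable_indic.
  - exact: measurable_mexp.
  move=> w _; rewrite -EFinM lee_fin indicE.
  have [|_] := boolP (w \in A); last by rewrite mulr0 expR_ge0.
  by rewrite inE /A/= mulr1 ler_expR.
by rewrite expRN EFinM lee_pdivlMr ?expR_gt0// muleC.
Qed.

(** From [x y <= (x^2 + y^2) / 2]; additive, where Cauchy-Schwarz would be
    multiplicative, which is enough when one of the terms is bounded. *)
Lemma mexp_half f g : measurable_fun setT f -> measurable_fun setT g ->
  (mexp P (fun w => (f w + g w)%R) <=
   (2^-1)%:E * (mexp P (fun w => (2 * f w)%R) + mexp P (fun w => (2 * g w)%R)))%E.
Proof.
move=> mf mg.
have m2f : measurable_fun setT (fun w => 2 * f w) by exact: measurable_funM.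
have m2g : measurable_fun setT (fun w => 2 * g w) by exact: measurable_funM.
rewrite /mexp -ge0_integralD//; last 2 first.
- exact: measurable_mexp.
- exact: measurable_mexp.
rewrite -ge0_integralZl_EFin ?invr_ge0//; last 2 first.
- by move=> w _; rewrite adde_ge0 ?lee_fin ?expR_ge0.
- by apply: emeasurable_funD; exact: measurable_mexp.
apply: ge0_le_integral => //.
- by apply: measurable_mexp; exact: measurable_funD.
- by apply: measurable_funeM; apply: emeasurable_funD; exact: measurable_mexp.
move=> w _; rewrite -EFinD -EFinM lee_fin !expRM_natl expRD.
have := sqr_ge0 (expR (f w) - expR (g w)); lra.
Qed.

End mexp_theory.

Section ar_exponential_bounds.
Context d (T : measurableType d) (R : realType) (P : probability T R).
Variable xi : int -> {RV P >-> R}.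
Hypothesis xi_iid : iid xi.
Local Notation mu := (distribution P (xi 0)).
Local Notation pastT := (pastT xi).

Let mxi (g : R -> R) k : measurable_fun setT g ->
  measurable_fun setT (fun z : pastT k * R => g z.2).
Proof. by move=> mg; apply: measurableT_comp mg _; exact: measurable_snd. Qed.

Lemma mexp_iid_sum (L : T -> R) (g : R -> R) (c : R) n :
  measurable_fun [set: pastT 0] L -> measurable_fun setT g ->
  (\int[mu]_x (expR (g x))%:E <= (expR c)%:E)%E ->
  (mexp P (fun w => (L w + \sum_(0 <= k < n) g (xi k.+1%:Z w))%R) <=
   mexp P L * (expR (n%:R * c))%:E)%E.
Proof.
move=> mL mg gc.
have mgx k : measurable_fun setT (fun w => g (xi k%:Z w)) by exact: measurableT_comp.
have mLT : measurable_fun [set: T] L by exact: measurable_fun_past mL.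
have mgc : measurable_fun setT (fun x => g x - c) by exact: measurable_funB.
have -> : mexp P (fun w => L w + \sum_(0 <= k < n) g (xi k.+1%:Z w)) =
    (mexp P (fun w => L w + \sum_(0 <= k < n) (g (xi k.+1%:Z w) - c))%R *
    (expR (n%:R * c))%:E)%E.
  rewrite -mexpDr.
    congr mexp; apply/funext => w.
    by rewrite -addrA sumrB big_const_nat iter_addr_0 subn0 -[c *+ n]mulr_natl subrK.
  apply: measurable_funD => //; apply: measurable_sum => k.
  exact: measurable_funB.
apply: lee_wpmul2r; first by rewrite lee_fin expR_ge0.
apply: (@mexp_sum_le _ _ _ _ xi xi_iid L (fun k z => g z.2 - c)) => //.
  by move=> k; exact: (@mxi (fun x => g x - c) k mgc).
move=> k w _ /=.
under eq_integral do rewrite expRD EFinM.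
rewrite ge0_integralZr//; last first.
  by apply/measurable_EFinP; exact: measurableT_comp.
by rewrite expRN lee_pdivrMr ?expR_gt0// mul1e.
Qed.

Variable al : R.
Hypothesis al_gt0 : 0 < al.
Hypothesis exp_fin : (\int[mu]_x (expR (al * x ^+ 2))%:E < +oo)%E.
Hypothesis mean0 : (\int[mu]_x x%:E = 0)%E.
Local Notation C := (\int[mu]_x (expR (al * x ^+ 2))).
Local Notation var := (\int[mu]_x (x ^+ 2)).
Variable K : R.
Hypothesis K_gt0 : 0 < K.
Hypothesis cum_le : forall s, cumulant mu s <= K * s ^+ 2.
Hypothesis sq_le : forall s, 0 <= s <= al ->
  (\int[mu]_x (expR (s * x ^+ 2))%:E <= (expR (K * s))%:E)%E.

Let C_ge1 : 1 <= C. Proof. exact: gaussian_moment_ge1. Qed.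

Let noiseC : (\int[mu]_x (expR (al * x ^+ 2))%:E <= C%:E)%E.
Proof.
rewrite fineK// ge0_fin_numE//.
by apply: integral_ge0 => x _; rewrite lee_fin expR_ge0.
Qed.

Let mphi : measurable_fun setT (cumulant mu).
Proof. exact: measurable_cumulant. Qed.

(** The cumulant is the compensator of the exponential of a predictable
    transform of the noise. *)
Lemma mexp_martingale (U : nat -> T -> R) n :
  (forall k, measurable_fun [set: pastT k] (U k)) ->
  mexp P (fun w => \sum_(0 <= k < n) (U k w * xi k.+1%:Z w - cumulant mu (U k w))) = 1%E.
Proof.
move=> mU; pose h k (z : T * R) := U k z.1 * z.2 - cumulant mu (U k z.1).
transitivity (mexp P (fun w => 0 + \sum_(0 <= k < n) h k (w, xi k.+1%:Z w))).
  by congr mexp; apply/funext => w; rewrite add0r.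
rewrite (@mexp_sum_eq _ _ _ P xi xi_iid (fun=> 0) h) ?mexp0//.
  move=> k.
  have m1 : measurable_fun setT (fun z : pastT k * R => U k z.1).
    by apply: (measurableT_comp (mU k)); exact: measurable_fst.
  apply: measurable_funB; last exact: measurableT_comp mphi m1.
  by apply: measurable_funM => //; exact: measurable_snd.
by move=> k w _; exact: (mgf_cumulant al_gt0 exp_fin mean0 (U k w)).
Qed.

Variable th : R.
Hypothesis th01 : 0 <= th < 1.
Local Notation X := (ar xi th).
Local Notation u := (1 - th).

Let u_gt0 : 0 < u. Proof. by have /andP[_] := th01; rewrite subr_gt0. Qed.

Let mX k : measurable_fun setT (X k). Proof. exact: measurable_ar. Qed.

(** By [ar_excess_sum] with [A = 0], the energy of the path is bounded by the
    starting point and by the energy of the noise. *)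
Lemma mexp_sum_sqr be n : 0 <= be -> be <= al * u ^+ 3 ->
  (mexp P (fun w => (be * \sum_(0 <= k < n.+1) X k w ^+ 2)%R) <=
   (C * expR (K * be * n%:R / u ^+ 2))%:E)%E.
Proof.
move=> be0 beal.
have u1 : u <= 1 by have /andP[th0 _] := th01; rewrite gerBl.
pose L w := be / u * X 0%N w ^+ 2.
pose g (x : R) := be / u ^+ 2 * x ^+ 2.
have mg : measurable_fun setT g by exact: measurable_funM.
have mL : measurable_fun [set: pastT 0] L.
  apply: measurable_funM => //; apply: measurable_funX.
  by apply: measurable_past_ar.
have mLT : measurable_fun [set: T] L by exact: measurable_fun_past mL.
have b2 : be / u ^+ 2 <= al.
  rewrite ler_pdivrMr ?exprn_gt0//; apply: (le_trans beal).
  by rewrite ler_wpM2l ?(ltW al_gt0)// exprS ler_piMl// sqr_ge0.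
have b20 : 0 <= be / u ^+ 2 by rewrite divr_ge0// sqr_ge0.
have b1 : be / u <= al * u ^+ 2.
  by rewrite ler_pdivrMr// -mulrA -exprSr.
apply: (@le_trans _ _ (mexp P (fun w => (L w + \sum_(0 <= k < n) g (xi k.+1%:Z w))%R))).
  apply: (@le_mexp_ae _ _ _ _ (ar_good xi th)).
  - apply: measurable_funM => //; apply: measurable_sum => k.
    exact: measurable_funX.
  - apply: measurable_funD => //; apply: measurable_sum => k.
    exact: measurableT_comp.
  - exact: measurable_ar_good.
  - exact: (ar_good_ae xi_iid al_gt0 noiseC th01).
  move=> w gw.
  have := @ar_excess_sum R th 0 (fun k => X k w) (fun k => xi k.+1%:Z w) n th01
    (lexx 0) (fun k => ar_rec k gw).
  under eq_bigr do rewrite subr0 (max_idPl _) ?sqr_ge0//.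
  under [in leRHS]eq_bigr do rewrite mulr0 subr0 (max_idPl _) ?sqr_ge0//.
  move=> /(ler_wpM2l be0) h; apply: (le_trans h).
  by rewrite /L /g -mulr_sumr mulrDr !mulrA.
have gK := sq_le (introT andP (conj b20 b2)).
apply: (le_trans (mexp_iid_sum n mL mg gK)).
rewrite EFinM; apply: lee_pmul => //.
- exact: mexp_ge0.
- apply: le_trans (ar_moment xi_iid al_gt0 noiseC th01 0); apply: le_mexp => //.
    by do 2 apply: measurable_funM => //; exact: measurable_funX.
  by move=> w; rewrite [leRHS]mulrA; apply: ler_wpM2r => //; exact: sqr_ge0.
- by rewrite lee_fin ler_expR; apply: le_of_eq; ring.
Qed.

(** Add and subtract half the compensator at [2 s]: the martingale part
    has moment [1], and the compensator is bounded by the energy of [X]. *)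
Lemma mexp_transform (U : nat -> T -> R) s n :
  (forall k, measurable_fun [set: pastT k] (U k)) ->
  (forall w, \sum_(0 <= k < n) U k w ^+ 2 <= \sum_(0 <= k < n.+1) X k w ^+ 2) ->
  4 * K * s ^+ 2 <= al * u ^+ 3 ->
  (mexp P (fun w => (s * \sum_(0 <= k < n) U k w * xi k.+1%:Z w)%R) <=
   (C * expR (4 * K ^+ 2 * s ^+ 2 * n%:R / u ^+ 2))%:E)%E.
Proof.
move=> mU UX sal.
have mUT k : measurable_fun setT (U k) by exact: measurable_fun_past (mU k).
have msU k : measurable_fun [set: pastT k] (fun w => 2 * s * U k w).
  by apply: measurable_funM.
have msUT k : measurable_fun [set: T] (fun w => 2 * s * U k w).
  by apply: measurable_funM.
pose f w := 2^-1 * \sum_(0 <= k < n)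
  (2 * s * U k w * xi k.+1%:Z w - cumulant mu (2 * s * U k w)).
pose g w := 2^-1 * \sum_(0 <= k < n) cumulant mu (2 * s * U k w).
have mc : measurable_fun setT (fun w => \sum_(0 <= k < n) cumulant mu (2 * s * U k w)).
  by apply: measurable_sum => k; exact: measurableT_comp.
have mf : measurable_fun setT f.
  apply: measurable_funM => //; apply: measurable_sum => k.
  by apply: measurable_funB; [exact: measurable_funM|exact: measurableT_comp].
have mg : measurable_fun setT g by exact: measurable_funM.
have -> : (fun w => s * \sum_(0 <= k < n) U k w * xi k.+1%:Z w) = (fun w => f w + g w).
  apply/funext => w; rewrite /f /g -mulrDr -big_split/= !mulr_sumr.
  by apply: eq_bigr => k _; field.
apply: (le_trans (mexp_half P mf mg)).
have -> : (fun w => 2 * f w) = (fun w => \sum_(0 <= k < n)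
    (2 * s * U k w * xi k.+1%:Z w - cumulant mu (2 * s * U k w))).
  by apply/funext => w; rewrite /f mulrA divff// mul1r.
rewrite (mexp_martingale n msU).
have -> : (fun w => 2 * g w) = (fun w => \sum_(0 <= k < n) cumulant mu (2 * s * U k w)).
  by apply/funext => w; rewrite /g mulrA divff// mul1r.
have K0 : 0 <= K by exact: ltW.
have b0 : 0 <= 4 * K * s ^+ 2.
  by apply: mulr_ge0; [rewrite mulr_ge0|rewrite sqr_ge0].
have le1 : (mexp P (fun w => (\sum_(0 <= k < n) cumulant mu (2 * s * U k w))%R) <=
    (C * expR (4 * K ^+ 2 * s ^+ 2 * n%:R / u ^+ 2))%:E)%E.
  have -> : 4 * K ^+ 2 * s ^+ 2 * n%:R / u ^+ 2 =
    K * (4 * K * s ^+ 2) * n%:R / u ^+ 2 by ring.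
  apply: le_trans (mexp_sum_sqr n b0 sal); apply: le_mexp => //.
    apply: measurable_funM => //; apply: measurable_sum => k.
    exact: measurable_funX.
  move=> w; apply: le_trans (ler_wpM2l b0 (UX w)); rewrite mulr_sumr.
  apply: ler_sum => k _; apply: (le_trans (cum_le _)).
  by apply: le_of_eq; ring.
have c1 : 1 <= C * expR (4 * K ^+ 2 * s ^+ 2 * n%:R / u ^+ 2).
  have e1 : 1 <= expR (4 * K ^+ 2 * s ^+ 2 * n%:R / u ^+ 2).
    rewrite -[leLHS]expR0 ler_expR divr_ge0 ?sqr_ge0//.
    by do 2 apply: mulr_ge0 => //; rewrite ?sqr_ge0//; apply: mulr_ge0; rewrite ?sqr_ge0.
  by rewrite -[leLHS]mul1r ler_pM.
apply: (@le_trans _ _ ((2^-1)%:E * (1 + (C * expR (4 * K ^+ 2 * s ^+ 2 * n%:R / u ^+ 2))%:E))%E).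
  by rewrite lee_wpmul2l ?lee_fin ?invr_ge0// leeD2l.
by rewrite -EFinD -EFinM lee_fin; lra.
Qed.

End ar_exponential_bounds.

(** * Tail bounds *)

Section chernoff.
Context d (T : measurableType d) (R : realType) (P : probability T R).
Implicit Types f g : T -> R.

Lemma measurable_ge_set f x : measurable_fun setT f ->
  measurable [set w | (x <= f w)%R].
Proof.
by move=> mf; rewrite -[X in measurable X]setTI; apply: measurable_fun_le.
Qed.

Lemma chernoff_scaled f (s x c : R) : 0 < s -> measurable_fun setT f ->
  (mexp P (fun w => (s * f w)%R) <= c%:E)%E ->
  (P [set w | (x <= f w)%R] <= (c * expR (- (s * x)))%:E)%E.
Proof.
move=> s0 mf fc.
have -> : [set w | x <= f w] = [set w | s * x <= s * f w].
  by apply/seteqP; split => w /=; rewrite ler_pM2l.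
by apply: chernoff_bound => //; exact: measurable_funM.
Qed.

Lemma chernoff_two_sided f (s x c : R) : 0 < s -> measurable_fun setT f ->
  (mexp P (fun w => (s * f w)%R) <= c%:E)%E ->
  (mexp P (fun w => (- s * f w)%R) <= c%:E)%E ->
  (P [set w | (x <= `|f w|)%R] <= (2 * c * expR (- (s * x)))%:E)%E.
Proof.
move=> s0 mf fc fc'.
have mNf : measurable_fun setT (fun w => - f w) by exact: measurableT_comp.
have -> : [set w | x <= `|f w|] = [set w | x <= f w] `|` [set w | x <= - f w].
  by apply/seteqP; split => w /=; rewrite ler_normr; [move/orP|move=> h; apply/orP].
apply: (@le_trans _ _ (P [set w | (x <= f w)%R] + P [set w | (x <= - f w)%R])%E).
  by apply: measureU2; exact: measurable_ge_set.
rewrite (_ : 2 * c * _ = c * expR (- (s * x)) + c * expR (- (s * x))); last by ring.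
rewrite EFinD; apply: leeD; apply: chernoff_scaled => //.
by under eq_fun do rewrite mulrN -mulNr.
Qed.

End chernoff.

(** The hypotheses on the noise together with the consequences collected in
    [noise_bounds], for fixed constants. *)
Record exp_noise d (T : measurableType d) (R : realType) (P : probability T R)
    (xi : int -> {RV P >-> R}) (al K : R) : Prop := ExpNoise {
  en_iid : iid xi ;
  en_al : 0 < al ;
  en_fin : (\int[distribution P (xi 0%R)]_x (expR (al * x ^+ 2))%:E < +oo)%E ;
  en_mean : (\int[distribution P (xi 0%R)]_x x%:E = 0)%E ;
  en_K : 0 < K ;
  en_cum : forall s, cumulant (distribution P (xi 0%R)) s <= K * s ^+ 2 ;
  en_sq : forall s, 0 <= s <= al ->
    (\int[distribution P (xi 0%R)]_x (expR (s * x ^+ 2))%:E <= (expR (K * s))%:E)%E ;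
  en_exc : forall H,
    (\int[distribution P (xi 0%R)]_x (expR (al * Num.max (x ^+ 2 - H) 0))%:E <=
      (expR (K * expR (- (al * H))))%:E)%E ;
  en_bern : forall s, `|s| <= al / 2 ->
    (\int[distribution P (xi 0%R)]_x
       (expR (s * (x ^+ 2 - \int[distribution P (xi 0%R)]_y (y ^+ 2)))%R)%:E <=
     (expR (K * s ^+ 2))%:E)%E }.

Section tail_bounds.
Context d (T : measurableType d) (R : realType) (P : probability T R).
Variables (xi : int -> {RV P >-> R}) (al K : R).
Hypothesis N : exp_noise xi al K.
Local Notation mu := (distribution P (xi 0)).
Local Notation C := (\int[mu]_x (expR (al * x ^+ 2))).
Local Notation var := (\int[mu]_x (x ^+ 2)).

Lemma en_C_ge1 : 1 <= C. Proof. exact: (gaussian_moment_ge1 (en_al N) (en_fin N)). Qed.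

Lemma en_C : (\int[mu]_x (expR (al * x ^+ 2))%:E <= C%:E)%E.
Proof.
rewrite fineK// ge0_fin_numE ?(en_fin N)//.
by apply: integral_ge0 => x _; rewrite lee_fin expR_ge0.
Qed.

(** This martingale carries the whole large deviation behaviour. *)
Definition transform (th : R) (n : nat) (w : T) : R :=
  \sum_(0 <= k < n) ar xi th k w * xi k.+1%:Z w.

Definition total_cumulant (th t : R) (n : nat) (w : T) : R :=
  \sum_(0 <= k < n) cumulant mu (t * ar xi th k w).

Lemma measurable_transform th n : measurable_fun setT (transform th n).
Proof.
by apply: measurable_sum => k; apply: measurable_funM => //; exact: measurable_ar.
Qed.

Lemma measurable_total_cumulant th t n : measurable_fun setT (total_cumulant th t n).
Proof.
apply: measurable_sum => k; apply: measurableT_comp; first exact: measurable_cumulant.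
by apply: measurable_funM => //; exact: measurable_ar.
Qed.

Lemma square_tail th k x : 0 <= th < 1 ->
  (P [set w | (x <= ar xi th k w ^+ 2)%R] <=
   (C * expR (- (al * (1 - th) ^+ 2 * x)))%:E)%E.
Proof.
move=> th01; have u0 : 0 < 1 - th by case/andP: th01 => _; rewrite subr_gt0.
apply: chernoff_scaled.
- by rewrite mulr_gt0 ?(en_al N)// exprn_gt0.
- by apply: measurable_funX; exact: measurable_ar.
under eq_fun do rewrite -mulrA.
exact: (ar_moment (en_iid N) (en_al N) en_C th01).
Qed.

Lemma noise_square_tail s x n : 0 < s -> s <= al / 2 ->
  (P [set w | (x <= `|\sum_(0 <= k < n) (xi k.+1%:Z w ^+ 2 - var)|)%R] <=
   (2 * expR (K * s ^+ 2 * n%:R) * expR (- (s * x)))%:E)%E.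
Proof.
move=> s0 sal.
have bnd s' : `|s'| <= al / 2 ->
    (mexp P (fun w => (s' * \sum_(0 <= k < n) (xi k.+1%:Z w ^+ 2 - var))%R) <=
     (expR (K * s' ^+ 2 * n%:R))%:E)%E.
  move=> s'al.
  have mg : measurable_fun setT (fun x : R => s' * (x ^+ 2 - var)).
    by apply: measurable_funM => //; exact: measurable_funB.
  have := @mexp_iid_sum _ _ _ _ _ (en_iid N) (fun=> 0) _ (K * s' ^+ 2) n _ mg (en_bern N s'al).
  rewrite mexp0 mul1e [n%:R * _]mulrC => h.
  apply: le_trans (h _) => //.
  apply: le_of_eq; congr mexp; apply/funext => w.
  by rewrite add0r mulr_sumr.
apply: chernoff_two_sided => //.
- apply: measurable_sum => k; apply: measurable_funB => //.
  exact: measurable_funX.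
- by apply: bnd; rewrite ger0_norm// ltW.
- by have := bnd (- s); rewrite sqrrN normrN; apply; rewrite ger0_norm// ltW.
Qed.

Lemma noise_excess_tail H x n :
  (P [set w | (x <= \sum_(0 <= k < n) Num.max (xi k.+1%:Z w ^+ 2 - H) 0)%R] <=
   (expR (n%:R * (K * expR (- (al * H)))) * expR (- (al * x)))%:E)%E.
Proof.
have mm : measurable_fun setT (fun x : R => Num.max (x ^+ 2 - H) 0).
  by apply: measurable_maxr => //; exact: measurable_funB.
have mg : measurable_fun setT (fun x : R => al * Num.max (x ^+ 2 - H) 0).
  exact: measurable_funM.
have h := @mexp_iid_sum _ _ _ _ _ (en_iid N) (fun=> 0) _
  (K * expR (- (al * H))) n (measurable_cst _) mg (en_exc N H).
apply: chernoff_scaled; first exact: (en_al N).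
  by apply: measurable_sum => k; apply: (measurableT_comp mm).
rewrite mexp0 mul1e in h; apply: le_trans h.
apply: le_of_eq; congr mexp; apply/funext => w.
by rewrite add0r mulr_sumr.
Qed.

(** Stated for general weights [U] dominated in energy by [X], because the
    products at other lags are of this form too. *)
Lemma predictable_tail (U : nat -> T -> R) th s x n : 0 <= th < 1 -> 0 < s ->
  (forall k, measurable_fun [set: pastT xi k] (U k)) ->
  (forall w, \sum_(0 <= k < n) U k w ^+ 2 <= \sum_(0 <= k < n.+1) ar xi th k w ^+ 2) ->
  4 * K * s ^+ 2 <= al * (1 - th) ^+ 3 ->
  (P [set w | (x <= `|\sum_(0 <= k < n) U k w * xi k.+1%:Z w|)%R] <=
   (2 * (C * expR (4 * K ^+ 2 * s ^+ 2 * n%:R / (1 - th) ^+ 2)) *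
     expR (- (s * x)))%:E)%E.
Proof.
move=> th01 s0 mU UX hs.
have bnd s' : 4 * K * s' ^+ 2 <= al * (1 - th) ^+ 3 ->
    (mexp P (fun w => (s' * \sum_(0 <= k < n) U k w * xi k.+1%:Z w)%R) <=
    (C * expR (4 * K ^+ 2 * s' ^+ 2 * n%:R / (1 - th) ^+ 2))%:E)%E.
  exact: (mexp_transform (en_iid N) (en_al N) (en_fin N) (en_mean N)
    (en_K N) (en_cum N) (en_sq N) th01).
apply: chernoff_two_sided => //.
- apply: measurable_sum => k; apply: measurable_funM => //.
  exact: measurable_fun_past (mU k).
- exact: bnd.
- by have := bnd (- s); rewrite sqrrN; apply.
Qed.

Lemma transform_tail th s x n : 0 <= th < 1 -> 0 < s ->
  4 * K * s ^+ 2 <= al * (1 - th) ^+ 3 ->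
  (P [set w | (x <= `|transform th n w|)%R] <=
   (2 * (C * expR (4 * K ^+ 2 * s ^+ 2 * n%:R / (1 - th) ^+ 2)) *
     expR (- (s * x)))%:E)%E.
Proof.
move=> th01 s0; apply: predictable_tail => //.
- by move=> k; exact: measurable_past_ar.
- by move=> w; rewrite [leRHS]big_nat_recr//= lerDl sqr_ge0.
Qed.

End tail_bounds.

(** * Concentration of the total cumulant *)

Section concentration_arithmetic.
Variable R : realFieldType.
Implicit Types x y a : R.

Lemma norm_sub_le x y a : 0 <= x -> 0 <= y -> x <= a -> y <= a -> `|x - y| <= a.
Proof. by move=> *; rewrite ler_norml; apply/andP; split; lra. Qed.

(** [te] is the contribution of large values, [z] the relative deviation of
    the energy from its mean. *)
Lemma concentration_arith (K v L eps rho delta lb B F te z : R) :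
  0 < K -> 0 <= v -> L * (eps * (v + 4)) = delta / 2 ->
  L * (rho * (4 * K + 6 * v)) <= delta / 2 -> 0 < rho -> rho <= 1 -> 0 < eps ->
  0 <= lb -> 0 <= B -> lb <= L * B ->
  `|F - v * (lb * (v + z)) / 2| <= eps * (lb * (v + z)) + 2 * (K + v) * te ->
  te <= lb * (2 * rho) -> `|z| <= 4 * rho ->
  `|F - lb * v ^+ 2 / 2| <= delta * B.
Proof.
move=> K0 v0 epsE rhoE rho0 rho1 eps0 lb0 B0 lbL close tE2 zrho.
have KV : 0 <= 2 * (K + v) by lra.
have h1 := ler_wpM2l KV tE2.
have [z1 z2] : - (4 * rho) <= z /\ z <= 4 * rho.
  by move: zrho; rewrite ler_norml => /andP[].
have lv0 : 0 <= lb * v by rewrite mulr_ge0.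
have h2 := ler_wpM2l lv0 z1.
have h3 := ler_wpM2l lv0 z2.
have le0 : 0 <= lb * eps by rewrite mulr_ge0// ltW.
have h4 := ler_wpM2l le0 z2.
have h4' : lb * eps * (4 * rho) <= lb * eps * 4 by rewrite ler_wpM2l//; lra.
have g0 : 0 <= eps * (v + 4) + rho * (4 * K + 6 * v).
  by rewrite addr_ge0 ?mulr_ge0//; lra.
have h5 : lb * (eps * (v + 4) + rho * (4 * K + 6 * v)) <= delta * B.
  apply: (le_trans (ler_wpM2r g0 lbL)); rewrite mulrAC ler_wpM2r//.
  by rewrite mulrDr; lra.
move: close; rewrite !ler_norml => /andP[c1 c2].
by apply/andP; split; lra.
Qed.

End concentration_arithmetic.

Section total_cumulant.
Context d (T : measurableType d) (R : realType) (P : probability T R).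
Variables (xi : int -> {RV P >-> R}) (al K : R).
Hypothesis N : exp_noise xi al K.
Local Notation mu := (distribution P (xi 0)).
Local Notation C := (\int[mu]_x (expR (al * x ^+ 2))).
Local Notation var := (\int[mu]_x (x ^+ 2)).
Local Notation X := (ar xi).

Let var_ge0 : 0 <= var. Proof. by apply: Rintegral_ge0 => x _; exact: sqr_ge0. Qed.

(** Below [eta] the Taylor expansion applies.  Above it both terms are at
    most quadratic, and [(t x)^2 >= eta^2 >= 2 t^2 A] makes [x^2] at most
    twice its excess over [A]. *)
Lemma cumulant_close (eps eta : R) : 0 <= eps -> 0 < eta ->
  (forall s, `|s| <= eta -> `|cumulant mu s - var * s ^+ 2 / 2| <= eps * s ^+ 2) ->
  forall t A x : R, 2 * t ^+ 2 * A <= eta ^+ 2 ->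
  `|cumulant mu (t * x) - var * (t * x) ^+ 2 / 2| <=
  eps * (t ^+ 2 * x ^+ 2) + 2 * (K + var) * (t ^+ 2 * Num.max (x ^+ 2 - A) 0).
Proof.
move=> eps0 eta0 tay t A x tA; have K0 := en_K N; have v0 := var_ge0.
have KV : 0 <= 2 * (K + var) by lra.
have m0 : 0 <= Num.max (x ^+ 2 - A) 0 by rewrite le_max lexx orbT.
have [xs|xl] := leP `|t * x| eta.
  apply: (le_trans (tay _ xs)); rewrite exprMn lerDl.
  by apply: mulr_ge0 => //; apply: mulr_ge0 => //; exact: sqr_ge0.
have c0 : 0 <= cumulant mu (t * x).
  exact: (cumulant_ge0 (en_al N) (en_fin N) (en_mean N)).
have c1 := en_cum N (t * x).
have s2 : eta ^+ 2 <= (t * x) ^+ 2.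
  by rewrite -[leRHS]real_normK ?num_real// ler_sqr ?nnegrE// ltW.
have h1 : x ^+ 2 - A <= Num.max (x ^+ 2 - A) 0 by rewrite le_max lexx.
have h2 := ler_wpM2l (sqr_ge0 t) h1.
rewrite exprMn in s2 c1 *.
rewrite mulrBr in h2; rewrite -mulrA in tA.
have y0 : 0 <= t ^+ 2 * x ^+ 2 by rewrite mulr_ge0 ?sqr_ge0.
have z0 : 0 <= t ^+ 2 * Num.max (x ^+ 2 - A) 0 by rewrite mulr_ge0 ?sqr_ge0.
clear h1 m0 tay xl.
move: (t ^+ 2 * A) (eta ^+ 2) (t ^+ 2 * Num.max (x ^+ 2 - A) 0) tA s2 h2 z0.
move: (t ^+ 2 * x ^+ 2) (cumulant mu (t * x)) c0 c1 y0.
move: var v0 KV => v v0 KV y p c0 c1 y0 z q m h1 h2 h3 m0.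
have {h1 h2} h3 : y <= 2 * m by lra.
have e1 : 0 <= eps * y by rewrite mulr_ge0.
have e2 : K * y <= K * (2 * m) by rewrite ler_wpM2l// ltW.
have e3 : v * y <= v * (2 * m) by rewrite ler_wpM2l.
have e4 : 0 <= v * y by rewrite mulr_ge0.
have e5 : 0 <= K * y by rewrite mulr_ge0// ltW.
have -> : 2 * (K + v) * m = K * (2 * m) + v * (2 * m) by ring.
by rewrite ler_norml; apply/andP; split; lra.
Qed.

(** Summing [X_{k+1}^2 = th^2 X_k^2 + 2 th X_k xi_{k+1} + xi_{k+1}^2]. *)
Lemma energy_identity (th : R) n w : 0 <= th < 1 -> ar_good xi th w ->
  (1 - th ^+ 2) * (\sum_(0 <= k < n) X th k w ^+ 2) =
  X th 0 w ^+ 2 - X th n w ^+ 2 + 2 * th * transform xi th n w +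
  \sum_(0 <= k < n) xi k.+1%:Z w ^+ 2.
Proof.
move=> th01 gw; elim: n => [|n ih]; first by rewrite /transform !big_geq//; ring.
rewrite /transform !big_nat_recr//= -/(transform xi th n w) mulrDr ih.
by rewrite (ar_rec n gw); ring.
Qed.

(** The parameter for which [tilt * transform] is [lam b^2] times the
    normalized transform, and [tilt^2 \sum X_k^2] is of order [b^2]. *)
Definition tilt (lam b th : R) (n : nat) : R :=
  lam * b * Num.sqrt (1 - th ^+ 2) / Num.sqrt n%:R.

Lemma tilt_sqr (lam b th : R) n : 0 <= th < 1 ->
  tilt lam b th n ^+ 2 = lam ^+ 2 * b ^+ 2 * (1 - th ^+ 2) / n%:R.
Proof.
move=> /andP[th0 th1]; rewrite /tilt !exprMn exprVn !sqr_sqrtr//.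
by rewrite subr_ge0 expr_le1// ltW.
Qed.

(** By the energy identity [(1 - th^2) \sum X_k^2] is [n var] up to boundary
    terms, the transform and the centred squares of the noise, each of which
    exceeds [rho n] with probability at most [exp (- c n (1 - th)^2)]; the
    values of [X] too large for the Taylor expansion are controlled by their
    excess.  The factor [exp (c1 b^2 / (1 - th))] comes from the excess; it
    is dominated because [b^2 / (1 - th)] is of smaller order than
    [n (1 - th)^2]. *)
Lemma total_cumulant_concentration (lam delta : R) : 0 < delta ->
  exists2 c0 : R, 0 < c0 & exists c1 : R, forall (n : nat) (th b : R),
  (0 < n)%N -> 0 <= th < 1 -> 0 < b -> exists Bad : set T,
  [/\ measurable Bad,
      (P Bad <= (7 * C * expR (c1 * (b ^+ 2 / (1 - th)) - c0 * (n%:R * (1 - th) ^+ 2)))%:E)%E &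
      forall w, ~ Bad w ->
        `|total_cumulant xi th (tilt lam b th n) n w - lam ^+ 2 * b ^+ 2 * var ^+ 2 / 2|
        <= delta * b ^+ 2].
Proof.
move=> delta0; have al0 := en_al N; have K0 := en_K N; have v0 := var_ge0.
have C1 := en_C_ge1 N.
pose L := lam ^+ 2 + 1.
have L1 : 1 <= L by rewrite lerDr sqr_ge0.
pose eps := delta / (2 * L * (var + 4)).
pose rho := Num.min 1 (delta / (2 * L * (4 * K + 6 * var))).
have p1 : 0 < 2 * L * (var + 4) by rewrite mulr_gt0//; lra.
have p2 : 0 < 2 * L * (4 * K + 6 * var) by rewrite mulr_gt0//; lra.
have eps0 : 0 < eps by rewrite divr_gt0.
have rho0 : 0 < rho by rewrite lt_min ltr01 divr_gt0.
have rho1 : rho <= 1 by rewrite ge_min lexx.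
have epsE : L * (eps * (var + 4)) = delta / 2.
  by rewrite /eps; field; rewrite ?gt_eqF//; lra.
have rhoE : L * (rho * (4 * K + 6 * var)) <= delta / 2.
  have : rho <= delta / (2 * L * (4 * K + 6 * var)) by rewrite ge_min lexx orbT.
  by rewrite ler_pdivlMr//; lra.
have [eta eta0 tay] := cumulant_taylor al0 (en_fin N) (en_mean N) eps0.
(* [c (1 - th)^2] and [s] are the Chernoff parameters for the transform and
   for the squares of the noise. *)
pose c := Num.min 1 (Num.min (rho / (8 * K ^+ 2)) (al / (4 * K))).
have c_gt0 : 0 < c by rewrite !lt_min ltr01 !divr_gt0// ?mulr_gt0// exprn_gt0.
have c_1 : c <= 1 by rewrite ge_min lexx.
have c_rho : 8 * K ^+ 2 * c <= rho.
  have : c <= rho / (8 * K ^+ 2) by rewrite !ge_min lexx orbT.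
  by rewrite ler_pdivlMr ?mulr_gt0 ?exprn_gt0// mulrC.
have c_al : 4 * K * c <= al.
  have : c <= al / (4 * K) by rewrite !ge_min lexx !orbT.
  by rewrite ler_pdivlMr ?mulr_gt0// mulrC.
pose s := Num.min (al / 2) (rho / (2 * K)).
have s_gt0 : 0 < s by rewrite !lt_min !divr_gt0// mulr_gt0.
have s_al : s <= al / 2 by rewrite ge_min lexx.
have s_rho : 2 * K * s <= rho.
  have : s <= rho / (2 * K) by rewrite !ge_min lexx orbT.
  by rewrite ler_pdivlMr ?mulr_gt0// mulrC.
pose c0 := Num.min (al * rho / 2) (Num.min (c * rho / 2) (s * rho / 2)).
have c0_gt0 : 0 < c0 by rewrite !lt_min !divr_gt0// mulr_gt0.
have c0a : c0 <= al * rho / 2 by rewrite ge_min lexx.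
have c0b : c0 <= c * rho / 2 by rewrite !ge_min lexx orbT.
have c0c : c0 <= s * rho / 2 by rewrite !ge_min lexx !orbT.
pose c1 := 4 * K * L / (al * eta ^+ 2).
have c1_ge0 : 0 <= c1.
  apply: divr_ge0; first by rewrite !mulr_ge0//; lra.
  by apply: mulr_ge0; [exact: ltW|exact: sqr_ge0].
exists c0 => //; exists c1 => n th b n0 th01 b0.
have /andP[th0 th1] := th01.
set u := 1 - th.
have u0 : 0 < u by rewrite subr_gt0.
have u1 : u <= 1 by rewrite gerBl.
have nR : 0 < n%:R :> R by rewrite ltr0n.
(* Below the level [A], [|tilt * X_k|] is at most [eta]. *)
pose A := eta ^+ 2 * n%:R / (4 * L * b ^+ 2 * u).
have LL : 0 < L by lra.
have A_den : 0 < 4 * L * b ^+ 2 * u by rewrite !mulr_gt0// exprn_gt0.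
have A0 : 0 < A by rewrite divr_gt0// mulr_gt0// exprn_gt0.
pose H := u ^+ 2 * A.
pose B1 := [set w | (rho * n%:R / 2 <= X th 0 w ^+ 2)%R].
pose B2 := [set w | (rho * n%:R <= X th n w ^+ 2)%R].
pose B3 := [set w | (rho * n%:R <= `|transform xi th n w|)%R].
pose B4 := [set w | (rho * n%:R <= `|\sum_(0 <= k < n) (xi k.+1%:Z w ^+ 2 - var)|)%R].
pose B5 := [set w | (rho * n%:R * u / 2 <=
  \sum_(0 <= k < n) Num.max (xi k.+1%:Z w ^+ 2 - H) 0)%R].
have mB0 : measurable (~` ar_good xi th) by apply: measurableC; exact: measurable_ar_good.
have mB1 : measurable B1.
  by apply: measurable_ge_set; apply: measurable_funX; exact: measurable_ar.
have mB2 : measurable B2.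
  by apply: measurable_ge_set; apply: measurable_funX; exact: measurable_ar.
have mB3 : measurable B3.
  by apply: measurable_ge_set; apply: measurableT_comp => //; exact: measurable_transform.
have mB4 : measurable B4.
  apply: measurable_ge_set; apply: measurableT_comp => //.
  apply: measurable_sum => k; apply: measurable_funB => //.
  exact: measurable_funX.
have mB5 : measurable B5.
  apply: measurable_ge_set; apply: measurable_sum => k.
  apply: measurable_maxr => //; apply: measurable_funB => //.
  exact: measurable_funX.
pose e := n%:R * u ^+ 2.
have en : e <= n%:R by rewrite ler_piMr ?expr_le1// ltW.
have e0 : 0 <= e by rewrite mulr_ge0// ?sqr_ge0// ltW.
set v := b ^+ 2 / u.
have v_ge0 : 0 <= v by rewrite divr_ge0 ?sqr_ge0// ltW.
have cv : 0 <= c1 * v by rewrite mulr_ge0.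
set r := expR (c1 * v - c0 * e).
have bound (x y : R) : 0 <= x -> y <= c1 * v - c0 * e -> x * expR y <= x * r.
  by move=> x0 xy; rewrite ler_wpM2l// ler_expR.
have C0 : 0 <= C by lra.
have PB1 : (P B1 <= (C * r)%:E)%E.
  apply: (le_trans (square_tail N 0 _ th01)); rewrite lee_fin; apply: bound => //.
  have -> : al * (1 - th) ^+ 2 * (rho * n%:R / 2) = al * rho / 2 * e by rewrite /e -/u; ring.
  have := ler_wpM2r e0 c0a; lra.
have PB2 : (P B2 <= (C * r)%:E)%E.
  apply: (le_trans (square_tail N n _ th01)); rewrite lee_fin; apply: bound => //.
  have -> : al * (1 - th) ^+ 2 * (rho * n%:R) = al * rho * e by rewrite /e -/u; ring.
  have := ler_wpM2r e0 c0a.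
  have : 0 <= al * rho * e by rewrite !mulr_ge0// ltW.
  by rewrite [al * rho / 2 * e]mulrAC; lra.
have PB3 : (P B3 <= (2 * C * r)%:E)%E.
  have cu : 0 < c * u ^+ 2 by rewrite mulr_gt0// exprn_gt0.
  apply: (le_trans (transform_tail N _ n th01 cu _)).
    have -> : 4 * K * (c * u ^+ 2) ^+ 2 = (4 * K * c) * (c * u) * u ^+ 3 by ring.
    rewrite ler_wpM2r ?exprn_ge0 ?(ltW u0)//.
    have cu1 : c * u <= 1 by rewrite mulr_ile1// ltW.
    apply: (le_trans _ c_al); rewrite ler_piMr//.
    by rewrite !mulr_ge0// ltW.
  have E (x y : R) : 2 * (C * expR x) * expR y = 2 * C * expR (x + y) by rewrite expRD !mulrA.
  rewrite lee_fin -/u E; apply: bound; first by rewrite mulr_ge0.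
  have -> : 4 * K ^+ 2 * (c * u ^+ 2) ^+ 2 * n%:R / u ^+ 2 =
    (8 * K ^+ 2 * c) * (c * e) / 2 by rewrite /e; field; rewrite gt_eqF.
  have -> : c * u ^+ 2 * (rho * n%:R) = rho * (c * e) by rewrite /e; ring.
  have ce0 : 0 <= c * e by rewrite mulr_ge0// ltW.
  have := ler_wpM2r ce0 c_rho.
  have := ler_wpM2r e0 c0b.
  have -> : c * rho / 2 * e = rho * (c * e) / 2 by ring.
  lra.
have PB4 : (P B4 <= (2 * r)%:E)%E.
  apply: (le_trans (noise_square_tail N _ n s_gt0 s_al)).
  rewrite lee_fin -[leLHS]mulrA -expRD; apply: bound => //.
  have sn0 : 0 <= s * n%:R by rewrite mulr_ge0// ltW.
  have := ler_wpM2r sn0 s_rho.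
  have := ler_wpM2r e0 c0c.
  have : s * rho / 2 * e <= s * rho / 2 * n%:R.
    by rewrite ler_wpM2l// divr_ge0// mulr_ge0// ltW.
  have -> : K * s ^+ 2 * n%:R = 2 * K * s * (s * n%:R) / 2 by field.
  have -> : s * (rho * n%:R) = rho * (s * n%:R) by ring.
  have -> : s * rho / 2 * n%:R = rho * (s * n%:R) / 2 by ring.
  lra.
have PB5 : (P B5 <= r%:E)%E.
  apply: (le_trans (noise_excess_tail N H _ n)).
  rewrite lee_fin -expRD -[r]mul1r -[leLHS]mul1r; apply: bound => //.
  have H0 : 0 < al * H by rewrite mulr_gt0// mulr_gt0// exprn_gt0.
  (* This crude bound already turns [n exp (- al H)] into a multiple of
     [b^2 / (1 - th)]. *)
  have hH := expRN_le H0.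
  have h1 : n%:R * (K * expR (- (al * H))) <= c1 * v.
    apply: (@le_trans _ _ (n%:R * (K * (al * H)^-1))).
      by rewrite ler_wpM2l ?(ltW nR)// ler_wpM2l// ltW.
    rewrite le_eqVlt; apply/orP; left; apply/eqP.
    rewrite /c1 /v /H /A; field.
    by rewrite !gt_eqF.
  have -> : al * (rho * n%:R * u / 2) = al * rho / 2 * (n%:R * u) by ring.
  have h2 : al * rho / 2 * e <= al * rho / 2 * (n%:R * u).
    rewrite ler_wpM2l ?divr_ge0 ?mulr_ge0 ?(ltW al0) ?(ltW rho0)//.
    by rewrite ler_wpM2l ?(ltW nR)// expr2 ler_piMr// ltW.
  have := ler_wpM2r e0 c0a; lra.
have PB0 : (P (~` ar_good xi th) <= 0)%E.
  by rewrite (ar_good_ae (en_iid N) al0 (en_C N) th01).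
exists (~` ar_good xi th `|` B1 `|` B2 `|` B3 `|` B4 `|` B5); split.
- by do 5 apply: measurableU => //.
- apply: (@le_trans _ _ (0 + (C * r)%:E + (C * r)%:E + (2 * C * r)%:E + (2 * r)%:E + r%:E)%E).
    apply: le_trans (measureU2 _ _ _) _; [by do 4 apply: measurableU => //|by []|].
    apply: leeD => //; apply: le_trans (measureU2 _ _ _) _; [by do 3 apply: measurableU => //|by []|].
    apply: leeD => //; apply: le_trans (measureU2 _ _ _) _; [by do 2 apply: measurableU => //|by []|].
    apply: leeD => //; apply: le_trans (measureU2 _ _ _) _; [by apply: measurableU => //|by []|].
    apply: leeD => //; apply: le_trans (measureU2 _ _ _) _; [by []|by []|].
    exact: leeD.
  rewrite add0e -!EFinD lee_fin.
  have r0 : 0 <= r by exact: expR_ge0.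
  have : 3 * r <= 3 * C * r by rewrite ler_wpM2r//; lra.
  by lra.
move=> w nB.
have gw : ar_good xi th w by apply: contrapT => h; apply: nB; do 5 left.
have {}nB1 : X th 0 w ^+ 2 < rho * n%:R / 2.
  by rewrite ltNge; apply/negP => h; apply: nB; do 4 left; right.
have {}nB2 : X th n w ^+ 2 < rho * n%:R.
  by rewrite ltNge; apply/negP => h; apply: nB; do 3 left; right.
have {}nB3 : `|transform xi th n w| < rho * n%:R.
  by rewrite ltNge; apply/negP => h; apply: nB; do 2 left; right.
have {}nB4 : `|\sum_(0 <= k < n) (xi k.+1%:Z w ^+ 2 - var)| < rho * n%:R.
  by rewrite ltNge; apply/negP => h; apply: nB; left; right.
pose W5 := \sum_(0 <= k < n) Num.max (xi k.+1%:Z w ^+ 2 - H) 0.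
have {}nB5 : W5 < rho * n%:R * u / 2.
  by rewrite ltNge; apply/negP => h; apply: nB; right.
clear nB.
set t := tilt lam b th n.
have tE : t ^+ 2 = lam ^+ 2 * b ^+ 2 * (1 - th ^+ 2) / n%:R by exact: tilt_sqr.
pose Q := \sum_(0 <= k < n) X th k w ^+ 2.
pose E := \sum_(0 <= k < n) Num.max (X th k w ^+ 2 - A) 0.
have uE : 1 - th ^+ 2 = (1 + th) * u by rewrite /u; ring.
have lamL : lam ^+ 2 <= L by rewrite lerDl.
have tA : 2 * t ^+ 2 * A <= eta ^+ 2.
  have -> : 2 * t ^+ 2 * A = eta ^+ 2 * (lam ^+ 2 * (1 + th) / (2 * L)).
    rewrite tE uE /A; field.
    by rewrite (gt_eqF LL) (gt_eqF u0) (gt_eqF b0) (gt_eqF nR).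
  rewrite ler_piMr ?sqr_ge0// ler_pdivrMr ?mulr_gt0// mul1r mulrC.
  apply: ler_pM; rewrite ?sqr_ge0 ?addr_ge0//.
  by rewrite -[2]/(1 + 1) lerD2l ltW.
have close : `|total_cumulant xi th t n w - var * (t ^+ 2 * Q) / 2| <=
    eps * (t ^+ 2 * Q) + 2 * (K + var) * (t ^+ 2 * E).
  have -> : total_cumulant xi th t n w - var * (t ^+ 2 * Q) / 2 =
      \sum_(0 <= k < n) (cumulant mu (t * X th k w) - var * (t * X th k w) ^+ 2 / 2).
    rewrite sumrB /Q; congr (_ - _); move: var => v'.
    have -> : v' * (t ^+ 2 * \sum_(0 <= k < n) X th k w ^+ 2) / 2 =
      v' * t ^+ 2 / 2 * \sum_(0 <= k < n) X th k w ^+ 2 by ring.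
    by rewrite mulr_sumr; apply: eq_bigr => k _; ring.
  apply: (le_trans (ler_norm_sum _ _ _)).
  rewrite /Q /E ![t ^+ 2 * _]mulr_sumr ![_ * \sum_(0 <= k < n) _]mulr_sumr -big_split/=.
  by apply: ler_sum => k _; apply: (cumulant_close (ltW eps0) eta0 tay).
pose z := (X th 0 w ^+ 2 - X th n w ^+ 2 + 2 * th * transform xi th n w +
  \sum_(0 <= k < n) (xi k.+1%:Z w ^+ 2 - var)) / n%:R.
have tQ : t ^+ 2 * Q = lam ^+ 2 * b ^+ 2 * (var + z).
  have -> : t ^+ 2 * Q = lam ^+ 2 * b ^+ 2 / n%:R * ((1 - th ^+ 2) * Q).
    by rewrite tE; ring.
  rewrite energy_identity// /z sumrB big_const_nat iter_addr_0 subn0 -mulr_natr.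
  move: var (\sum_(0 <= k < n) _) => v' W.
  by field; rewrite gt_eqF.
have zrho : `|z| <= 4 * rho.
  rewrite /z normrM normfV [`|n%:R|]ger0_norm ?ler0n// ler_pdivrMr//.
  have h1 : `|X th 0 w ^+ 2 - X th n w ^+ 2| <= rho * n%:R.
    apply: norm_sub_le; rewrite ?sqr_ge0//; last exact: ltW.
    apply: (le_trans (ltW nB1)); rewrite ler_pdivrMr// ler_peMr// ?ler1n//.
    by rewrite mulr_ge0// ltW.
  have h2 : `|2 * th * transform xi th n w| <= 2 * (rho * n%:R).
    rewrite normrM ger0_norm ?mulr_ge0// -mulrA ler_wpM2l//.
    by apply: (le_trans _ (ltW nB3)); rewrite ler_piMl// ltW.
  apply: (le_trans (ler_normD _ _)); apply: (le_trans (lerD (ler_normD _ _) (lexx _))).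
  have h3 := ltW nB4; apply: (le_trans (lerD (lerD h1 h2) h3)).
  by apply: le_of_eq; ring.
have tE2 : t ^+ 2 * E <= lam ^+ 2 * b ^+ 2 * (2 * rho).
  have hE : E <= rho * n%:R / u.
    have := @ar_excess_sum R th A (fun k => X th k w) (fun k => xi k.+1%:Z w) n th01
      (ltW A0) (fun k => ar_rec k gw).
    rewrite big_nat_recr//= -/E -/u -/H => h.
    have m0 : 0 <= Num.max (X th n w ^+ 2 - A) 0 by rewrite le_max lexx orbT.
    apply: (@le_trans _ _ (u^-1 * (rho * n%:R / 2) + (u ^+ 2)^-1 * (rho * n%:R * u / 2))).
      have h1 : u^-1 * X th 0 w ^+ 2 <= u^-1 * (rho * n%:R / 2).
        by rewrite ler_wpM2l ?invr_ge0 ?(ltW u0) ?(ltW nB1).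
      have h2 : (u ^+ 2)^-1 * \sum_(0 <= k < n) Num.max (xi k.+1%:Z w ^+ 2 - H) 0 <=
          (u ^+ 2)^-1 * (rho * n%:R * u / 2).
        by rewrite ler_wpM2l ?invr_ge0 ?sqr_ge0 ?(ltW nB5).
      by apply: (le_trans _ (lerD h1 h2)); apply: (le_trans _ h); rewrite lerDl.
    by rewrite le_eqVlt; apply/orP; left; apply/eqP; field; rewrite gt_eqF.
  apply: (le_trans (ler_wpM2l (sqr_ge0 _) hE)); rewrite tE uE.
  have -> : lam ^+ 2 * b ^+ 2 * ((1 + th) * u) / n%:R * (rho * n%:R / u) =
    lam ^+ 2 * b ^+ 2 * ((1 + th) * rho) by field; rewrite !gt_eqF.
  have th2 : 1 + th <= 2 by rewrite -[2]/(1 + 1) lerD2l ltW.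
  apply: ler_wpM2l; first by apply: mulr_ge0; exact: sqr_ge0.
  by rewrite ler_wpM2r// ltW.
rewrite tQ in close.
have lb0 : 0 <= lam ^+ 2 * b ^+ 2 by rewrite mulr_ge0 ?sqr_ge0.
have b20 : 0 <= b ^+ 2 by exact: sqr_ge0.
have lbL : lam ^+ 2 * b ^+ 2 <= L * b ^+ 2 by rewrite ler_wpM2r.
exact: (concentration_arith K0 v0 epsE rhoE rho0 rho1 eps0 lb0 b20 lbL close tE2 zrho).
Qed.
End total_cumulant.

(** * The moment generating function of the transform *)

Section change_of_measure.
Context d (T : measurableType d) (R : realType) (P : probability T R).
Variables (F Phi : T -> R) (Bad : set T).
Hypothesis mF : measurable_fun setT F.
Hypothesis mPhi : measurable_fun setT Phi.
Hypothesis mBad : measurable Bad.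

Let mI : measurable_fun setT (\1_Bad : T -> R).
Proof. exact: measurable_indic. Qed.

Let meF : measurable_fun setT (fun w => (expR (F w) * \1_Bad w)%:E).
Proof.
by apply/measurable_EFinP; apply: measurable_funM => //; exact: measurableT_comp.
Qed.

(** [2 x 1_Bad <= exp (-a) x^2 + exp a 1_Bad]: a second moment and a small
    probability together control the exponential on the bad event. *)
Lemma exp_on_bad_le (a : R) :
  (\int[P]_w (expR (F w) * \1_Bad w)%:E <= (2^-1)%:E *
   ((expR (- a))%:E * mexp P (fun w => (2 * F w)%R) + (expR a)%:E * P Bad))%E.
Proof.
have -> : P Bad = (\int[P]_w (\1_Bad w)%:E)%E by rewrite integral_indic// setIT.
have m2 : measurable_fun setT (fun w => (expR (2 * F w))%:E).
  by apply: measurable_mexp; exact: measurable_funM.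
have m3 : measurable_fun setT (fun w => (\1_Bad w : R)%:E) by exact/measurable_EFinP.
have e0 (x : R) : (0 <= (expR x)%:E)%E by rewrite lee_fin expR_ge0.
have i0 w : (0 <= (\1_Bad w : R)%:E)%E by rewrite lee_fin.
rewrite -!ge0_integralZl_EFin ?expR_ge0//.
rewrite -ge0_integralD//; [|exact: measurable_funeM|exact: measurable_funeM].
rewrite -ge0_integralZl_EFin ?invr_ge0//; last 2 first.
- by move=> w _; rewrite adde_ge0// mule_ge0.
- by apply: emeasurable_funD; exact: measurable_funeM.
apply: ge0_le_integral => //.
- by apply: measurable_funeM; apply: emeasurable_funD; exact: measurable_funeM.
move=> w _.
change ((expR (F w) * \1_Bad w)%:E <=
  (2^-1 * (expR (- a) * expR (2 * F w) + expR a * \1_Bad w))%:E)%E.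
rewrite lee_fin.
have h0 : 0 <= 2^-1 * (expR (- a) * expR (2 * F w)) by rewrite !mulr_ge0 ?expR_ge0 ?invr_ge0.
rewrite indicE; case: (w \in Bad) => /=; last by rewrite !mulr0 addr0.
rewrite !mulr1.
have -> : expR (- a) * expR (2 * F w) = expR (F w - a / 2) ^+ 2 .
  by rewrite -expRD expr2 -expRD; congr expR; field.
have -> : expR a = expR (a / 2) ^+ 2 by rewrite expr2 -expRD; congr expR; field.
have -> : expR (F w) = expR (F w - a / 2) * expR (a / 2) by rewrite -expRD subrK.
have := sqr_ge0 (expR (F w - a / 2) - expR (a / 2)).
move: (expR _) (expR _) => x y; lra.
Qed.

Hypothesis F1 : mexp P (fun w => F w - Phi w) = 1%E.
Hypothesis Phi_ge0 : forall w, 0 <= Phi w.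
Variables lo hi tau : R.
Hypothesis Philohi : forall w, ~ Bad w -> lo <= Phi w <= hi.
Hypothesis Ftau : (\int[P]_w (expR (F w) * \1_Bad w)%:E <= tau%:E)%E.

Let mFPhi : measurable_fun setT (fun w => (expR (F w - Phi w))%:E).
Proof. by apply: measurable_mexp; exact: measurable_funB. Qed.

(** Off [Bad] one has [exp F <= exp hi * exp (F - Phi)], and the last factor
    has mean [1]. *)
Lemma mexp_upper : (mexp P F <= (expR hi + tau)%:E)%E.
Proof.
have i0 w : (0 <= (expR (F w) * \1_Bad w)%:E)%E by rewrite lee_fin mulr_ge0 ?expR_ge0.
apply: (@le_trans _ _ (\int[P]_w ((expR hi)%:E * (expR (F w - Phi w))%:E +
    (expR (F w) * \1_Bad w)%:E))%E).
  apply: ge0_le_integral => //.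
  - exact: measurable_mexp.
  - by apply: emeasurable_funD => //; exact: measurable_funeM.
  move=> w _; rewrite -EFinM -EFinD lee_fin indicE.
  have [_|] := boolP (w \in Bad); first by rewrite mulr1 lerDr mulr_ge0 ?expR_ge0.
  rewrite notin_setE => /Philohi/andP[_ h].
  by rewrite mulr0 addr0 -expRD ler_expR; lra.
rewrite ge0_integralD//; [|exact: measurable_funeM].
rewrite ge0_integralZl_EFin ?expR_ge0//.
by rewrite -/(mexp P (fun w => F w - Phi w)) F1 mule1 EFinD leeD2l.
Qed.

Lemma mexp_lower : (1 <= (expR (- lo))%:E * mexp P F + tau%:E)%E.
Proof.
have i0 w : (0 <= (expR (F w) * \1_Bad w)%:E)%E by rewrite lee_fin mulr_ge0 ?expR_ge0.
rewrite -[leLHS]F1.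
apply: (@le_trans _ _ (\int[P]_w ((expR (- lo))%:E * (expR (F w))%:E +
    (expR (F w) * \1_Bad w)%:E))%E); last first.
  rewrite ge0_integralD//; [|by apply: measurable_funeM; exact: measurable_mexp].
  rewrite ge0_integralZl_EFin ?expR_ge0//; last exact: measurable_mexp.
  by rewrite leeD2l.
apply: ge0_le_integral => //.
- by apply: emeasurable_funD => //; apply: measurable_funeM; exact: measurable_mexp.
move=> w _; rewrite -EFinM -EFinD lee_fin indicE.
have [_|] := boolP (w \in Bad).
  rewrite mulr1; apply: ler_wpDl; first by rewrite mulr_ge0 ?expR_ge0.
  by rewrite ler_expR gerBl.
rewrite notin_setE => /Philohi/andP[h _].
by rewrite mulr0 addr0 -expRD ler_expR; lra.
Qed.

End change_of_measure.

Section regime.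
Variable R : realType.

(** What remains of the hypotheses on the sequences at a fixed large [n], with
    a single parameter in place of three limits. *)
Definition regime (B : R) (n : nat) (th b : R) : Prop :=
  [/\ (0 < n)%N, 0 <= th < 1, B <= b, B * b ^+ 2 <= n%:R * (1 - th) ^+ 3 &
      B * (1 - th) <= 1].

Lemma regime_le (B B' : R) n th b : B <= B' -> regime B' n th b -> regime B n th b.
Proof.
move=> BB' [n0 th01 bB nb u1]; have /andP[_ th1] := th01.
split => //.
- exact: le_trans bB.
- by apply: le_trans nb; rewrite ler_wpM2r ?sqr_ge0.
- by apply: le_trans u1; rewrite ler_wpM2r// subr_ge0 ltW.
Qed.

End regime.

Section mgf_arithmetic.
Variable R : realFieldType.
Implicit Types x y z : R.

Lemma exponent_arith (D c0 c1 B v y : R) : 0 <= c0 -> 0 <= v ->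
  D + 2 + c1 <= c0 * B -> B * v <= y ->
  (D + 1) * v + (c1 * v - c0 * y) <= - v.
Proof.
move=> c00 v0 cB By.
have h1 := ler_wpM2l c00 By; have h2 := ler_wpM2r v0 cB.
lra.
Qed.

Lemma tail_arith x y : x <= 7 * y -> 8 * y <= 1 -> 2^-1 * (y + x) <= 2^-1.
Proof. by move=> h1 h2; lra. Qed.

Lemma lower_arith x y z : 0 < x -> 2 <= y -> 1 <= (x * y)^-1 * z + 2^-1 -> x <= z.
Proof.
move=> x0 y2 h; have y0 : 0 < y by lra.
have : 2^-1 <= z / (x * y) by rewrite mulrC; lra.
rewrite ler_pdivlMr ?mulr_gt0// => h'; apply: (le_trans _ h').
by rewrite mulrCA ler_peMr ?(ltW x0)//; lra.
Qed.

Lemma upper_arith x y z : 1 <= x -> 2 <= y -> z <= x + 2^-1 -> z <= x * y.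
Proof.
move=> x1 y2 h; have := ler_wpM2l (le_trans ler01 x1) y2; lra.
Qed.

End mgf_arithmetic.

Section mgf_transform.
Context d (T : measurableType d) (R : realType) (P : probability T R).
Variables (xi : int -> {RV P >-> R}) (al K : R).
Hypothesis N : exp_noise xi al K.
Local Notation mu := (distribution P (xi 0)).
Local Notation C := (\int[mu]_x (expR (al * x ^+ 2))).
Local Notation var := (\int[mu]_x (x ^+ 2)).

Lemma tilt_martingale th t n :
  mexp P (fun w => t * transform xi th n w - total_cumulant xi th t n w) = 1%E.
Proof.
have mU k : measurable_fun setT (fun w : pastT xi k => t * ar xi th k w).
  by apply: measurable_funM => //; exact: measurable_past_ar.
rewrite -[RHS](mexp_martingale (en_iid N) (en_al N) (en_fin N) (en_mean N) n mU).
congr mexp; apply/funext => w.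
rewrite sumrB /total_cumulant; congr (_ - _).
by rewrite /transform mulr_sumr; apply: eq_bigr => k _; rewrite mulrA.
Qed.

Lemma total_cumulant_ge0 th t n w : 0 <= total_cumulant xi th t n w.
Proof.
apply: sumr_ge0 => k _.
exact: (cumulant_ge0 (en_al N) (en_fin N) (en_mean N)).
Qed.

(** The bound on [s] under which [mexp_transform] holds, at [s = 2 tilt]. *)
Lemma tilt_small lam : exists B : R, forall n th b, regime B n th b ->
  4 * K * (2 * tilt lam b th n) ^+ 2 <= al * (1 - th) ^+ 3.
Proof.
have al0 := en_al N; have K0 := en_K N.
exists (32 * K * lam ^+ 2 / al) => n th b [n0 th01 bB nb u1].
have /andP[th0 th1] := th01.
have nR : 0 < n%:R :> R by rewrite ltr0n.
rewrite exprMn tilt_sqr//.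
set u := 1 - th in nb u1 *.
have u0 : 0 <= u by rewrite subr_ge0 ltW.
have u1' : u <= 1 by rewrite gerBl.
have uE : 1 - th ^+ 2 = (1 + th) * u by rewrite /u; ring.
rewrite uE.
have -> : 4 * K * (2 ^+ 2 * (lam ^+ 2 * b ^+ 2 * ((1 + th) * u) / n%:R)) =
  16 * (K * (lam ^+ 2 * b ^+ 2)) * ((1 + th) * u) / n%:R by ring.
rewrite ler_pdivrMr//.
have -> : al * u ^+ 3 * n%:R = al * (n%:R * u ^+ 3) by ring.
have h1 := ler_wpM2l (ltW al0) nb.
apply: (le_trans _ h1).
have -> : al * (32 * K * lam ^+ 2 / al * b ^+ 2) = 16 * (K * (lam ^+ 2 * b ^+ 2)) * 2.
  by field; rewrite gt_eqF.
have p0 : 0 <= 16 * (K * (lam ^+ 2 * b ^+ 2)).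
  apply: mulr_ge0 => //; apply: mulr_ge0; first exact: ltW.
  by apply: mulr_ge0; exact: sqr_ge0.
apply: ler_wpM2l => //.
rewrite -[leRHS]mulr1; apply: ler_pM => //; first by rewrite addr_ge0.
by rewrite -[2]/(1 + 1) lerD2l ltW.
Qed.

Lemma mexp_two_tilt lam : exists B : R, forall n th b, regime B n th b ->
  (mexp P (fun w => (2 * (tilt lam b th n * transform xi th n w))%R) <=
  (C * expR (32 * K ^+ 2 * lam ^+ 2 * (b ^+ 2 / (1 - th))))%:E)%E.
Proof.
have [B hB] := tilt_small lam; exists B => n th b rg.
have [n0 th01 bB nb u1] := rg; have /andP[th0 th1] := th01.
have u0 : 0 < 1 - th by rewrite subr_gt0.
have nR : 0 < n%:R :> R by rewrite ltr0n.
under eq_fun do rewrite mulrA.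
apply: (le_trans (mexp_transform (en_iid N) (en_al N) (en_fin N) (en_mean N)
    (en_K N) (en_cum N) (en_sq N) th01 (n := n) _ _ (hB _ _ _ rg))) => //.
- by move=> k; exact: measurable_past_ar.
- by move=> w; rewrite [leRHS]big_nat_recr//= lerDl sqr_ge0.
have C0 : 0 <= C by have := en_C_ge1 N; exact: le_trans.
rewrite lee_fin ler_wpM2l// ler_expR exprMn tilt_sqr//.
have -> : 4 * K ^+ 2 * (2 ^+ 2 * (lam ^+ 2 * b ^+ 2 * (1 - th ^+ 2) / n%:R)) * n%:R / (1 - th) ^+ 2
  = 16 * (K ^+ 2 * lam ^+ 2 * (b ^+ 2 / (1 - th))) * (1 + th).
  by field; rewrite !gt_eqF.
have -> : 32 * K ^+ 2 * lam ^+ 2 * (b ^+ 2 / (1 - th)) =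
  16 * (K ^+ 2 * lam ^+ 2 * (b ^+ 2 / (1 - th))) * 2 by ring.
apply: ler_wpM2l; last by rewrite -[2]/(1 + 1) lerD2l ltW.
apply: mulr_ge0 => //; apply: mulr_ge0; last by rewrite divr_ge0 ?sqr_ge0// ltW.
by apply: mulr_ge0; exact: sqr_ge0.
Qed.

(** The total cumulant is close to the constant [lam^2 b^2 var^2 / 2] off the
    bad event, so the mean-one martingale gives the moment there.  On the bad
    event, the second moment [exp (D v)], [v = b^2 / (1 - th)], loses against
    the probability [exp (c1 v - c0 n (1 - th)^2)], as [n (1 - th)^2 / v] is
    large. *)
Lemma mgf_transform (lam delta : R) : 0 < delta -> exists B : R,
  forall n th b, regime B n th b ->
  ((expR ((lam ^+ 2 * var ^+ 2 / 2 - delta) * b ^+ 2))%:E <=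
     mexp P (fun w => (tilt lam b th n * transform xi th n w)%R) <=
   (expR ((lam ^+ 2 * var ^+ 2 / 2 + delta) * b ^+ 2))%:E)%E.
Proof.
move=> delta0; have d2 : 0 < delta / 2 by rewrite divr_gt0.
have [c0 c00 [c1 conc]] := total_cumulant_concentration N lam d2.
have [B1 hB1] := mexp_two_tilt lam.
have C1 := en_C_ge1 N.
pose D := 32 * K ^+ 2 * lam ^+ 2.
have [B2 _ hB2] := constant_factor_le_expR (ler0n _ 2) d2.
pose B := Num.max B1 (Num.max 1 (Num.max (8 * C) (Num.max B2 ((D + 2 + c1) / c0)))).
exists B => n th b rg.
have rg1 : regime B1 n th b by apply: regime_le rg; rewrite le_max lexx.
have mom := hB1 _ _ _ rg1.
have [n0 th01 bB nb u1] := rg; have /andP[th0 th1] := th01.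
have Bge x : x <= B -> x <= b by move=> h; exact: le_trans bB.
have b1 : 1 <= b by apply: Bge; rewrite !le_max lexx ?orbT.
have b8 : 8 * C <= b by apply: Bge; rewrite !le_max lexx ?orbT.
have big2 : 2 <= expR (delta / 2 * b ^+ 2) by apply: hB2; apply: Bge; rewrite !le_max lexx ?orbT.
have b0 : 0 < b by exact: lt_le_trans ltr01 b1.
have b2 : b <= b ^+ 2 by rewrite expr2 ler_peMr// ltW.
have cB : D + 2 + c1 <= c0 * B.
  by rewrite mulrC -ler_pdivrMr// !le_max lexx ?orbT.
have nR : 0 < n%:R :> R by rewrite ltr0n.
set u := 1 - th in nb u1 *.
have u0 : 0 < u by rewrite subr_gt0.
have u1' : u <= 1 by rewrite gerBl.
set v := b ^+ 2 / u.
have v_b : b ^+ 2 <= v by rewrite ler_pdivlMr// ler_piMr ?sqr_ge0.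
have v0 : 0 < v by rewrite divr_gt0// exprn_gt0.
have nv : B * v <= n%:R * u ^+ 2.
  rewrite /v mulrA ler_pdivrMr//; apply: (le_trans nb).
  by rewrite -mulrA -exprSr.
have [Bad [mBad PBad close]] := conc n th b n0 th01 b0.
set t := tilt lam b th n in mom close *.
set L := lam ^+ 2 * var ^+ 2 / 2.
have F1 := tilt_martingale th t n.
have mS : measurable_fun setT (fun w => t * transform xi th n w).
  by apply: measurable_funM => //; exact: measurable_transform.
have mPhi := @measurable_total_cumulant _ _ _ _ xi th t n.
have lohi w : ~ Bad w -> (L - delta / 2) * b ^+ 2 <= total_cumulant xi th t n w <=
    (L + delta / 2) * b ^+ 2.
  move=> /close; rewrite ler_distl.
  have -> : lam ^+ 2 * b ^+ 2 * var ^+ 2 / 2 = L * b ^+ 2 by rewrite /L; move: var => z; ring.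
  by rewrite mulrBl mulrDl.
(* The weight [exp ((D + 1) v)] balances the second moment against the
   probability. *)
have tau : (\int[P]_w (expR (t * transform xi th n w) * \1_Bad w)%:E <= (2^-1)%:E)%E.
  apply: (le_trans (exp_on_bad_le P mS mBad ((D + 1) * v))).
  have C0 : 0 <= C by exact: (le_trans ler01 C1).
  apply: (@le_trans _ _ ((2^-1)%:E * ((expR (- ((D + 1) * v)))%:E *
      (C * expR (D * v))%:E + (expR ((D + 1) * v))%:E *
      (7 * C * expR (c1 * v - c0 * (n%:R * u ^+ 2)))%:E))%E).
    by apply: lee_wpmul2l => //; apply: leeD; apply: lee_wpmul2l => //;
      rewrite lee_fin expR_ge0.
  change ((2^-1 * (expR (- ((D + 1) * v)) * (C * expR (D * v)) +
    expR ((D + 1) * v) * (7 * C * expR (c1 * v - c0 * (n%:R * u ^+ 2)))))%:E <=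
    (2^-1)%:E)%E.
  rewrite lee_fin.
  have e1 : expR (- ((D + 1) * v)) * (C * expR (D * v)) = C * expR (- v).
    by rewrite mulrCA -expRD; congr (_ * expR _); ring.
  have e2 : expR ((D + 1) * v) * (7 * C * expR (c1 * v - c0 * (n%:R * u ^+ 2))) <=
      7 * C * expR (- v).
    rewrite mulrCA -expRD; apply: ler_wpM2l; first by rewrite mulr_ge0.
    rewrite ler_expR.
    exact: (exponent_arith (ltW c00) (ltW v0) cB nv).
  have C8 : 0 < 8 * C by rewrite mulr_gt0//; exact: (lt_le_trans ltr01 C1).
  have e3 : expR (- v) <= (8 * C)^-1.
    apply: (le_trans (expRN_le v0)); rewrite lef_pV2 ?posrE//.
    by apply: (le_trans b8); exact: (le_trans b2).
  have e4 : 8 * C * expR (- v) <= 1.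
    by rewrite mulrC -ler_pdivlMr// div1r.
  have e2' := e2; rewrite -[leRHS]mulrA in e2'.
  have e4' := e4; rewrite -[leLHS]mulrA in e4'.
  by rewrite e1; exact: (tail_arith e2' e4').
have phi0 := total_cumulant_ge0 th t n.
have up := mexp_upper mS mPhi mBad F1 lohi tau.
have low := mexp_lower mS mPhi mBad F1 phi0 lohi tau.
set m := mexp P _ in up low *.
have m0 : (0 <= m)%E by exact: mexp_ge0.
have mfin : m \is a fin_num.
  by rewrite ge0_fin_numE//; apply: le_lt_trans up _; exact: ltry.
move: up low; rewrite -(fineK mfin) -EFinM -EFinD !lee_fin => up low.
have E1 : expR ((L + delta) * b ^+ 2) = expR ((L + delta / 2) * b ^+ 2) * expR (delta / 2 * b ^+ 2).
  by rewrite -expRD; congr expR; field.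
have E2 : expR ((L - delta) * b ^+ 2) * expR (delta / 2 * b ^+ 2) = expR ((L - delta / 2) * b ^+ 2).
  by rewrite -expRD; congr expR; field.
have L0 : 0 <= L.
  by apply: divr_ge0 => //; apply: mulr_ge0; exact: sqr_ge0.
have one : 1 <= expR ((L + delta / 2) * b ^+ 2).
  rewrite -[leLHS]expR0 ler_expR; apply: mulr_ge0; last exact: sqr_ge0.
  by rewrite addr_ge0// ltW.
apply/andP; split.
  move: low; rewrite expRN -E2.
  exact: (lower_arith (expR_gt0 _) big2).
by rewrite E1; exact: (upper_arith one big2 up).
Qed.

End mgf_transform.

(** * Gaussian tails from a Gaussian moment generating function *)

Section tilting.
Context d (T : measurableType d) (R : realType) (P : probability T R).

(** Lower bound by tilting: under the weight [exp (lam c Z)] the variable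
    [Z] can leave [x1, x2] only at the cost of the mgf at [lam + h] and
    [lam - h]. *)
Lemma tilted_mass (Z : T -> R) (lam h c x1 x2 m1 m2 : R) :
  measurable_fun setT Z -> 0 <= lam -> 0 <= h -> 0 <= c ->
  (mexp P (fun w => ((lam + h) * c * Z w)%R) <= (expR m1)%:E)%E ->
  (mexp P (fun w => ((lam - h) * c * Z w)%R) <= (expR m2)%:E)%E ->
  (mexp P (fun w => (lam * c * Z w)%R) <=
   (expR (m1 - h * c * x2) + expR (m2 + h * c * x1))%:E +
   (expR (lam * c * x2))%:E * P [set w | (x1 <= Z w)%R])%E.
Proof.
move=> mZ lam0 h0 c0 hm1 hm2.
pose A := [set w | x1 <= Z w].
have mA : measurable A by exact: measurable_ge_set.
have ml y : measurable_fun setT (fun w => y * c * Z w) by exact: measurable_funM.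
have PA : P A = (\int[P]_w (\1_A w)%:E)%E by rewrite integral_indic// setIT.
pose f1 w := ((expR (- (h * c * x2)))%:E * (expR ((lam + h) * c * Z w))%:E)%E.
pose f2 w := ((expR (h * c * x1))%:E * (expR ((lam - h) * c * Z w))%:E)%E.
pose f3 w := ((expR (lam * c * x2))%:E * (\1_A w)%:E)%E.
have mI : measurable_fun setT (fun w => (\1_A w : R)%:E).
  by apply/measurable_EFinP; exact: measurable_indic.
have mf1 : measurable_fun setT f1.
  by apply: measurable_funeM; exact: measurable_mexp.
have mf2 : measurable_fun setT f2.
  by apply: measurable_funeM; exact: measurable_mexp.
have mf3 : measurable_fun setT f3 by exact: measurable_funeM.
have f10 w : (0 <= f1 w)%E by rewrite mule_ge0 ?lee_fin ?expR_ge0.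
have f20 w : (0 <= f2 w)%E by rewrite mule_ge0 ?lee_fin ?expR_ge0.
have f30 w : (0 <= f3 w)%E by rewrite mule_ge0 ?lee_fin ?expR_ge0.
apply: (@le_trans _ _ (\int[P]_w (f1 w + f2 w + f3 w))%E).
  apply: ge0_le_integral => //.
  - exact: measurable_mexp.
  - by do 2 apply: emeasurable_funD => //.
  move=> w _.
  change ((expR (lam * c * Z w))%:E <= (expR (- (h * c * x2)) * expR ((lam + h) * c * Z w) +
    expR (h * c * x1) * expR ((lam - h) * c * Z w) + expR (lam * c * x2) * \1_A w)%:E)%E.
  rewrite lee_fin -!expRD.
  have e1 : 0 <= expR (- (h * c * x2) + (lam + h) * c * Z w) by exact: expR_ge0.
  have e2 : 0 <= expR (h * c * x1 + (lam - h) * c * Z w) by exact: expR_ge0.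
  have e3 : 0 <= expR (lam * c * x2) * \1_A w by rewrite mulr_ge0// expR_ge0.
  have hc0 : 0 <= h * c by rewrite mulr_ge0.
  have [zx2|x2z] := leP (Z w) x2; last first.
    apply: (@le_trans _ _ (expR (- (h * c * x2) + (lam + h) * c * Z w))).
      by rewrite ler_expR; have := ler_wpM2l hc0 (ltW x2z); lra.
    by rewrite -addrA lerDl addr_ge0.
  have [x1z|zx1] := leP x1 (Z w).
    rewrite indicE mem_set// mulr1.
    apply: ler_wpDl; first exact: addr_ge0.
    by rewrite ler_expR ler_wpM2l// mulr_ge0.
  apply: (@le_trans _ _ (expR (h * c * x1 + (lam - h) * c * Z w))).
    by rewrite ler_expR; have := ler_wpM2l hc0 (ltW zx1); lra.
  by rewrite addrAC lerDr addr_ge0.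
rewrite ge0_integralD//; last 2 first.
- by move=> w _; rewrite adde_ge0.
- by apply: emeasurable_funD.
rewrite ge0_integralD// EFinD; apply: leeD; first apply: leeD.
- rewrite ge0_integralZl_EFin ?expR_ge0//; last exact: measurable_mexp.
  have -> : expR (m1 - h * c * x2) = expR (- (h * c * x2)) * expR m1.
    by rewrite -expRD addrC.
  by rewrite EFinM; apply: lee_wpmul2l => //; rewrite lee_fin expR_ge0.
- rewrite ge0_integralZl_EFin ?expR_ge0//; last exact: measurable_mexp.
  have -> : expR (m2 + h * c * x1) = expR (h * c * x1) * expR m2.
    by rewrite -expRD addrC.
  by rewrite EFinM; apply: lee_wpmul2l => //; rewrite lee_fin expR_ge0.
- by rewrite ge0_integralZl_EFin ?expR_ge0// PA.
Qed.

End tilting.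

Lemma mass_arith (R : realFieldType) (w v z : R) :
  0 < w -> 2 <= v -> w * v * v <= w + w + z -> w * v * v <= 2 * z.
Proof.
move=> w0 v2 hz.
have h1 : w * 2 <= w * v by rewrite ler_wpM2l// ltW.
have h2 : w * v * 2 <= w * v * v.
  by rewrite ler_wpM2l// mulr_ge0 ?(ltW w0)// (le_trans _ v2).
lra.
Qed.

Section gaussian_tails.
Context d (T : measurableType d) (R : realType) (P : probability T R).
Variable Z : nat -> R -> R -> T -> R.
Hypothesis mZ : forall n th b, measurable_fun setT (Z n th b).
Variable s : R.
Hypothesis s_gt0 : 0 < s.
Hypothesis mgfZ : forall lam delta : R, 0 < delta -> exists B : R,
  forall n th b, regime B n th b ->
  ((expR ((lam ^+ 2 * s / 2 - delta) * b ^+ 2))%:E <=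
     mexp P (fun w => (lam * b ^+ 2 * Z n th b w)%R) <=
   (expR ((lam ^+ 2 * s / 2 + delta) * b ^+ 2))%:E)%E.

Lemma gaussian_upper_tail (x delta : R) : 0 < x -> 0 < delta -> exists B : R,
  forall n th b, regime B n th b ->
  (P [set w | (x <= `|Z n th b w|)%R] <=
   (expR (- (x ^+ 2 / (2 * s) - delta) * b ^+ 2))%:E)%E.
Proof.
move=> x0 delta0; have d2 : 0 < delta / 2 by rewrite divr_gt0.
have [B1 h1] := mgfZ (x / s) d2; have [B2 h2] := mgfZ (- (x / s)) d2.
have [B3 _ h3] := constant_factor_le_expR (ler0n _ 2) d2.
exists (Num.max B1 (Num.max B2 (Num.max 1 B3))) => n th b rg.
have rg1 : regime B1 n th b by apply: regime_le rg; rewrite !le_max lexx ?orbT.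
have /andP[_ u1] := h1 n th b rg1.
have rg2 : regime B2 n th b by apply: regime_le rg; rewrite !le_max lexx ?orbT.
have /andP[_ u2] := h2 n th b rg2.
have [_ _ bB _ _] := rg.
have b1 : 1 <= b by apply: le_trans bB; rewrite !le_max lexx ?orbT.
have b0 : 0 < b by exact: lt_le_trans b1.
have sc0 : 0 < x / s * b ^+ 2 by rewrite mulr_gt0 ?divr_gt0 ?exprn_gt0.
have u2' : (mexp P (fun w => (- (x / s * b ^+ 2) * Z n th b w)%R) <=
    (expR (((x / s) ^+ 2 * s / 2 + delta / 2) * b ^+ 2))%:E)%E.
  by move: u2; rewrite sqrrN mulNr.
apply: (le_trans (chernoff_two_sided x sc0 (mZ n th b) u1 u2')).
rewrite lee_fin -mulrA -expRD.
have big2 : 2 <= expR (delta / 2 * b ^+ 2).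
  by apply: h3; apply: le_trans bB; rewrite !le_max lexx ?orbT.
apply: (le_trans (ler_wpM2r (expR_ge0 _) big2)).
rewrite -expRD ler_expR; apply: le_of_eq.
by field; rewrite gt_eqF.
Qed.

(** The tilt [lam = y / s] centres [Z] at [y = x + e]; tilting further by
    [+ h] and [- h], [h = e / s], shows that [Z] stays in [x, x + 2 e]. *)
Lemma gaussian_lower_tail (x delta : R) : 0 < x -> 0 < delta -> exists B : R,
  forall n th b, regime B n th b ->
  ((expR (- (x ^+ 2 / (2 * s) + delta) * b ^+ 2))%:E <=
   P [set w | (x <= Z n th b w)%R])%E.
Proof.
move=> x0 delta0.
(* Small enough for moving the target from [x] to [x + 2 e] to cost at most
   [delta / 2] in the exponent. *)
pose e := Num.min 1 (delta * s / (4 * (x + 1))).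
have x1 : 0 < x + 1 by rewrite addr_gt0.
have e0 : 0 < e by rewrite lt_min ltr01 divr_gt0 ?mulr_gt0.
have e1 : e <= 1 by rewrite ge_min lexx.
have ed : e * (4 * (x + 1)) <= delta * s.
  by rewrite -ler_pdivlMr ?mulr_gt0// ge_min lexx orbT.
(* [k] is a quarter of the gain [h e - h^2 s / 2] of the extra tilts. *)
pose y := x + e.
pose lam := y / s; pose h := e / s; pose k := e ^+ 2 / (8 * s).
have k0 : 0 < k by rewrite divr_gt0 ?exprn_gt0 ?mulr_gt0.
have lam0 : 0 <= lam by rewrite divr_ge0 ?addr_ge0 ?ltW.
have h0 : 0 <= h by rewrite divr_ge0 ?ltW.
have [B1 h1] := mgfZ lam k0; have [B2 h2] := mgfZ (lam + h) k0.
have [B3 h3] := mgfZ (lam - h) k0.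
have d2 : 0 < delta / 2 by rewrite divr_gt0.
have [B4 _ h4] := constant_factor_le_expR (ler0n _ 2) d2.
have [B5 _ h5] := constant_factor_le_expR (ler0n _ 2) k0.
exists (Num.max B1 (Num.max B2 (Num.max B3 (Num.max 1 (Num.max B4 B5))))) => n th b rg.
have rg1 : regime B1 n th b by apply: regime_le rg; rewrite !le_max lexx ?orbT.
have /andP[l1 _] := h1 n th b rg1.
have rg2 : regime B2 n th b by apply: regime_le rg; rewrite !le_max lexx ?orbT.
have /andP[_ u2] := h2 n th b rg2.
have rg3 : regime B3 n th b by apply: regime_le rg; rewrite !le_max lexx ?orbT.
have /andP[_ u3] := h3 n th b rg3.
have [_ _ bB _ _] := rg.
have b1 : 1 <= b by apply: le_trans bB; rewrite !le_max lexx ?orbT.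
have b0 : 0 < b by exact: lt_le_trans b1.
have bigk : 2 <= expR (k * b ^+ 2).
  by apply: h5; apply: le_trans bB; rewrite !le_max lexx ?orbT.
have bigd : 2 <= expR (delta / 2 * b ^+ 2).
  by apply: h4; apply: le_trans bB; rewrite !le_max lexx ?orbT.
have c0 : 0 <= b ^+ 2 by exact: sqr_ge0.
have := tilted_mass x (y + e) (mZ n th b) lam0 h0 c0 u2 u3.
move=> /(le_trans l1).
set p := P _ => hp.
have pfin : p \is a fin_num by rewrite fin_num_measure//; exact: measurable_ge_set.
rewrite -(fineK pfin) lee_fin.
move: hp; rewrite -(fineK pfin) -EFinM -EFinD lee_fin.
have p0 : 0 <= fine p by apply: fine_ge0; exact: measure_ge0.
set M := lam ^+ 2 * s / 2 * b ^+ 2.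
have E1 : ((lam + h) ^+ 2 * s / 2 + k) * b ^+ 2 - h * b ^+ 2 * (y + e) = M - 3 * (k * b ^+ 2).
  by rewrite /M /lam /h /k; field; rewrite gt_eqF.
have E2 : ((lam - h) ^+ 2 * s / 2 + k) * b ^+ 2 + h * b ^+ 2 * x = M - 3 * (k * b ^+ 2).
  by rewrite /M /lam /h /k /y; field; rewrite gt_eqF.
rewrite E1 E2.
have -> : (lam ^+ 2 * s / 2 - k) * b ^+ 2 = M - k * b ^+ 2 by rewrite mulrBl.
have D1 : expR (M - k * b ^+ 2) = expR (M - 3 * (k * b ^+ 2)) * expR (k * b ^+ 2) * expR (k * b ^+ 2).
  by rewrite -!expRD; congr expR; ring.
have half : expR (M - k * b ^+ 2) <= 2 * (expR (lam * b ^+ 2 * (y + e)) * fine p) ->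
    expR (- (x ^+ 2 / (2 * s) + delta) * b ^+ 2) <= fine p.
  move=> hh.
  have q0 : 0 < expR (lam * b ^+ 2 * (y + e)) by exact: expR_gt0.
  rewrite -(ler_pM2l q0) -(ler_pM2l (ltr0Sn R 1)).
  apply: le_trans hh.
  apply: (le_trans (ler_wpM2r _ bigd)); first by rewrite mulr_ge0 ?expR_ge0.
  rewrite -!expRD ler_expR -subr_ge0.
  have -> : M - k * b ^+ 2 - (delta / 2 * b ^+ 2 + (lam * b ^+ 2 * (y + e) +
      - (x ^+ 2 / (2 * s) + delta) * b ^+ 2)) =
      b ^+ 2 * ((delta * s - e * (4 * x + 13 / 4 * e)) / (2 * s)).
    by rewrite /M /lam /k /y; field; rewrite gt_eqF.
  apply: mulr_ge0 => //; apply: divr_ge0; last by rewrite mulr_ge0// ltW.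
  rewrite subr_ge0; apply: le_trans ed; rewrite ler_wpM2l ?(ltW e0)//.
  by have := ler_wpM2l (ler0n R 13) e1; lra.
move=> hp; apply: half; rewrite D1 in hp *.
exact: (mass_arith (expR_gt0 _) bigk hp).
Qed.

End gaussian_tails.

(** * Superexponentially negligible errors *)

Section negligible.
Context d (T : measurableType d) (R : realType) (P : probability T R).
Implicit Types E F : nat -> R -> R -> T -> R.

(** Superexponential negligibility at speed [b^2].  The covering event makes
    the notion insensitive to null sets and to measurability of [E]. *)
Definition negl E := forall delta L : R, 0 < delta -> 0 < L ->
  exists B : R, forall n th b, regime B n th b ->
  exists A : set T, [/\ measurable A, (P A <= (expR (- L * b ^+ 2))%:E)%E &
    forall w, ~ A w -> `|E n th b w| < delta].

Lemma regime_maxl (B B' : R) n th b : regime (Num.max B B') n th b -> regime B n th b.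
Proof. by apply: regime_le; rewrite le_max lexx. Qed.

Lemma regime_maxr (B B' : R) n th b : regime (Num.max B B') n th b -> regime B' n th b.
Proof. by apply: regime_le; rewrite le_max lexx orbT. Qed.

Lemma regime_ge B n (th b : R) : regime B n th b -> B <= b.
Proof. by case. Qed.

Lemma absorb (c L : R) : exists2 B : R, 1 <= B & forall b, B <= b ->
  c * expR (- (L + 1) * b ^+ 2) <= expR (- L * b ^+ 2).
Proof.
have [B B1 hB] := constant_factor_le_expR (normr_ge0 c) ltr01.
exists B => // b /hB h; apply: (le_trans (ler_wpM2r (expR_ge0 _) (le_trans (ler_norm c) h))).
by rewrite -expRD ler_expR; apply: le_of_eq; ring.
Qed.

Lemma negl_tail E :
  (forall n th b, measurable_fun setT (E n th b)) ->
  (forall delta : R, 0 < delta -> exists c : R, forall L : R, 0 < L ->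
     exists B : R, forall n th b, regime B n th b ->
     (P [set w | (delta <= `|E n th b w|)%R] <= (c * expR (- L * b ^+ 2))%:E)%E) ->
  negl E.
Proof.
move=> mE hE delta L delta0 L0.
have [c hc] := hE _ delta0.
have L1 : 0 < L + 1 by rewrite addr_gt0.
have [B1 h1] := hc _ L1; have [B2 _ h2] := absorb c L.
exists (Num.max B1 B2) => n th b rg.
exists [set w | delta <= `|E n th b w|]; split.
- by apply: measurable_ge_set; exact: measurableT_comp.
- apply: (le_trans (h1 _ _ _ (regime_maxl rg))); rewrite lee_fin.
  exact: h2 (regime_ge (regime_maxr rg)).
- by move=> w /negP; rewrite -ltNge.
Qed.

Lemma negl_le (c : R) E F : 0 < c -> negl F ->
  (exists B : R, forall n th b, regime B n th b -> exists A : set T,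
     [/\ measurable A, P A = 0%E &
       forall w, ~ A w -> `|E n th b w| <= c * `|F n th b w|]) ->
  negl E.
Proof.
move=> c0 nF [B1 h1] delta L delta0 L0.
have dc : 0 < delta / c by rewrite divr_gt0.
have [B2 h2] := nF _ _ dc L0.
exists (Num.max B1 B2) => n th b rg.
have [A1 [mA1 PA1 hA1]] := h1 _ _ _ (regime_maxl rg).
have [A2 [mA2 PA2 hA2]] := h2 _ _ _ (regime_maxr rg).
exists (A1 `|` A2); split.
- exact: measurableU.
- have PA1' : (P A1 <= 0)%E by rewrite PA1.
  apply: (le_trans (measureU2 _ mA1 mA2)); apply: (le_trans (leeD PA1' PA2)).
  by rewrite add0e.
move=> w nA; apply: (@le_lt_trans _ _ (c * `|F n th b w|)).
  by apply: hA1 => h; apply: nA; left.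
by rewrite mulrC -ltr_pdivlMr//; apply: hA2 => h; apply: nA; right.
Qed.

Lemma negl_add E F : negl E -> negl F -> negl (fun n th b w => E n th b w + F n th b w).
Proof.
move=> nE nF delta L delta0 L0.
have d2 : 0 < delta / 2 by rewrite divr_gt0.
have L1 : 0 < L + 1 by rewrite addr_gt0.
have [B1 h1] := nE _ _ d2 L1; have [B2 h2] := nF _ _ d2 L1.
have [B3 _ h3] := absorb 2 L.
exists (Num.max (Num.max B1 B2) B3) => n th b rg.
have rg12 := regime_maxl rg.
have [A1 [mA1 PA1 hA1]] := h1 _ _ _ (regime_maxl rg12).
have [A2 [mA2 PA2 hA2]] := h2 _ _ _ (regime_maxr rg12).
exists (A1 `|` A2); split.
- exact: measurableU.
- apply: (le_trans (measureU2 _ mA1 mA2)); apply: (le_trans (leeD PA1 PA2)).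
  rewrite -EFinD lee_fin -mulr2n -mulr_natl.
  exact: h3 (regime_ge (regime_maxr rg)).
move=> w nA; apply: (le_lt_trans (ler_normD _ _)); rewrite [ltRHS]splitr.
by apply: ltrD; [apply: hA1|apply: hA2] => h; apply: nA; [left|right].
Qed.

Lemma negl_cst (e : nat -> R -> R -> R) :
  (forall delta : R, 0 < delta -> exists B : R, forall n th b, regime B n th b ->
     `|e n th b| < delta) -> negl (fun n th b _ => e n th b).
Proof.
move=> he delta L delta0 L0; have [B hB] := he _ delta0.
exists B => n th b rg; exists set0; split => //.
  by rewrite measure0 lee_fin expR_ge0.
by move=> w _; exact: hB.
Qed.

Lemma negl0 : negl (fun _ _ _ _ => 0).
Proof. by apply: negl_cst => delta delta0; exists 0 => *; rewrite normr0. Qed.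

Lemma negl_sum m (E : nat -> nat -> R -> R -> T -> R) :
  (forall i, (i < m)%N -> negl (E i)) ->
  negl (fun n th b w => \sum_(0 <= i < m) E i n th b w).
Proof.
elim: m => [|m ih] hE.
  apply: (@negl_le 1 _ _ ltr01 negl0); exists 0 => n th b _; exists set0; split => //.
  by move=> w _; rewrite big_geq// mul1r.
have h1 : negl (fun n th b w => \sum_(0 <= i < m) E i n th b w + E m n th b w).
  apply: negl_add; last exact: hE.
  by apply: ih => i im; apply: hE; exact: ltnW.
apply: (@negl_le 1 _ _ ltr01 h1); exists 0 => n th b _; exists set0; split => //.
by move=> w _; rewrite big_nat_recr//= mul1r.
Qed.

End negligible.

Section scale.
Variable R : realType.
Implicit Types (n : nat) (th b : R).

(** The factor that normalizes the transform. *)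
Definition gfac n th b := Num.sqrt (1 - th ^+ 2) / (Num.sqrt n%:R * b).

Lemma gfac_sqr n th b : 0 <= th < 1 ->
  gfac n th b ^+ 2 = (1 - th ^+ 2) / (n%:R * b ^+ 2).
Proof.
move=> /andP[th0 th1]; rewrite /gfac exprMn exprVn exprMn !sqr_sqrtr//.
by rewrite subr_ge0 expr_le1// ltW.
Qed.

Lemma gfac_gt0 n th b : (0 < n)%N -> 0 <= th < 1 -> 0 < b -> 0 < gfac n th b.
Proof.
move=> n0 /andP[th0 th1] b0; rewrite divr_gt0 ?mulr_gt0 ?sqrtr_gt0 ?ltr0n//.
by rewrite subr_gt0 expr_lt1.
Qed.

Lemma one_sub_sqr th : 0 <= th < 1 -> 0 < 1 - th ^+ 2 <= 2 * (1 - th).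
Proof.
move=> /andP[th0 th1].
have -> : 1 - th ^+ 2 = (1 + th) * (1 - th) by ring.
have u0 : 0 < 1 - th by rewrite subr_gt0.
apply/andP; split; first by rewrite mulr_gt0// ltr_pwDl.
by rewrite ler_wpM2r ?(ltW u0)// -[2]/(1 + 1) lerD2l ltW.
Qed.

(** Writing [g] for [gfac], [(g b^2)^2 <= 2 (1 - th) b^2 / n], and [b^2 / n] is
    of smaller order than [(1 - th)^3].  This makes a single [X_k^2], of order [(1 - th)^-2]
    at most, negligible after normalization. *)
Lemma gfac_small (L : R) : 0 <= L -> exists2 B : R, 1 <= B & forall n th b, regime B n th b ->
  L * (gfac n th b * b ^+ 2) <= (1 - th) ^+ 2.
Proof.
move=> L0; exists (Num.max 1 (2 * L ^+ 2)); first by rewrite le_max lexx.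
move=> n th b [n0 th01 bB nb u1].
have b1 : 1 <= b by apply: le_trans bB; rewrite le_max lexx.
have b0 : 0 < b by exact: lt_le_trans ltr01 b1.
have nR : 0 < n%:R :> R by rewrite ltr0n.
have nb' : 2 * L ^+ 2 * b ^+ 2 <= n%:R * (1 - th) ^+ 3.
  by apply: le_trans nb; rewrite ler_wpM2r ?sqr_ge0// le_max lexx orbT.
have u0 : 0 < 1 - th by case/andP: th01 => _; rewrite subr_gt0.
have g0 := gfac_gt0 n0 th01 b0.
rewrite -ler_sqr ?nnegrE ?sqr_ge0//; last first.
  by apply: mulr_ge0 => //; apply: mulr_ge0; [exact: ltW|exact: sqr_ge0].
have -> : (L * (gfac n th b * b ^+ 2)) ^+ 2 = L ^+ 2 * (gfac n th b ^+ 2 * (b ^+ 2) ^+ 2).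
  by move: (gfac n th b) => x; ring.
rewrite gfac_sqr//.
have /andP[_ h2] := one_sub_sqr th01.
have -> : L ^+ 2 * ((1 - th ^+ 2) / (n%:R * b ^+ 2) * (b ^+ 2) ^+ 2) =
  L ^+ 2 * b ^+ 2 / n%:R * (1 - th ^+ 2) by field; rewrite !gt_eqF.
have p0 : 0 <= L ^+ 2 * b ^+ 2 / n%:R.
  by apply: divr_ge0 => //; apply: mulr_ge0; exact: sqr_ge0.
apply: (le_trans (ler_wpM2l p0 h2)).
rewrite -ler_pdivlMr ?mulr_gt0//.
rewrite ler_pdivrMr//.
have -> : ((1 - th) ^+ 2) ^+ 2 / (2 * (1 - th)) * n%:R = n%:R * (1 - th) ^+ 3 / 2.
  by field; rewrite gt_eqF.
by rewrite ler_pdivlMr//; apply: le_trans nb'; apply: le_of_eq; ring.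
Qed.

End scale.

(** * Negligible remainders *)

Lemma sub_le_opp (R : realDomainType) (x q y z : R) :
  x <= q -> q + q <= y -> z <= q -> x - y <= - z.
Proof. by move=> h1 h2 h3; lra. Qed.

Section remainder_tails.
Context d (T : measurableType d) (R : realType) (P : probability T R).
Variables (xi : int -> {RV P >-> R}) (al K : R).
Hypothesis N : exp_noise xi al K.
Local Notation mu := (distribution P (xi 0)).
Local Notation C := (\int[mu]_x (expR (al * x ^+ 2))).
Local Notation var := (\int[mu]_x (x ^+ 2)).

Lemma norm_scaled_set (g delta : R) (Y : T -> R) : 0 < g ->
  [set w | delta <= `|g * Y w|] = [set w | delta / g <= `|Y w|].
Proof.
move=> g0; apply/seteqP; split => w /=;
by rewrite normrM (gtr0_norm g0) ler_pdivrMr// mulrC.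
Qed.

Lemma regime_facts B n (th b : R) : 1 <= B -> regime B n th b ->
  [/\ 1 <= b, 0 < b, 0 < n%:R :> R, 0 < 1 - th <= 1 & B <= n%:R].
Proof.
move=> B1 [n0 th01 bB nb u1].
have /andP[th0 th1] := th01.
have b1 : 1 <= b by exact: le_trans bB.
have b0 : 0 < b by exact: lt_le_trans b1.
have nR : 0 < n%:R :> R by rewrite ltr0n.
have u0 : 0 < 1 - th by rewrite subr_gt0.
split => //; first by rewrite u0 gerBl.
apply: (@le_trans _ _ (B * b ^+ 2)).
  by rewrite ler_peMr ?(le_trans ler01 B1)// exprn_ege1.
apply: (le_trans nb); rewrite ler_piMr ?(ltW nR)// exprn_ile1 ?(ltW u0)//.
by rewrite gerBl.
Qed.

Lemma negl_square (Y : nat -> R -> T -> R) :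
  (forall n th, measurable_fun setT (Y n th)) ->
  (forall n th, 0 <= th < 1 ->
     (mexp P (fun w => (al * ((1 - th) ^+ 2 * Y n th w ^+ 2))%R) <= C%:E)%E) ->
  negl P (fun n th b w => gfac n th b * Y n th w ^+ 2).
Proof.
move=> mY hY; have mY2 n th : measurable_fun setT (fun w => Y n th w ^+ 2).
  exact: measurable_funX.
apply: negl_tail => [n th b|delta delta0]; first exact: measurable_funM.
exists C => L L0; have al0 := en_al N.
have L0' : 0 <= L / (al * delta) by rewrite divr_ge0 ?mulr_ge0 ?ltW.
have [B B1 hB] := gfac_small L0'.
exists B => n th b rg; have h := hB _ _ _ rg.
have [b1 b0 nR /andP[u0 _] _] := regime_facts B1 rg.
have [n0 th01 _ _ _] := rg.
have g0 := gfac_gt0 n0 th01 b0.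
rewrite norm_scaled_set//.
have -> : [set w | delta / gfac n th b <= `|Y n th w ^+ 2|] =
    [set w | delta / gfac n th b <= Y n th w ^+ 2].
  by apply/seteqP; split => w /=; rewrite ger0_norm ?sqr_ge0.
have s0 : 0 < al * (1 - th) ^+ 2 by rewrite mulr_gt0// exprn_gt0.
have := hY n th th01; under eq_fun do rewrite mulrA; move=> hs.
apply: (le_trans (chernoff_scaled _ s0 (mY2 n th) hs)); rewrite lee_fin.
have C0 : 0 <= C by exact: le_trans ler01 (en_C_ge1 N).
rewrite ler_wpM2l// ler_expR mulNr lerN2 mulrA ler_pdivlMr//.
move: h; rewrite mulrAC ler_pdivrMr ?mulr_gt0// mulrA => h.
by apply: (le_trans _ (le_trans h _)); apply: le_of_eq; ring.
Qed.

Lemma negl_ar_square (kap : nat -> nat) :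
  negl P (fun n th b w => gfac n th b * ar xi th (kap n) w ^+ 2).
Proof.
apply: (negl_square (Y := fun n th => ar xi th (kap n))) => [n th|n th th01].
  exact: measurable_ar.
exact: (ar_moment (en_iid N) (en_al N) (en_C N) th01).
Qed.

Lemma negl_noise_square (kap : nat -> int) :
  negl P (fun n th b w => gfac n th b * xi (kap n) w ^+ 2).
Proof.
apply: (negl_square (Y := fun n _ => xi (kap n))) => [//|n th /andP[th0 th1]].
apply: le_trans (noise_moment (en_iid N) (en_C N) (kap n)).
have m2 : measurable_fun setT (fun w => xi (kap n) w ^+ 2) by exact: measurable_funX.
apply: le_mexp => [||w]; [by do 2 apply: measurable_funM => //|exact: measurable_funM|].
rewrite ler_wpM2l ?(ltW (en_al N))// ler_piMl ?sqr_ge0// exprn_ile1 ?subr_ge0 ?(ltW th1)//.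
by rewrite gerBl.
Qed.

Lemma gfac_sqr_le n (th b a : R) : (0 < n)%N -> 0 <= th < 1 -> 0 < b ->
  (a * (gfac n th b * b ^+ 2)) ^+ 2 * n%:R <= 2 * a ^+ 2 * b ^+ 2 * (1 - th).
Proof.
move=> n0 th01 b0; have nR : 0 < n%:R :> R by rewrite ltr0n.
have -> : (a * (gfac n th b * b ^+ 2)) ^+ 2 * n%:R =
    a ^+ 2 * (gfac n th b ^+ 2 * (b ^+ 2) ^+ 2) * n%:R.
  by move: (gfac n th b) => x; ring.
rewrite gfac_sqr//.
have -> : a ^+ 2 * ((1 - th ^+ 2) / (n%:R * b ^+ 2) * (b ^+ 2) ^+ 2) * n%:R =
  a ^+ 2 * b ^+ 2 * (1 - th ^+ 2) by field; rewrite !gt_eqF.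
have /andP[_ h] := one_sub_sqr th01.
have p0 : 0 <= a ^+ 2 * b ^+ 2 by apply: mulr_ge0; exact: sqr_ge0.
by apply: (le_trans (ler_wpM2l p0 h)); apply: le_of_eq; ring.
Qed.

Lemma negl_centered_squares (l : nat) :
  negl P (fun n th b w => gfac n th b *
    \sum_(0 <= k < n - l) (xi k.+1%:Z w ^+ 2 - var)).
Proof.
have mW n : measurable_fun setT (fun w => \sum_(0 <= k < n - l) (xi k.+1%:Z w ^+ 2 - var)).
  by apply: measurable_sum => k; apply: measurable_funB => //; exact: measurable_funX.
apply: negl_tail => [n th b|delta delta0]; first exact: measurable_funM.
exists 2 => L L0; have al0 := en_al N; have K0 := en_K N.
(* With the Chernoff parameter [s = a g b^2], the event costs
   [exp (- (L + 1) b^2)], of which [b^2] pays for the moment. *)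
pose a := (L + 1) / delta.
have a0 : 0 < a by rewrite divr_gt0// addr_gt0.
exists (Num.max 1 (Num.max (2 * K * a ^+ 2) (8 * a ^+ 2 / al ^+ 2))) => n th b rg.
have B1 : 1 <= Num.max 1 (Num.max (2 * K * a ^+ 2) (8 * a ^+ 2 / al ^+ 2)).
  by rewrite le_max lexx.
have [b1 b0 nR /andP[u0 u1] _] := regime_facts B1 rg.
have [n0 th01 _ nb ub] := rg.
have g0 := gfac_gt0 n0 th01 b0.
pose s := a * (gfac n th b * b ^+ 2).
have s0 : 0 < s by rewrite mulr_gt0// mulr_gt0// exprn_gt0.
have sn := gfac_sqr_le a n0 th01 b0; rewrite -/s in sn.
have b20 : 0 <= b ^+ 2 by exact: sqr_ge0.
have Ku : 2 * K * a ^+ 2 * (1 - th) <= 1.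
  by apply: le_trans ub; rewrite ler_wpM2r ?(ltW u0)// !le_max lexx !orbT.
have sal : s <= al / 2.
  rewrite -ler_sqr ?nnegrE ?divr_ge0 ?(ltW s0) ?(ltW al0)//.
  rewrite -(ler_pM2r nR); apply: (le_trans sn).
  have nb' : 8 * a ^+ 2 / al ^+ 2 * b ^+ 2 <= n%:R.
    apply: (@le_trans _ _ (n%:R * (1 - th) ^+ 3)).
      by apply: le_trans nb; rewrite ler_wpM2r// !le_max lexx !orbT.
    by rewrite ler_piMr ?(ltW nR)// exprn_ile1// ltW.
  apply: (@le_trans _ _ (2 * a ^+ 2 * b ^+ 2)).
    by rewrite ler_piMr//; apply: mulr_ge0; [apply: mulr_ge0 => //|]; exact: sqr_ge0.
  have p : 0 <= (al / 2) ^+ 2 by exact: sqr_ge0.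
  apply: (le_trans _ (ler_wpM2l p nb')); apply: le_of_eq.
  by field; rewrite gt_eqF.
rewrite norm_scaled_set//.
apply: (le_trans (noise_square_tail N _ (n - l) s0 sal)).
rewrite lee_fin -mulrA -expRD ler_wpM2l// ler_expR.
have -> : s * (delta / gfac n th b) = (L + 1) * b ^+ 2.
  by rewrite /s /a; field; rewrite !gt_eqF.
have h1 : K * s ^+ 2 * (n - l)%:R <= b ^+ 2.
  have h2 : (n - l)%:R <= n%:R :> R by rewrite ler_nat leq_subr.
  have p : 0 <= K * s ^+ 2 by rewrite mulr_ge0 ?sqr_ge0// ltW.
  apply: (le_trans (ler_wpM2l p h2)); rewrite -mulrA.
  apply: (le_trans (ler_wpM2l (ltW K0) sn)).
  have -> : K * (2 * a ^+ 2 * b ^+ 2 * (1 - th)) = 2 * K * a ^+ 2 * (1 - th) * b ^+ 2 by ring.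
  by rewrite -[leRHS]mul1r ler_wpM2r.
rewrite mulNr mulrDl mul1r opprD addrCA gerDl.
by rewrite subr_le0.
Qed.

(** Delaying the weights by [j] writes [\sum_(1 <= k <= n) X_k xi_(k + j + 1)]
    as the transform [lagged] of a predictable sequence. *)
Definition lag_weight th (j k : nat) (w : T) : R :=
  if (j < k)%N then ar xi th (k - j) w else 0.

Definition lagged th (j n : nat) (w : T) : R :=
  \sum_(0 <= k < n + j.+1) lag_weight th j k w * xi k.+1%:Z w.

Lemma measurable_lag_weight th j k :
  measurable_fun [set: pastT xi k] (lag_weight th j k).
Proof.
rewrite /lag_weight; case: (j < k)%N => //.
by apply: measurable_past_ar; exact: leq_subr.
Qed.

Lemma lag_weight_sqr th j n w :
  \sum_(0 <= k < n + j.+1) lag_weight th j k w ^+ 2 <=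
  \sum_(0 <= k < (n + j.+1).+1) ar xi th k w ^+ 2.
Proof.
rewrite (big_cat_nat (n := j.+1) (m := 0%N) (p := (n + j.+1)%N))//=; last first.
  exact: leq_addl.
rewrite big_nat big1 ?add0r; last first.
  move=> k; rewrite ltnS /lag_weight => /andP[_ kj].
  by rewrite ltnNge kj expr0n.
rewrite -{1}[j.+1]add0n big_addn addnK big_nat_recl//.
rewrite (big_cat_nat (n := n) (m := 0%N) (p := (n + j.+1)%N))//=; last exact: leq_addr.
rewrite addrCA; apply: ler_wpDr.
  by rewrite addr_ge0 ?sqr_ge0// sumr_ge0// => k _; rewrite sqr_ge0.
apply: ler_sum => k _.
by rewrite /lag_weight addnS ltnS leq_addl subSn ?leq_addl// addnK.
Qed.

Lemma measurable_lagged th j n : measurable_fun setT (lagged th j n).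
Proof.
apply: measurable_sum => k; apply: measurable_funM => //.
exact: (measurable_fun_past (@measurable_lag_weight th j k)).
Qed.

(** [lagged] has the same size as the transform, and the extra factor
    [1 - th^2] tends to zero. *)
Lemma negl_lagged (l j : nat) : (j < l)%N ->
  negl P (fun n th b w => gfac n th b * ((1 - th ^+ 2) * lagged th j (n - l) w)).
Proof.
move=> jl.
apply: negl_tail => [n th b|delta delta0].
  by do 2 apply: measurable_funM => //; exact: measurable_lagged.
exists (2 * C) => L L0; have al0 := en_al N; have K0 := en_K N.
have C0 : 0 <= C by exact: le_trans ler01 (en_C_ge1 N).
(* Makes the exponent of the moment bound half the gain of the Chernoff
   bound; both are multiples of [b^2 / (1 - th)], which outgrows [L b^2]. *)
pose a := delta / (32 * K ^+ 2).
have a0 : 0 < a by rewrite divr_gt0// mulr_gt0// exprn_gt0.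
pose BB := Num.max 1 (Num.max (4 * L / (a * delta)) (Num.max (8 * K * a ^+ 2 / al) l%:R)).
exists BB => n th b rg.
have B1 : 1 <= BB by rewrite le_max lexx.
have [b1 b0 nR /andP[u0 u1] Bn] := regime_facts B1 rg.
have [n0 th01 _ nb ub] := rg.
have g0 := gfac_gt0 n0 th01 b0.
have ln : (l <= n)%N.
  by rewrite -(ler_nat R); apply: le_trans Bn; rewrite !le_max lexx !orbT.
pose s := a * (gfac n th b * b ^+ 2).
have s0 : 0 < s by rewrite mulr_gt0// mulr_gt0// exprn_gt0.
have sn := gfac_sqr_le a n0 th01 b0; rewrite -/s in sn.
have b20 : 0 <= b ^+ 2 by exact: sqr_ge0.
have Lu : 4 * L / (a * delta) * (1 - th) <= 1.
  by apply: le_trans ub; rewrite ler_wpM2r ?(ltW u0)// !le_max lexx !orbT.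
have q0 : 0 < gfac n th b * (1 - th ^+ 2).
  by have /andP[h _] := one_sub_sqr th01; rewrite mulr_gt0.
have hs : 4 * K * s ^+ 2 <= al * (1 - th) ^+ 3.
  rewrite -(ler_pM2r nR).
  have -> : 4 * K * s ^+ 2 * n%:R = 4 * K * (s ^+ 2 * n%:R) by ring.
  have K4 : 0 <= 4 * K by rewrite mulr_ge0// ltW.
  apply: (le_trans (ler_wpM2l K4 sn)).
  have nb' : 8 * K * a ^+ 2 / al * b ^+ 2 <= n%:R * (1 - th) ^+ 3.
    by apply: le_trans nb; rewrite ler_wpM2r// !le_max lexx !orbT.
  have -> : al * (1 - th) ^+ 3 * n%:R = al * (n%:R * (1 - th) ^+ 3) by ring.
  apply: (le_trans _ (ler_wpM2l (ltW al0) nb')).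
  have -> : al * (8 * K * a ^+ 2 / al * b ^+ 2) = 4 * K * (2 * a ^+ 2 * b ^+ 2).
    by field; rewrite gt_eqF.
  rewrite ler_wpM2l// ler_piMr//.
  by apply: mulr_ge0 => //; apply: mulr_ge0 => //; exact: sqr_ge0.
have -> : [set w | delta <= `|gfac n th b * ((1 - th ^+ 2) * lagged th j (n - l) w)|] =
    [set w | delta / (gfac n th b * (1 - th ^+ 2)) <= `|lagged th j (n - l) w|].
  by under eq_set do rewrite mulrA; rewrite norm_scaled_set.
apply: (le_trans (predictable_tail N _ th01 s0 _ _ hs)).
- exact: measurable_lag_weight.
- exact: lag_weight_sqr.
have E (x y : R) : 2 * (C * expR x) * expR y = 2 * C * expR (x + y) by rewrite expRD !mulrA.
rewrite lee_fin E ler_wpM2l ?mulr_ge0// ler_expR.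
have mn : (n - l + j.+1)%:R <= n%:R :> R.
  by rewrite ler_nat -[leqRHS](subnK ln) leq_add2l.
have h1 : 4 * K ^+ 2 * s ^+ 2 * (n - l + j.+1)%:R / (1 - th) ^+ 2 <=
    a * delta / 4 * (b ^+ 2 / (1 - th)).
  rewrite ler_pdivrMr ?exprn_gt0//.
  have p : 0 <= 4 * K ^+ 2 * s ^+ 2 by apply: mulr_ge0; [apply: mulr_ge0 => //|]; exact: sqr_ge0.
  apply: (le_trans (ler_wpM2l p mn)).
  have -> : 4 * K ^+ 2 * s ^+ 2 * n%:R = 4 * K ^+ 2 * (s ^+ 2 * n%:R) by ring.
  have p' : 0 <= 4 * K ^+ 2 by apply: mulr_ge0 => //; exact: sqr_ge0.
  apply: (le_trans (ler_wpM2l p' sn)); apply: le_of_eq.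
  by rewrite /a; field; rewrite !gt_eqF.
have h2 : a * delta / 2 * (b ^+ 2 / (1 - th)) <= s * (delta / (gfac n th b * (1 - th ^+ 2))).
  have /andP[v0 v1] := one_sub_sqr th01.
  have -> : s * (delta / (gfac n th b * (1 - th ^+ 2))) = a * delta * b ^+ 2 / (1 - th ^+ 2).
    by rewrite /s; field; rewrite !gt_eqF.
  have -> : a * delta / 2 * (b ^+ 2 / (1 - th)) = a * delta * b ^+ 2 / (2 * (1 - th)).
    by field; rewrite gt_eqF.
  apply: ler_wpM2l.
    by apply: mulr_ge0 => //; apply: mulr_ge0; exact: ltW.
  by rewrite lef_pV2// posrE// mulr_gt0.
have h3 : L * b ^+ 2 <= a * delta / 4 * (b ^+ 2 / (1 - th)).
  have ad : 0 < a * delta by rewrite mulr_gt0.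
  rewrite mulrA ler_pdivlMr// mulrAC ler_wpM2r//.
  have := ler_wpM2l (ltW ad) Lu.
  have -> : a * delta * (4 * L / (a * delta) * (1 - th)) = 4 * (L * (1 - th)).
    by field; rewrite !gt_eqF.
  by rewrite mulr1 ler_pdivlMr// mulrC.
rewrite mulNr; move: h1 h2 h3.
have -> : a * delta / 2 * (b ^+ 2 / (1 - th)) =
  a * delta / 4 * (b ^+ 2 / (1 - th)) + a * delta / 4 * (b ^+ 2 / (1 - th)) by field; rewrite gt_eqF.
exact: sub_le_opp.
Qed.

End remainder_tails.

(** * Means, and the covariance identity *)

Section integrability.
Context d (T : measurableType d) (R : realType) (P : probability T R).
Implicit Types f : T -> R.

Lemma integrable_rsum m (f : nat -> T -> R) :
  (forall i, (i < m)%N -> P.-integrable setT (EFin \o f i)) ->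
  P.-integrable setT (EFin \o (fun w => \sum_(0 <= i < m) f i w)).
Proof.
elim: m => [|m ih] hf.
  rewrite (_ : (fun _ => _) = cst 0); last by apply/funext => w; rewrite big_geq.
  exact: finite_measure_integrable_cst.
rewrite (_ : (fun _ => _) = fun w => \sum_(0 <= i < m) f i w + f m w); last first.
  by apply/funext => w; rewrite big_nat_recr.
apply: integrable_addr; last exact: hf.
by apply: ih => i im; apply: hf; exact: ltnW.
Qed.

Lemma Rintegral_rsum m (f : nat -> T -> R) :
  (forall i, (i < m)%N -> P.-integrable setT (EFin \o f i)) ->
  \int[P]_w (\sum_(0 <= i < m) f i w) = \sum_(0 <= i < m) \int[P]_w f i w.
Proof.
elim: m => [|m ih] hf.
  rewrite big_geq// (_ : (fun _ => _) = cst 0); last by apply/funext => w; rewrite big_geq.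
  by rewrite Rintegral_cst// mul0r.
have hf' i : (i < m)%N -> P.-integrable setT (EFin \o f i).
  by move=> im; apply: hf; exact: ltnW.
rewrite big_nat_recr//= -ih// -RintegralD//; last 2 first.
- exact: integrable_rsum.
- exact: hf.
by apply: eq_Rintegral => w _; rewrite big_nat_recr.
Qed.

Lemma Rintegral_probability_cst (c : R) : \int[P]_w (fun=> c) w = c.
Proof.
have e : fine (P setT) = 1 by rewrite (@probability_setT _ _ _ P).
by rewrite Rintegral_cst// [X in _ * X]e mulr1.
Qed.

Lemma integrable_square f (c M : R) : 0 < c -> measurable_fun setT f ->
  (mexp P (fun w => (c * f w ^+ 2)%R) <= M%:E)%E ->
  P.-integrable setT (EFin \o (fun w => f w ^+ 2)) /\
  \int[P]_w (f w ^+ 2) <= M / c.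
Proof.
move=> c0 mf fM.
have mf2 : measurable_fun setT (fun w => f w ^+ 2) by exact: measurable_funX.
have ie : P.-integrable setT (EFin \o (fun w => expR (c * f w ^+ 2))).
  apply/integrableP; split; first by apply: measurable_mexp; exact: measurable_funM.
  under eq_integral do rewrite /= ger0_norm ?expR_ge0//.
  by apply: le_lt_trans fM _; exact: ltry.
have ic := integrable_mulr c^-1 ie.
have pt w : f w ^+ 2 <= c^-1 * expR (c * f w ^+ 2).
  rewrite mulrC ler_pdivlMr// mulrC.
  by apply: le_trans (expR_ge1Dx _); rewrite lerDr.
have i2 : P.-integrable setT (EFin \o (fun w => f w ^+ 2)).
  apply: (le_integrable measurableT _ _ ic); first exact/measurable_EFinP.
  move=> w _ /=; rewrite lee_fin ger0_norm ?sqr_ge0//; apply: (le_trans (pt w)).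
  exact: ler_norm.
split => //.
apply: (@le_trans _ _ (\int[P]_w (c^-1 * expR (c * f w ^+ 2)))).
  exact: le_Rintegral.
rewrite RintegralZl// mulrC ler_wpM2r ?invr_ge0 ?(ltW c0)//.
rewrite -lee_fin fineK//; exact: integrable_fin_num.
Qed.

End integrability.

Lemma linear_quadratic_zero (R : realFieldType) (x c : R) : 0 <= c ->
  (forall s, s * x <= c * s ^+ 2) -> x = 0.
Proof.
move=> c0 h; apply/eqP/negP => /negP x0.
have c1 : 0 < c + 1 by rewrite ltr_wpDl.
have x2 : 0 < x ^+ 2 by rewrite exprn_even_gt0.
have := h (x / (c + 1)).
have -> : x / (c + 1) * x = x ^+ 2 / (c + 1) by ring.
have -> : c * (x / (c + 1)) ^+ 2 = x ^+ 2 / (c + 1) * (c / (c + 1)) by field; rewrite gt_eqF.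
rewrite -subr_ge0 -[X in _ - X]mulr1 -mulrBr pmulr_rge0 ?divr_gt0//.
rewrite subr_ge0 ler_pdivlMr// mul1r; lra.
Qed.

Section moments.
Context d (T : measurableType d) (R : realType) (P : probability T R).
Variables (xi : int -> {RV P >-> R}) (al K : R).
Hypothesis N : exp_noise xi al K.
Local Notation mu := (distribution P (xi 0)).
Local Notation C := (\int[mu]_x (expR (al * x ^+ 2))).
Local Notation var := (\int[mu]_x (x ^+ 2)).
Variable th : R.
Hypothesis th01 : 0 <= th < 1.
Local Notation X := (ar xi th).
Local Notation u := (1 - th).

Let u0 : 0 < u. Proof. by case/andP: th01 => _; rewrite subr_gt0. Qed.

(** The mean of [X_k^2] is at most of order [(1 - th)^-2]; this crude bound is
    enough for the boundary terms. *)
Lemma ar_square_integrable k : P.-integrable setT (EFin \o (fun w => X k w ^+ 2)) /\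
  \int[P]_w (X k w ^+ 2) <= C / (al * u ^+ 2).
Proof.
apply: integrable_square.
- by rewrite mulr_gt0 ?(en_al N)// exprn_gt0.
- exact: measurable_ar.
under eq_fun do rewrite -mulrA.
exact: (ar_moment (en_iid N) (en_al N) (en_C N) th01).
Qed.

Lemma noise_square_integrable i : P.-integrable setT (EFin \o (fun w => xi i w ^+ 2)).
Proof.
have [] // := integrable_square (en_al N) _ (noise_moment (en_iid N) (en_C N) i).
Qed.

Lemma noise_square_integral i : \int[P]_w (xi i w ^+ 2) = var.
Proof.
congr fine; rewrite (ge0_integral_noise (en_iid N) i (f := fun x => (x ^+ 2)%:E))//.
- by apply/measurable_EFinP; exact: exprn_measurable.
- by move=> x; rewrite lee_fin sqr_ge0.
Qed.

(** Compare, as the tilt tends to zero, the mean-one exponential of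
    [mexp_martingale] with [1 + x <= exp x]. *)
Lemma predictable_mean0 (U : nat -> T -> R) m :
  (forall k, measurable_fun [set: pastT xi k] (U k)) ->
  (forall w, \sum_(0 <= k < m) U k w ^+ 2 <= \sum_(0 <= k < m.+1) X k w ^+ 2) ->
  P.-integrable setT (EFin \o (fun w => \sum_(0 <= k < m) U k w * xi k.+1%:Z w)) /\
  \int[P]_w (\sum_(0 <= k < m) U k w * xi k.+1%:Z w) = 0.
Proof.
move=> mU UX.
have mUT k : measurable_fun [set: T] (U k) by exact: measurable_fun_past (mU k).
pose V w := \sum_(0 <= k < m) U k w * xi k.+1%:Z w.
pose W w := \sum_(0 <= k < m.+1) X k w ^+ 2.
have mV : measurable_fun setT V.
  by apply: measurable_sum => k; exact: measurable_funM.
have iW : P.-integrable setT (EFin \o W).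
  by apply: integrable_rsum => i _; have [] := ar_square_integrable i.
have iY : P.-integrable setT (EFin \o (fun w => \sum_(0 <= k < m) xi k.+1%:Z w ^+ 2)).
  by apply: integrable_rsum => i _; exact: noise_square_integrable.
have iV : P.-integrable setT (EFin \o V).
  apply: (le_integrable measurableT _ _ (integrable_addr iW iY)).
    exact/measurable_EFinP.
  move=> w _ /=; rewrite lee_fin.
  apply: le_trans (ler_norm _).
  apply: (@le_trans _ _ (\sum_(0 <= k < m) U k w ^+ 2 + \sum_(0 <= k < m) xi k.+1%:Z w ^+ 2)).
    rewrite -big_split/=; apply: (le_trans (ler_norm_sum _ _ _)).
    apply: ler_sum => k _; rewrite normrM.
    rewrite -[U k w ^+ 2]real_normK ?num_real// -[xi _ w ^+ 2]real_normK ?num_real//.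
    have := sqr_ge0 (`|U k w| - `|xi k.+1 w|); have := normr_ge0 (U k w).
    have := normr_ge0 (xi k.+1 w); move: `|U k w| `|xi k.+1 w| => x y; nra.
  by rewrite lerD2r.
split => //.
have K0 := en_K N.
have c0 : 0 <= K * \int[P]_w W w.
  apply: mulr_ge0; first exact: ltW.
  by apply: Rintegral_ge0 => w _; apply: sumr_ge0 => k _; exact: sqr_ge0.
apply: (linear_quadratic_zero c0) => s.
have msU k : measurable_fun [set: pastT xi k] (fun w => s * U k w) by exact: measurable_funM.
have mart := mexp_martingale (en_iid N) (en_al N) (en_fin N) (en_mean N) m msU.
pose F w := \sum_(0 <= k < m) (s * U k w * xi k.+1%:Z w - cumulant mu (s * U k w)).
have mF : measurable_fun setT F.
  apply: measurable_sum => k; apply: measurable_funB.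
    by do 2 apply: measurable_funM => //.
  by apply: measurableT_comp; [exact: measurable_cumulant|exact: measurable_funM].
have iF : P.-integrable setT (EFin \o (fun w => expR (F w))).
  apply/integrableP; split; first exact: measurable_mexp.
  under eq_integral do rewrite /= ger0_norm ?expR_ge0//.
  by rewrite -/(mexp P F) /F mart ltry.
have F1 : \int[P]_w (expR (F w)) = 1 by rewrite /Rintegral -/(mexp P F) /F mart.
have i1 := integrable_mulr s iV.
have i2 := integrable_mulr (- (K * s ^+ 2)) iW.
have i3 : P.-integrable setT (EFin \o (fun _ : T => 1 : R)) by exact: finite_measure_integrable_cst.
have i12 := integrable_addr i1 i2.
have : \int[P]_w (s * V w + - (K * s ^+ 2) * W w + 1) <= \int[P]_w (expR (F w)).
  apply: le_Rintegral => //; first exact: integrable_addr.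
  move=> w _; apply: le_trans (expR_ge1Dx _); rewrite addrC lerD2l.
  rewrite /F sumrB -/(V w) lerD//.
    by rewrite /V mulr_sumr; apply: ler_sum => k _; rewrite mulrA.
  rewrite mulNr lerN2.
  have h0 : 0 <= K * s ^+ 2 by apply: mulr_ge0; [exact: ltW|exact: sqr_ge0].
  apply: le_trans (ler_wpM2l h0 (UX w)); rewrite mulr_sumr.
  apply: ler_sum => k _; apply: (le_trans (en_cum N _)).
  by apply: le_of_eq; ring.
rewrite F1 RintegralD// RintegralD// !RintegralZl// Rintegral_probability_cst.
rewrite -lerBrDr subrr mulNr subr_le0 => h; apply: (le_trans h).
by rewrite mulrAC.
Qed.

Lemma transform_mean0 n :
  P.-integrable setT (EFin \o transform xi th n) /\ \int[P]_w (transform xi th n w) = 0.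
Proof.
apply: predictable_mean0.
- by move=> k; exact: measurable_past_ar.
- by move=> w; rewrite [leRHS]big_nat_recr//= lerDl sqr_ge0.
Qed.

Lemma lagged_mean0 j n :
  P.-integrable setT (EFin \o lagged xi th j n) /\ \int[P]_w (lagged xi th j n w) = 0.
Proof.
apply: predictable_mean0.
- exact: measurable_lag_weight.
- exact: lag_weight_sqr.
Qed.

Definition emp_cov (l n : nat) (w : T) : R :=
  (n - l)%:R^-1 * \sum_(1 <= k < (n - l).+1) (X (k + l) w * X k w).

Lemma measurable_emp_cov l n : measurable_fun setT (emp_cov l n).
Proof.
apply: measurable_funM => //; apply: measurable_sum => k.
by apply: measurable_funM; exact: measurable_ar.
Qed.

Lemma ar_iter k l w : ar_good xi th w ->
  X (k + l) w = th ^+ l * X k w + \sum_(0 <= j < l) th ^+ (l - j.+1) * xi (k + j).+1%:Z w.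
Proof.
move=> gw; elim: l => [|l ih]; first by rewrite addn0 expr0 mul1r big_geq// addr0.
rewrite addnS ar_rec// ih big_nat_recr//= subnn expr0 mul1r mulrDr addrA exprS mulrA.
congr (_ + _ + _); rewrite mulr_sumr; apply: eq_big_nat => j /= jl.
by rewrite mulrA -exprS -subSn.
Qed.

Lemma laggedE j n w :
  lagged xi th j n w = \sum_(1 <= k < n.+1) X k w * xi (k + j).+1%:Z w.
Proof.
rewrite /lagged (big_cat_nat (n := j.+1) (m := 0%N) (p := (n + j.+1)%N))//=; last first.
  exact: leq_addl.
rewrite big_nat big1 ?add0r; last first.
  move=> k; rewrite ltnS /lag_weight => /andP[_ kj].
  by rewrite ltnNge kj mul0r.
rewrite -{1}[j.+1]add1n big_addn addnS -addSn addnK.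
apply: eq_big_nat => k /andP[k1 _]; rewrite /lag_weight addnK.
by rewrite -{1}[j]add0n ltn_add2r k1.
Qed.

(** [(1 - th^2) n] times the covariance at lag [l] of a sample of size
    [n + l], without its mean; only the boundary squares are not centred. *)
Definition cov_noise (l n : nat) (w : T) : R :=
  th ^+ l * (th ^+ 2 * (X 0 w ^+ 2 - X n w ^+ 2) + 2 * th * transform xi th n w +
    \sum_(0 <= k < n) (xi k.+1%:Z w ^+ 2 - var)) +
  (1 - th ^+ 2) * \sum_(0 <= j < l) th ^+ (l - j.+1) * lagged xi th j n w.

(** Unfolding the recursion [l] times turns the lag-[l] products into
    [th^l X_k^2] plus products of [X] with later noises; the energy identity
    then expresses the sum of squares through the transform. *)
Lemma emp_covE l n w : ar_good xi th w -> (l < n)%N ->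
  emp_cov l n w = ((1 - th ^+ 2) * (n - l)%:R)^-1 *
    (cov_noise l (n - l) w + th ^+ l * ((n - l)%:R * var)).
Proof.
move=> gw ln; rewrite /emp_cov; set m := (n - l)%N.
have m0 : 0 < m%:R :> R by rewrite ltr0n subn_gt0.
have /andP[v0 _] := one_sub_sqr th01.
have -> : \sum_(1 <= k < m.+1) X (k + l) w * X k w =
  th ^+ l * \sum_(1 <= k < m.+1) X k w ^+ 2 +
  \sum_(0 <= j < l) th ^+ (l - j.+1) * lagged xi th j m w.
  under [X in _ = _ + X]eq_bigr do rewrite laggedE mulr_sumr.
  rewrite exchange_big/= mulr_sumr -big_split/=; apply: eq_bigr => k _.
  rewrite ar_iter// mulrDl mulr_suml -mulrA -expr2; congr (_ + _).
  by apply: eq_bigr => j _; ring.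
have -> : \sum_(1 <= k < m.+1) X k w ^+ 2 =
    \sum_(0 <= k < m) X k w ^+ 2 + X m w ^+ 2 - X 0 w ^+ 2.
  have : \sum_(0 <= k < m.+1) X k w ^+ 2 = \sum_(0 <= k < m) X k w ^+ 2 + X m w ^+ 2.
    by rewrite big_nat_recr.
  by rewrite big_ltn// => <-; rewrite addrC addKr.
have en := energy_identity m th01 gw.
have -> : \sum_(0 <= k < m) X k w ^+ 2 = (X 0 w ^+ 2 - X m w ^+ 2 +
    2 * th * transform xi th m w + \sum_(0 <= k < m) xi k.+1%:Z w ^+ 2) / (1 - th ^+ 2).
  by rewrite -en mulrAC divff ?mul1r// gt_eqF.
rewrite /cov_noise sumrB big_const_nat iter_addr_0 subn0 -mulr_natr.
move: var (\sum_(0 <= j < l) _) (\sum_(0 <= k < m) _) (transform xi th m w) => v A B D.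
by field; rewrite !gt_eqF.
Qed.

Lemma cov_noise_integral l n :
  P.-integrable setT (EFin \o cov_noise l n) /\
  \int[P]_w (cov_noise l n w) = th ^+ l * (th ^+ 2 *
    (\int[P]_w (X 0 w ^+ 2) - \int[P]_w (X n w ^+ 2))).
Proof.
have [iS S0] := transform_mean0 n.
have [i0 _] := ar_square_integrable 0.
have [in_ _] := ar_square_integrable n.
have iN := integrable_mulr (-1) in_.
have iD := integrable_mulr (th ^+ 2) (integrable_addr i0 iN).
have iS2 := integrable_mulr (2 * th) iS.
have ix k : P.-integrable setT (EFin \o (fun w => xi k.+1%:Z w ^+ 2 + - var)).
  apply: integrable_addr; first exact: noise_square_integrable.
  exact: finite_measure_integrable_cst.
have iX : P.-integrable setT (EFin \o (fun w => \sum_(0 <= k < n) (xi k.+1%:Z w ^+ 2 - var))).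
  by apply: integrable_rsum => k _; exact: ix.
have X0 : \int[P]_w (\sum_(0 <= k < n) (xi k.+1%:Z w ^+ 2 - var)) = 0.
  rewrite Rintegral_rsum => [|k _]; last exact: ix.
  apply: big1 => k _; rewrite RintegralB//; last 2 first.
  - exact: noise_square_integrable.
  - exact: finite_measure_integrable_cst.
  rewrite noise_square_integral Rintegral_probability_cst.
  by rewrite subrr.
have il j := integrable_mulr (th ^+ (l - j.+1)) (lagged_mean0 j n).1.
have iL : P.-integrable setT (EFin \o (fun w => \sum_(0 <= j < l) th ^+ (l - j.+1) * lagged xi th j n w)).
  by apply: integrable_rsum => j _; exact: il.
have L0 : \int[P]_w (\sum_(0 <= j < l) th ^+ (l - j.+1) * lagged xi th j n w) = 0.
  rewrite Rintegral_rsum => [|j _]; last exact: il.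
  apply: big1 => j _; have [h1 h2] := lagged_mean0 j n.
  by rewrite RintegralZl// h2 mulr0.
have iA := integrable_addr iD iS2.
have iB := integrable_mulr (th ^+ l) (integrable_addr iA iX).
have iC := integrable_mulr (1 - th ^+ 2) iL.
have cE : cov_noise l n = fun w => th ^+ l * (th ^+ 2 * (X 0 w ^+ 2 + -1 * X n w ^+ 2) +
   2 * th * transform xi th n w + \sum_(0 <= k < n) (xi k.+1%:Z w ^+ 2 - var)) +
  (1 - th ^+ 2) * \sum_(0 <= j < l) th ^+ (l - j.+1) * lagged xi th j n w.
  by apply/funext => w; rewrite /cov_noise mulN1r.
rewrite cE; split; first exact: integrable_addr.
rewrite RintegralD// RintegralZl//; last exact: integrable_addr.
rewrite [X in _ + X]RintegralZl// L0 mulr0 addr0.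
rewrite RintegralD// X0 addr0 RintegralD// [X in _ * (_ + X)]RintegralZl// S0 mulr0 addr0.
rewrite RintegralZl//; last exact: integrable_addr.
by rewrite RintegralD// RintegralZl// mulN1r.
Qed.

(** Only the boundary squares contribute to the mean of [cov_noise]. *)
Lemma emp_cov_centered l n w : ar_good xi th w -> (l < n)%N ->
  emp_cov l n w - \int[P]_w' (emp_cov l n w') =
  ((1 - th ^+ 2) * (n - l)%:R)^-1 * (cov_noise l (n - l) w -
   th ^+ l * (th ^+ 2 * (\int[P]_w (X 0 w ^+ 2) - \int[P]_w (X (n - l) w ^+ 2)))).
Proof.
move=> gw ln; rewrite emp_covE//; set c := (_ * (n - l)%:R)^-1.
set k := th ^+ l * ((n - l)%:R * var).
have [ic ci] := cov_noise_integral l (n - l).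
have ik : P.-integrable setT (EFin \o (fun _ : T => k)) by exact: finite_measure_integrable_cst.
have ick := integrable_addr ic ik.
have -> : \int[P]_w' (emp_cov l n w') = \int[P]_w' (c * (cov_noise l (n - l) w' + k)).
  congr fine; apply: ae_eq_integral => //.
  - by apply/measurable_EFinP; exact: measurable_emp_cov.
  - by have /integrableP[] := integrable_mulr c ick.
  exists (~` ar_good xi th); split.
  - by apply: measurableC; exact: measurable_ar_good.
  - exact: (ar_good_ae (en_iid N) (en_al N) (en_C N) th01).
  by move=> w' /= h gw'; apply: h => _; rewrite emp_covE.
rewrite RintegralZl// RintegralD// ci Rintegral_probability_cst.
by rewrite -mulrBr opprD addrACA subrr addr0.
Qed.

End moments.

(** * The leading term *)

Section leading_term.
Context d (T : measurableType d) (R : realType) (P : probability T R).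
Variables (xi : int -> {RV P >-> R}) (al K : R).
Hypothesis N : exp_noise xi al K.
Local Notation mu := (distribution P (xi 0)).
Local Notation C := (\int[mu]_x (expR (al * x ^+ 2))).
Local Notation var := (\int[mu]_x (x ^+ 2)).
Hypothesis var_gt0 : 0 < var.

(** Up to the factor [2] the leading term of every centred empirical
    covariance. *)
Definition score n th b w := gfac n th b * transform xi th n w.

Lemma measurable_score n th b : measurable_fun setT (score n th b).
Proof. by apply: measurable_funM => //; exact: measurable_transform. Qed.

Lemma mgf_score (lam delta : R) : 0 < delta -> exists B : R,
  forall n th b, regime B n th b ->
  ((expR ((lam ^+ 2 * var ^+ 2 / 2 - delta) * b ^+ 2))%:E <=
     mexp P (fun w => (lam * b ^+ 2 * score n th b w)%R) <=
   (expR ((lam ^+ 2 * var ^+ 2 / 2 + delta) * b ^+ 2))%:E)%E.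
Proof.
move=> delta0; have [B hB] := mgf_transform N lam delta0.
exists (Num.max B 1) => n th b rg; have := hB _ _ _ (regime_maxl rg).
have [_ b0 nR _ _] := regime_facts (lexx 1) (regime_maxr rg).
suff -> : (fun w => tilt lam b th n * transform xi th n w) =
  (fun w => lam * b ^+ 2 * score n th b w) by [].
apply/funext => w; rewrite /score mulrA; congr (_ * _).
by rewrite /tilt /gfac; field; rewrite !gt_eqF// sqrtr_gt0.
Qed.

Let var2 : 0 < var ^+ 2. Proof. by rewrite exprn_gt0. Qed.

Lemma score_upper_tail (x delta : R) : 0 < x -> 0 < delta -> exists B : R,
  forall n th b, regime B n th b ->
  (P [set w | (x <= `|score n th b w|)%R] <=
   (expR (- (x ^+ 2 / (2 * var ^+ 2) - delta) * b ^+ 2))%:E)%E.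
Proof. exact: (gaussian_upper_tail measurable_score var2 mgf_score). Qed.

Lemma score_lower_tail (x delta : R) : 0 < x -> 0 < delta -> exists B : R,
  forall n th b, regime B n th b ->
  ((expR (- (x ^+ 2 / (2 * var ^+ 2) + delta) * b ^+ 2))%:E <=
   P [set w | (x <= score n th b w)%R])%E.
Proof. exact: (gaussian_lower_tail measurable_score var2 mgf_score). Qed.

Lemma negl_small_score (e : nat -> R -> R -> R) :
  (forall delta : R, 0 < delta -> exists B : R, forall n th b, regime B n th b ->
     `|e n th b| < delta) -> negl P (fun n th b w => e n th b * score n th b w).
Proof.
move=> he; apply: negl_tail => [n th b|delta delta0].
  by apply: measurable_funM => //; exact: measurable_score.
exists 1 => L L0.
(* Large enough for [x^2 / (2 var^2)] to exceed [L + 1]. *)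
pose x := 2 * var ^+ 2 * (L + 1) + 1.
have p0 : 0 < 2 * var ^+ 2 * (L + 1) by rewrite mulr_gt0 ?addr_gt0// mulr_gt0.
have x0 : 0 < x by rewrite addr_gt0.
have [B1 h1] := score_upper_tail x0 ltr01.
have [B2 h2] := he _ (divr_gt0 delta0 x0).
exists (Num.max B1 B2) => n th b rg.
have hx := h1 _ _ _ (regime_maxl rg); have he2 := h2 _ _ _ (regime_maxr rg).
apply: le_trans (le_trans hx _).
  apply: le_measure; rewrite ?inE.
  - apply: measurable_ge_set; apply: measurableT_comp => //.
    by apply: measurable_funM => //; exact: measurable_score.
  - by apply: measurable_ge_set; apply: measurableT_comp => //; exact: measurable_score.
  move=> w /=; rewrite normrM => h; rewrite leNgt; apply/negP => zx.
  have : `|e n th b| * `|score n th b w| < delta / x * x by apply: ltr_pM.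
  by rewrite divfK ?gt_eqF// ltNge h.
rewrite lee_fin mul1r ler_expR !mulNr lerN2 ler_wpM2r ?sqr_ge0//.
rewrite lerBrDr ler_pdivlMr ?mulr_gt0//.
rewrite [leRHS]expr2 [leLHS]mulrC /x.
move: p0; move: (2 * var ^+ 2 * (L + 1)) => p p0; nra.
Qed.

Lemma negl_scale (k : R) (c : nat -> R -> R -> R) (E : nat -> R -> R -> T -> R) :
  0 < k -> (exists B : R, forall n th b, regime B n th b -> `|c n th b| <= k) ->
  negl P E -> negl P (fun n th b w => c n th b * E n th b w).
Proof.
move=> k0 [B hB] nE; apply: (negl_le k0 nE); exists B => n th b rg.
exists set0; split => // w _; rewrite normrM ler_wpM2r//; exact: hB.
Qed.

Lemma lag_ratio l : exists B : R, forall n (th b : R), regime B n th b ->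
  [/\ (l < n)%N, 0 < (n - l)%:R :> R & n%:R <= 2 * (n - l)%:R :> R].
Proof.
exists (Num.max 1 (2 * l.+1)%:R) => n th b rg.
have [_ _ _ _ Bn] := regime_facts (lexx 1) (regime_maxl rg).
have : (2 * l.+1 <= n)%N.
  have rg' := regime_maxr rg.
  have h1 : 1 <= (2 * l.+1)%:R :> R by rewrite (ler_nat R 1).
  by have [_ _ _ _] := regime_facts h1 rg'; rewrite ler_nat.
move=> h; have ln : (l < n)%N by apply: leq_trans h; rewrite mul2n -addnn leq_addr.
split => //; first by rewrite ltr0n subn_gt0.
rewrite -natrM ler_nat mulnBr leq_subRL; last by rewrite leq_mul2l/= ltnW.
rewrite [leqRHS]mul2n -addnn leq_add2r; apply: leq_trans h.
by rewrite leq_mul2l leqnSn.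
Qed.

(** Bernoulli's inequality. *)
Lemma exprn_ge_linear (th : R) k : 0 <= th <= 1 -> 1 - k%:R * (1 - th) <= th ^+ k.
Proof.
move=> /andP[th0 th1]; elim: k => [|k ih]; first by rewrite mul0r subr0.
have h : th ^+ k * (1 - th) <= 1 - th.
  by rewrite ler_piMl ?subr_ge0// exprn_ile1.
rewrite exprSr -natr1 mulrDl mul1r opprD addrA.
apply: le_trans (lerD ih (lexx (- (1 - th)))) _.
by rewrite lerBlDr; apply: le_trans (lerD (lexx (th ^+ k * th)) h); rewrite -mulrDr addrC subrK mulr1.
Qed.

(** The lag is fixed, so neither dropping the last [l] indices nor the
    factor [th^(l+1)] changes the leading term. *)
Lemma lag_factor_small l (delta : R) : 0 < delta -> exists B : R,
  forall n (th b : R), regime B n th b ->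
  `|2 * (n%:R / (n - l)%:R * th ^+ l.+1 - 1)| < delta.
Proof.
move=> delta0; have [B1 h1] := lag_ratio l.
pose B2 : R := (6 * l%:R + 3) / delta.
exists (Num.max B1 (Num.max 1 B2)) => n th b rg.
have [ln m0 nm] := h1 _ _ _ (regime_maxl rg).
have B1' : 1 <= Num.max 1 B2 by rewrite le_max lexx.
have [_ _ nR /andP[u0 u1] Bn] := regime_facts B1' (regime_maxr rg).
have [_ /andP[th0 th1] _ _ uB] := regime_maxr (regime_maxr rg).
have B20 : 0 < B2 by rewrite divr_gt0// ltr_wpDl// mulr_ge0.
have Bn2 : B2 <= n%:R by apply: le_trans Bn; rewrite le_max lexx orbT.
have th01 : 0 <= th <= 1 by rewrite th0 ltW.
have lo := exprn_ge_linear l.+1 th01.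
have hi : th ^+ l.+1 <= 1 by rewrite exprn_ile1// ltW.
have t0 : 0 <= th ^+ l.+1 by exact: exprn_ge0.
have nE : n%:R = (n - l)%:R + l%:R :> R by rewrite -natrD subnK// ltnW.
have l0 : 0 <= l%:R :> R by [].
have q : l%:R / (n - l)%:R <= 2 * l%:R / B2 :> R.
  rewrite ler_pdivrMr// mulrAC ler_pdivlMr//.
  have h : B2 <= 2 * (n - l)%:R by exact: le_trans nm.
  by apply: (le_trans (ler_wpM2l l0 h)); apply: le_of_eq; ring.
have uB' : 1 - th <= B2^-1 by rewrite -[leRHS]mul1r ler_pdivlMr// mulrC.
have -> : n%:R / (n - l)%:R = 1 + l%:R / (n - l)%:R :> R.
  by rewrite nE; field; rewrite gt_eqF.
have q0 : 0 <= l%:R / (n - l)%:R :> R by rewrite divr_ge0// ltW.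
have dB : delta = (6 * l%:R + 3) / B2 by rewrite /B2; field; rewrite !gt_eqF// ltr_wpDl// mulr_ge0.
have up : (1 + l%:R / (n - l)%:R) * th ^+ l.+1 <= 1 + l%:R / (n - l)%:R.
  by rewrite ler_piMr// addr_ge0.
have dn : th ^+ l.+1 <= (1 + l%:R / (n - l)%:R) * th ^+ l.+1.
  by rewrite ler_peMl// lerDl.
have lu : l.+1%:R * (1 - th) <= (l%:R + 1) * B2^-1.
  by rewrite natr1 ler_wpM2l.
have iB : 0 < B2^-1 by rewrite invr_gt0.
rewrite dB ltr_norml; move: up dn lo q lu l0 iB.
move: (th ^+ l.+1) (l%:R / (n - l)%:R : R) (l.+1%:R * (1 - th)) (B2^-1) (l%:R : R) => t p v B L.
move: (_ * t) => y *.
by apply/andP; split; nra.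
Qed.

End leading_term.

(** * The error of one empirical covariance *)

Section covariance_error.
Context d (T : measurableType d) (R : realType) (P : probability T R).
Variables (xi : int -> {RV P >-> R}) (al K : R).
Hypothesis N : exp_noise xi al K.
Local Notation mu := (distribution P (xi 0)).
Local Notation C := (\int[mu]_x (expR (al * x ^+ 2))).
Local Notation var := (\int[mu]_x (x ^+ 2)).
Hypothesis var_gt0 : 0 < var.

Lemma negl_opp (E : nat -> R -> R -> T -> R) :
  negl P E -> negl P (fun n th b w => - E n th b w).
Proof.
move=> nE; apply: (negl_le ltr01 nE); exists 0 => n th b _; exists set0; split => //.
by move=> w _; rewrite normrN mul1r.
Qed.

Lemma negl_ar_noise (kap : nat -> nat) :
  negl P (fun n th b w => gfac n th b * (ar xi th (kap n) w * xi (kap n).+1%:Z w)).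
Proof.
have h := negl_add (negl_ar_square N kap) (negl_noise_square N (fun n => (kap n).+1%:Z)).
apply: (negl_le ltr01 h); exists 1 => n th b rg; exists set0; split => // w _.
have [b1 b0 nR _ _] := regime_facts (lexx 1) rg; have [n0 th01 _ _ _] := rg.
have g0 := gfac_gt0 n0 th01 b0.
rewrite mul1r -mulrDr !normrM ler_wpM2l// -normrM.
set x := ar _ _ _ _; set y := xi _ _.
rewrite [leRHS]ger0_norm ?addr_ge0 ?sqr_ge0//.
by rewrite ler_norml; apply/andP; split; nra.
Qed.

Lemma negl_ar_square_mean (kap : nat -> nat) :
  negl P (fun n th b _ => gfac n th b * \int[P]_w (ar xi th (kap n) w ^+ 2)).
Proof.
apply: negl_cst => delta delta0; have al0 := en_al N.
have C1 := en_C_ge1 N.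
have C0 : 0 < C by exact: lt_le_trans ltr01 C1.
have L0 : 0 <= 2 * C / (al * delta).
  by rewrite divr_ge0 ?mulr_ge0 ?(ltW C0) ?(ltW al0) ?(ltW delta0).
have [B B1 hB] := gfac_small L0.
exists B => n th b rg; have h := hB _ _ _ rg.
have [b1 b0 nR /andP[u0 u1] _] := regime_facts B1 rg; have [n0 th01 _ _ _] := rg.
have g0 := gfac_gt0 n0 th01 b0.
have [_ m] := ar_square_integrable N th01 (kap n).
have m0 : 0 <= \int[P]_w (ar xi th (kap n) w ^+ 2).
  by apply: Rintegral_ge0 => w _; exact: sqr_ge0.
rewrite ger0_norm; last by apply: mulr_ge0 => //; exact: ltW.
apply: (le_lt_trans (ler_wpM2l (ltW g0) m)).
rewrite mulrA ltr_pdivrMr ?mulr_gt0// ?exprn_gt0//.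
move: h; rewrite mulrAC ler_pdivrMr ?mulr_gt0// => h.
have b2 : 1 <= b ^+ 2 by exact: exprn_ege1.
have gC : 0 < gfac n th b * C by rewrite mulr_gt0.
have h1 : 2 * C * gfac n th b <= 2 * C * (gfac n th b * b ^+ 2).
  by rewrite ler_wpM2l ?mulr_ge0 ?(ltW C0)// ler_peMr// ltW.
have -> : delta * (al * (1 - th) ^+ 2) = (1 - th) ^+ 2 * (al * delta) by ring.
apply: lt_le_trans (le_trans h1 h).
by rewrite -mulrA [C * _]mulrC ltr_pMl// ltr1n.
Qed.

(** The factor is [(1 - th^2)^(3/2) sqrt n / b] written through [gfac]. *)
Definition cov_error l n th b w :=
  n%:R * (1 - th ^+ 2) * gfac n th b *
    (emp_cov xi th l n w - \int[P]_w' (emp_cov xi th l n w')) -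
  2 * score xi n th b w.

Lemma transform_split l n th w : (l <= n)%N ->
  transform xi th n w = transform xi th (n - l) w +
  \sum_(0 <= i < l) ar xi th (n - l + i) w * xi (n - l + i).+1%:Z w.
Proof.
move=> ln; rewrite /transform (big_cat_nat (n := (n - l)%N) (m := 0%N) (p := n))//=; last first.
  exact: leq_subr.
congr (_ + _); rewrite -{1}[(n - l)%N]add0n big_addn subKn//.
by apply: eq_bigr => i _; rewrite addnC.
Qed.

(** With [m = n - l], the rescaled covariance is [n / m] times the bracket of
    the covariance identity; each of its terms other than the transform is
    negligible, and the factor of the transform tends to [2]. *)
Lemma negl_cov_error l : negl P (cov_error l).
Proof.
have [B1 h1] := @lag_ratio R l.
pose c k (n : nat) (th b : R) : R := n%:R / (n - l)%:R * th ^+ k.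
have cb k : exists B, forall n th b, regime B n th b -> `|c k n th b| <= 2.
  exists B1 => n th b rg; have [ln m0 nm] := h1 _ _ _ rg.
  have [_ /andP[th0 th1] _ _ _] := rg.
  have q0 : 0 <= n%:R / (n - l)%:R :> R by rewrite divr_ge0// ltW.
  rewrite /c ger0_norm ?mulr_ge0 ?exprn_ge0//.
  apply: (@le_trans _ _ (n%:R / (n - l)%:R)).
    by rewrite ler_piMr// exprn_ile1// ltW.
  by rewrite ler_pdivrMr.
have c2b : exists B, forall n th b, regime B n th b -> `|- 2 * c l.+1 n th b| <= 4.
  have [B hB] := cb l.+1; exists B => n th b /hB h.
  rewrite normrM normrN (ger0_norm (ler0n _ 2)).
  by apply: (le_trans (ler_wpM2l (ler0n _ 2) h)); rewrite -natrM.
have n1 := negl_small_score N var_gt0 (@lag_factor_small R l).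
have n2 := negl_scale (ltr0n _ 4) c2b
  (negl_sum (m := l) (fun i _ => negl_ar_noise (fun n => (n - l + i)%N))).
have n3a := negl_add (negl_ar_square N (fun=> 0%N))
  (negl_opp (negl_ar_square N (fun n => (n - l)%N))).
have n3b := negl_add (negl_opp (negl_ar_square_mean (fun=> 0%N)))
  (negl_ar_square_mean (fun n => (n - l)%N)).
have n3 := negl_scale (ltr0n _ 2) (cb l.+2) (negl_add n3a n3b).
have n4 := negl_scale (ltr0n _ 2) (cb l) (negl_centered_squares N l).
have n5 := negl_sum (m := l) (fun j jl =>
  negl_scale (ltr0n _ 2) (cb (l - j.+1)%N) (negl_lagged N jl)).
have nn := negl_add (negl_add n1 n2) (negl_add n3 (negl_add n4 n5)).
apply: (negl_le ltr01 nn); exists (Num.max B1 1) => n th b rg.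
have [ln m0 _] := h1 _ _ _ (regime_maxl rg).
have [_ th01 _ _ _] := rg.
exists (~` ar_good xi th); split.
- by apply: measurableC; exact: measurable_ar_good.
- exact: (ar_good_ae (en_iid N) (en_al N) (en_C N) th01).
move=> w /contrapT gw; rewrite mul1r; apply: le_of_eq; congr (`|_|).
rewrite /cov_error (emp_cov_centered N th01 gw ln) /cov_noise /score /c.
rewrite (transform_split _ _ (ltnW ln)).
have -> : \sum_(0 <= i < l) n%:R / (n - l)%:R * th ^+ (l - i.+1) *
    (gfac n th b * ((1 - th ^+ 2) * lagged xi th i (n - l) w)) =
  n%:R / (n - l)%:R * gfac n th b * (1 - th ^+ 2) *
    \sum_(0 <= j < l) th ^+ (l - j.+1) * lagged xi th j (n - l) w.
  by rewrite mulr_sumr; apply: eq_bigr => i _; ring.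
rewrite -mulr_sumr !exprSr.
have /andP[v0 _] := one_sub_sqr th01.
move: (\sum_(0 <= j < l) _) (\sum_(0 <= i < l) _) (\sum_(0 <= k < n - l) _).
move: (\int[P]_w0 (ar xi th 0 w0 ^+ 2)) (\int[P]_w0 (ar xi th (n - l) w0 ^+ 2)).
move: (th ^+ l) (gfac n th b) => *.
by field; rewrite !gt_eqF.
Qed.

End covariance_error.

(** * Deviations of the leading term with a negligible error *)

Section deviations.
Context d (T : measurableType d) (R : realType) (P : probability T R).
Variables (xi : int -> {RV P >-> R}) (al K : R).
Hypothesis N : exp_noise xi al K.
Local Notation mu := (distribution P (xi 0)).
Local Notation var := (\int[mu]_x (x ^+ 2)).
Hypothesis var_gt0 : 0 < var.

Variables (A : R) (Y W : nat -> R -> R -> T -> R).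
Hypothesis mY : forall n th b, measurable_fun setT (Y n th b).
Hypothesis YE : forall n th b w, Y n th b w = 2 * A * score xi n th b w + W n th b w.
Hypothesis nW : negl P W.

Local Notation s := (4 * A ^+ 2 * var ^+ 2).

Lemma deviation_degenerate (r L : R) : A = 0 -> 0 < r -> 0 < L -> exists B : R,
  forall n th b, regime B n th b ->
  (P [set w | (r <= `|Y n th b w|)%R] <= (expR (- L * b ^+ 2))%:E)%E.
Proof.
move=> A0 r0 L0; have [B hB] := nW r0 L0.
exists B => n th b rg; have [D [mD PD hD]] := hB _ _ _ rg.
apply: le_trans PD; apply: le_measure; rewrite ?inE//.
  by apply: measurable_ge_set; exact: measurableT_comp.
move=> w /=; rewrite YE A0 mulr0 mul0r add0r => rW.
by apply: contrapT => /hD; rewrite ltNge rW.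
Qed.

(** The error may take up [eta] of the level [r]; the rest is a deviation of
    the score at [(r - eta) / (2 |A|)]. *)
Lemma deviation_upper (r delta : R) : A != 0 -> 0 < r -> 0 < delta -> exists B : R,
  forall n th b, regime B n th b ->
  (P [set w | (r <= `|Y n th b w|)%R] <=
   (expR (- (r ^+ 2 / (2 * s) - delta) * b ^+ 2))%:E)%E.
Proof.
move=> A0 r0 delta0.
have s0 : 0 < s by rewrite mulr_gt0 ?exprn_gt0// mulr_gt0// exprn_even_gt0.
have s2 : 0 < 2 * s by exact: mulr_gt0.
have A2 : 0 < 2 * `|A| by rewrite mulr_gt0// normr_gt0.
have d3 : 0 < delta / 3 by rewrite divr_gt0.
pose eta := Num.min (r / 2) (delta * s / (3 * r)).
have eta0 : 0 < eta by rewrite lt_min; apply/andP; split; apply: divr_gt0 => //; apply: mulr_gt0.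
have eta1 : eta <= r / 2 by rewrite ge_min lexx.
have eta2 : eta * (3 * r) <= delta * s.
  by rewrite -ler_pdivlMr ?mulr_gt0// ge_min lexx orbT.
pose x := (r - eta) / (2 * `|A|).
have re0 : 0 < r - eta by rewrite subr_gt0 (le_lt_trans eta1)// ltr_pdivrMr// ltr_pMr// ltr1n.
have x0 : 0 < x by rewrite divr_gt0.
have [B1 h1] := score_upper_tail N var_gt0 x0 d3.
have L0 : 0 < r ^+ 2 / (2 * s) by rewrite divr_gt0// exprn_gt0.
have [B2 h2] := nW eta0 L0.
have [B3 _ h3] := constant_factor_le_expR (ler0n _ 2) d3.
exists (Num.max (Num.max B1 B2) B3) => n th b rg.
have rg12 := regime_maxl rg.
have {}h1 := h1 _ _ _ (regime_maxl rg12).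
have [D [mD PD hD]] := h2 _ _ _ (regime_maxr rg12).
have {}h3 := h3 _ (regime_ge (regime_maxr rg)).
pose Z := [set w | x <= `|score xi n th b w|].
have mZ : measurable Z.
  by apply: measurable_ge_set; apply: measurableT_comp => //; exact: measurable_score.
apply: (@le_trans _ _ (P (Z `|` D))).
  apply: le_measure; rewrite ?inE//.
  - by apply: measurable_ge_set; exact: measurableT_comp.
  - exact: measurableU.
  move=> w /=; rewrite YE => rW.
  have [|/hD Ww] := pselect (D w); first by right.
  left; rewrite /Z /= /x ler_pdivrMr// lerBlDr.
  apply: (le_trans rW); apply: (le_trans (ler_normD _ _)).
  by apply: lerD; [rewrite normrM (normrM 2 A) (ger0_norm (ler0n _ 2)) mulrC|exact: ltW].
apply: (le_trans (measureU2 _ mZ mD)); apply: (le_trans (leeD h1 PD)).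
rewrite -EFinD lee_fin.
have b2 := sqr_ge0 b.
have xE : r ^+ 2 / (2 * s) - delta / 3 <= x ^+ 2 / (2 * var ^+ 2).
  have -> : x ^+ 2 / (2 * var ^+ 2) = (r - eta) ^+ 2 / (2 * s).
    rewrite /x -[A ^+ 2]real_normK ?num_real//.
    by field; rewrite normr_eq0 A0 !gt_eqF.
  rewrite lerBlDr -lerBlDl -mulrBl ler_pdivrMr//.
  have -> : delta / 3 * (2 * s) = 2 / 3 * (delta * s) by field.
  have -> : r ^+ 2 - (r - eta) ^+ 2 = 2 / 3 * (eta * (3 * r)) - eta ^+ 2 by field.
  have h : 2 / 3 * (eta * (3 * r)) <= 2 / 3 * (delta * s) by rewrite ler_wpM2l.
  by apply: le_trans h; rewrite gerBl sqr_ge0.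
pose e := expR (- (r ^+ 2 / (2 * s) - delta / 3 - delta / 3) * b ^+ 2).
have e1 : expR (- (x ^+ 2 / (2 * var ^+ 2) - delta / 3) * b ^+ 2) <= e.
  by rewrite ler_expR; apply: ler_wpM2r => //; rewrite lerN2 lerD2r.
have e2 : expR (- (r ^+ 2 / (2 * s)) * b ^+ 2) <= e.
  rewrite ler_expR; apply: ler_wpM2r => //; rewrite lerN2 -addrA gerDl.
  by rewrite -opprD oppr_le0 addr_ge0// ltW.
have eE : e + e = 2 * e by rewrite mulr_natl mulr2n.
apply: (le_trans (lerD e1 e2)); rewrite eE.
apply: (le_trans (ler_wpM2r (expR_ge0 _) h3)); rewrite -expRD ler_expR.
by apply: le_of_eq; field; rewrite gt_eqF.
Qed.

(** One-sided deviations of the score suffice, whatever the sign of [A]. *)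
Lemma deviation_lower (r delta : R) : A != 0 -> 0 < r -> 0 < delta -> exists B : R,
  forall n th b, regime B n th b ->
  ((expR (- (r ^+ 2 / (2 * s) + delta) * b ^+ 2))%:E <=
   P [set w | (r <= `|Y n th b w|)%R])%E.
Proof.
move=> A0 r0 delta0.
have s0 : 0 < s by rewrite mulr_gt0 ?exprn_gt0// mulr_gt0// exprn_even_gt0.
have s2 : 0 < 2 * s by exact: mulr_gt0.
have A2 : 0 < 2 * `|A| by rewrite mulr_gt0// normr_gt0.
have d3 : 0 < delta / 3 by rewrite divr_gt0.
have r21 : 0 < 2 * r + 1 by rewrite addr_gt0// mulr_gt0.
pose eta := Num.min 1 (delta / 3 * (2 * s) / (2 * r + 1)).
have eta0 : 0 < eta by rewrite lt_min ltr01; apply: divr_gt0 => //; exact: mulr_gt0.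
have eta1 : eta <= 1 by rewrite ge_min lexx.
have eta2 : eta * (2 * r + 1) <= delta / 3 * (2 * s).
  by rewrite -ler_pdivlMr// ge_min lexx orbT.
pose x := (r + eta) / (2 * `|A|).
have x0 : 0 < x by rewrite divr_gt0// addr_gt0.
have [B1 h1] := score_lower_tail N var_gt0 x0 d3.
have L0 : 0 < r ^+ 2 / (2 * s) + delta.
  by rewrite addr_gt0// divr_gt0// exprn_gt0.
have [B2 h2] := nW eta0 L0.
have [B3 _ h3] := constant_factor_le_expR (ler0n _ 2) d3.
exists (Num.max (Num.max B1 B2) B3) => n th b rg.
have rg12 := regime_maxl rg.
have {}h1 := h1 _ _ _ (regime_maxl rg12).
have [D [mD PD hD]] := h2 _ _ _ (regime_maxr rg12).
have {}h3 := h3 _ (regime_ge (regime_maxr rg)).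
set E := [set w | _].
have mE : measurable E by apply: measurable_ge_set; exact: measurableT_comp.
have sub : (P [set w | (x <= score xi n th b w)%R] <= P E + P D)%E.
  apply: le_trans (measureU2 _ mE mD); apply: le_measure; rewrite ?inE//.
  - by apply: measurable_ge_set; exact: measurable_score.
  - exact: measurableU.
  move=> w /=; rewrite /x ler_pdivrMr// => xS.
  have [|/hD Ww] := pselect (D w); first by right.
  left; rewrite /E /= YE.
  have h : `|2 * A * score xi n th b w| <= `|2 * A * score xi n th b w + W n th b w| + `|W n th b w|.
    by rewrite -{1}[2 * A * _](addrK (W n th b w)); exact: ler_normB.
  have h' : r + eta <= `|2 * A * score xi n th b w|.
    rewrite normrM (normrM 2 A) (ger0_norm (ler0n _ 2)) mulrC; apply: (le_trans xS).
    by apply: ler_wpM2r; [exact: ltW|exact: ler_norm].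
  by move: (le_trans h' h) Ww; move: `|_ + _| `|W n th b w| => p q; lra.
have b2 := sqr_ge0 b.
pose e := expR (- (r ^+ 2 / (2 * s) + delta) * b ^+ 2).
have xE : x ^+ 2 / (2 * var ^+ 2) <= r ^+ 2 / (2 * s) + delta / 3.
  have -> : x ^+ 2 / (2 * var ^+ 2) = (r + eta) ^+ 2 / (2 * s).
    rewrite /x -[A ^+ 2]real_normK ?num_real//.
    by field; rewrite normr_eq0 A0 !gt_eqF.
  rewrite -lerBlDl -mulrBl ler_pdivrMr//.
  apply: le_trans eta2.
  have -> : (r + eta) ^+ 2 - r ^+ 2 = eta * (2 * r + eta) by ring.
  by rewrite ler_wpM2l ?(ltW eta0)// lerD2l.
have e1 : e + e <= expR (- (x ^+ 2 / (2 * var ^+ 2) + delta / 3) * b ^+ 2).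
  have -> : e + e = 2 * e by rewrite mulr_natl mulr2n.
  apply: (le_trans (ler_wpM2r (expR_ge0 _) h3)).
  rewrite -expRD ler_expR -mulrDl ler_wpM2r//.
  by move: xE; move: (x ^+ 2 / _) (r ^+ 2 / _) => p q; lra.
rewrite -/e.
have : ((e + e)%:E <= P E + e%:E)%E.
  rewrite -lee_fin in e1.
  by apply: (le_trans e1); apply: (le_trans h1); apply: (le_trans sub); rewrite leeD2l.
rewrite -(fineK (fin_num_measure P _ mE)) -EFinD !lee_fin.
by rewrite lerD2r.
Qed.

End deviations.

(** * From exponential bounds to logarithmic limits *)

Section logarithmic_limit.
Variable R : realType.
Variables (b : nat -> R) (p : nat -> \bar R).
Hypothesis b_gt0 : \forall n \near \oo, 0 < b n.
Hypothesis p_ge0 : forall n, (0 <= p n)%E.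

Lemma scaled_lne_le (b0 : R) (q : \bar R) (x : R) : 0 < b0 -> (0 <= q)%E ->
  (q <= (expR (x * b0 ^+ 2))%:E)%E -> ((b0 ^+ 2)^-1%:E * lne q <= x%:E)%E.
Proof.
move=> b00; case: q => [q|//|//] q0; rewrite !lee_fin /= in q0 * => qx.
have b2 : 0 < (b0 ^+ 2)^-1 by rewrite invr_gt0 exprn_gt0.
case: ifPn => [_|]; first by rewrite gt0_muleNy ?lte_fin// leNye.
rewrite -ltNge => q1; rewrite -EFinM lee_fin mulrC ler_pdivrMr ?exprn_gt0//.
by rewrite -[leRHS]expRK ler_ln// posrE expR_gt0.
Qed.

Lemma scaled_lne_ge (b0 : R) (q : \bar R) (x : R) : 0 < b0 ->
  ((expR (x * b0 ^+ 2))%:E <= q)%E -> (x%:E <= (b0 ^+ 2)^-1%:E * lne q)%E.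
Proof.
move=> b00; have b2 : 0 < (b0 ^+ 2)^-1 by rewrite invr_gt0 exprn_gt0.
case: q => [q|_|//]; last by rewrite /= gt0_muley ?lte_fin// leey.
rewrite lee_fin => xq; have q0 : 0 < q := lt_le_trans (expR_gt0 _) xq.
rewrite lne_EFin// -EFinM lee_fin mulrC ler_pdivlMr ?exprn_gt0//.
by rewrite -[leLHS]expRK ler_ln// posrE expR_gt0.
Qed.

Lemma log_limitNy :
  (forall L : R, 0 < L -> \forall n \near \oo, (p n <= (expR (- L * b n ^+ 2))%:E)%E) ->
  (((b n ^+ 2)^-1)%:E * lne (p n))%E @[n --> \oo] --> -oo%E.
Proof.
move=> h; apply/cvgeNyPle => x.
have x1 : 0 < `|x| + 1 by rewrite ltr_wpDl.
near=> n.
have bn : 0 < b n by near: n.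
have := scaled_lne_le bn (p_ge0 n) _; move=> /(_ (- (`|x| + 1))) hh.
apply: (@le_trans _ _ (- (`|x| + 1))%:E).
  by apply: hh; near: n; exact: h.
by rewrite lee_fin lerNl; have := ler_norm (- x); rewrite normrN => /le_trans; apply; rewrite lerDl.
Unshelve. all: by end_near. Qed.

Lemma log_limit (rho : R) :
  (forall delta : R, 0 < delta -> \forall n \near \oo,
     (p n <= (expR (- (rho - delta) * b n ^+ 2))%:E)%E) ->
  (forall delta : R, 0 < delta -> \forall n \near \oo,
     ((expR (- (rho + delta) * b n ^+ 2))%:E <= p n)%E) ->
  (((b n ^+ 2)^-1)%:E * lne (p n))%E @[n --> \oo] --> (- rho)%:E.
Proof.
move=> hu hl.
have key (delta : R) : 0 < delta -> \forall n \near \oo,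
    ((- (rho + delta))%:E <= ((b n ^+ 2)^-1)%:E * lne (p n) <= (- (rho - delta))%:E)%E.
  move=> delta0; near=> n; have bn : 0 < b n by near: n.
  apply/andP; split.
    by apply: scaled_lne_ge => //; near: n; exact: hl.
  by apply: scaled_lne_le => //; near: n; exact: hu.
apply/fine_cvgP; split.
  near=> n; have /andP[lo up] : ((- (rho + 1))%:E <= ((b n ^+ 2)^-1)%:E * lne (p n) <= (- (rho - 1))%:E)%E.
    by near: n; exact: key.
  by rewrite fin_numElt (lt_le_trans (ltNyr _) lo) (le_lt_trans up (ltry _)).
apply/cvgrPdist_le => eps eps0; near=> n.
have /andP[lo up] : ((- (rho + eps))%:E <= ((b n ^+ 2)^-1)%:E * lne (p n) <= (- (rho - eps))%:E)%E.
  by near: n; exact: key.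
move: lo up; rewrite /=; case: (_ * _)%E => [y|//|//]; rewrite !lee_fin /= => lo up.
by rewrite ler_norml; apply/andP; split; lra.
Unshelve. all: by end_near. Qed.

End logarithmic_limit.

(** * Weighted sums of empirical covariances *)

Section assembly.
Context d (T : measurableType d) (R : realType) (P : probability T R).
Variable xi : int -> {RV P >-> R}.

(** From [sqrt n u^2 >= B b] and [u <= 1] follows
    [n u^3 >= n u^4 >= B^2 b^2]. *)
Lemma regime_near (theta b : nat -> R) :
  (forall n, (1 <= n)%N -> 0 <= theta n < 1) -> theta n @[n --> \oo] --> (1 : R) ->
  (forall n, (1 <= n)%N -> 0 < b n) -> b n @[n --> \oo] --> +oo ->
  Num.sqrt n%:R * (1 - theta n) ^+ 2 / b n @[n --> \oo] --> +oo ->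
  forall B : R, \forall n \near \oo, regime B n (theta n) (b n).
Proof.
move=> th01 th1 b0 boo hoo B.
pose B1 : R := Num.max 1 B.
have B11 : 1 <= B1 by rewrite le_max lexx.
have BB1 : B <= B1 by rewrite le_max lexx orbT.
have B10 : 0 < B1 by exact: lt_le_trans ltr01 B11.
near=> n; apply: (regime_le BB1).
have n1 : (1 <= n)%N by near: n; exact: nbhs_infty_ge.
have tn := th01 _ n1; have bn := b0 _ n1.
have /andP[t0 t1] := tn.
have u0 : 0 < 1 - theta n by rewrite subr_gt0.
have nR : 0 < n%:R :> R by rewrite ltr0n.
split => //.
- by near: n; move/cvgryPge : boo; exact.
- have h : B1 <= Num.sqrt n%:R * (1 - theta n) ^+ 2 / b n.
    by near: n; move/cvgryPge : hoo; exact.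
  rewrite ler_pdivlMr// in h.
  have h2 : (B1 * b n) ^+ 2 <= (Num.sqrt n%:R * (1 - theta n) ^+ 2) ^+ 2.
    by rewrite ler_sqr ?nnegrE ?mulr_ge0 ?exprn_ge0 ?(ltW u0) ?(ltW B10) ?(ltW bn).
  apply: (@le_trans _ _ ((B1 * b n) ^+ 2)).
    by rewrite exprMn ler_wpM2r ?sqr_ge0// expr2 ler_peMl// ltW.
  apply: (le_trans h2); rewrite exprMn sqr_sqrtr ?ler0n// ler_wpM2l ?ler0n//.
  have -> : ((1 - theta n) ^+ 2) ^+ 2 = (1 - theta n) * (1 - theta n) ^+ 3 by ring.
  by apply: ler_piMl; [apply: exprn_ge0; exact: ltW|rewrite gerBl].
- rewrite mulrC -ler_pdivlMr// mul1r lerBlDr -lerBlDl.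
  by near: n; apply: (cvgr_ge _ th1); rewrite ltrBlDr ltrDl invr_gt0.
Unshelve. all: by end_near. Qed.

Hypothesis xi_iid : iid xi.
Hypothesis xi_mean : (\int[P]_w (xi 0%R w)%:E = 0)%E.
Variable al : R.
Hypothesis al0 : 0 < al.
Hypothesis xi_exp : (\int[P]_w (expR (al * xi 0%R w ^+ 2))%:E < +oo)%E.

Lemma exp_noise_exists : exists K, exp_noise xi al K.
Proof.
have mg : measurable_fun setT (fun x : R => (expR (al * x ^+ 2))%:E).
  apply/measurable_EFinP; apply: measurableT_comp => //.
  by apply: measurable_funM => //; exact: exprn_measurable.
have fin : (\int[distribution P (xi 0%R)]_x (expR (al * x ^+ 2))%:E < +oo)%E.
  by rewrite -(ge0_integral_noise xi_iid 0 mg)// => x; rewrite lee_fin expR_ge0.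
have fn : (\int[P]_w (expR (al * xi 0%R w ^+ 2))%:E)%E \is a fin_num.
  rewrite fin_numElt xi_exp andbT; apply: (@lt_le_trans _ _ 0%E); first exact: ltNyr.
  by apply: integral_ge0 => w _; rewrite lee_fin expR_ge0.
have [i2 _] := integrable_square (M := fine (\int[P]_w (expR (al * xi 0%R w ^+ 2))%:E)%E)
  al0 (measurable_funPT (xi 0%R)) (le_of_eq (esym (fineK fn))).
have mean : (\int[distribution P (xi 0%R)]_x x%:E = 0)%E.
  rewrite (integral_distribution (X := xi 0%R) (f := EFin))//.
  have i1 : P.-integrable setT (EFin \o (fun _ : T => 1 : R)) by exact: finite_measure_integrable_cst.
  apply: (le_integrable measurableT _ _ (integrable_addr i1 i2)).
    exact/measurable_EFinP.
  move=> w _; rewrite /= lee_fin; apply: le_trans (ler_norm _).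
  rewrite ler_norml; apply/andP; split; move: (xi 0 w) => x; nra.
have [K K0 [h1 h2 h3 h4]] := noise_bounds al0 fin mean.
by exists K; split.
Qed.

End assembly.

Section weighted_covariances.
Context d (T : measurableType d) (R : realType) (P : probability T R).
Variables (xi : int -> {RV P >-> R}) (al K : R).
Hypothesis N : exp_noise xi al K.
Local Notation mu := (distribution P (xi 0)).
Local Notation var := (\int[mu]_x (x ^+ 2)).
Hypothesis var_gt0 : 0 < var.
Variables (M : nat) (a : nat -> nat -> R) (alim : nat -> R).
Hypothesis a_cvg : forall l, (l <= M)%N -> a l n @[n --> \oo] --> alim l.
Local Notation A := (\sum_(0 <= l < M.+1) alim l).

Definition weighted_cov n th b (w : T) : R :=
  n%:R * (1 - th ^+ 2) * gfac n th b *
  \sum_(0 <= l < M.+1) a l n * (emp_cov xi th l n w - \int[P]_w' (emp_cov xi th l n w')).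

Definition weighted_error n th b (w : T) : R :=
  2 * (\sum_(0 <= l < M.+1) a l n - A) * score xi n th b w +
  \sum_(0 <= l < M.+1) a l n * cov_error xi l n th b w.

Lemma measurable_weighted_cov n th b : measurable_fun setT (weighted_cov n th b).
Proof.
apply: measurable_funM => //; apply: measurable_sum => l.
by apply: measurable_funM => //; apply: measurable_funB => //; exact: measurable_emp_cov.
Qed.

Lemma weighted_covE n th b w : weighted_cov n th b w =
  2 * A * score xi n th b w + weighted_error n th b w.
Proof.
rewrite /weighted_cov /weighted_error addrA -mulrDl -mulrDr addrCA subrr addr0.
rewrite mulr_sumr mulr_sumr mulr_suml -big_split/=; apply: eq_bigr => l _.
by rewrite /cov_error; ring.
Qed.

Lemma sum_weights_cvg : \sum_(0 <= l < M.+1) a l n @[n --> \oo] --> A.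
Proof.
have : forall m, (m <= M.+1)%N ->
    \sum_(0 <= l < m) a l n @[n --> \oo] --> \sum_(0 <= l < m) alim l.
  elim=> [|m ih] mM.
    rewrite big_geq// (_ : (fun _ => _) = cst 0); last by apply/funext => n; rewrite big_geq.
    exact: cvg_cst.
  rewrite big_nat_recr//= (_ : (fun _ => _) = fun n => \sum_(0 <= l < m) a l n + a m n).
    by apply: cvgD; [apply: ih; exact: ltnW|exact: a_cvg].
  by apply/funext => n; rewrite big_nat_recr.
exact.
Qed.

(** A regime forces [n >= B], so conditions on [n] alone can be used in it. *)
Lemma regime_of_near (Q : nat -> Prop) : (\forall n \near \oo, Q n) ->
  exists B : R, forall n th b, regime B n th b -> Q n.
Proof.
move=> [n0 _ hn]; exists (Num.max 1 n0%:R) => n th b rg; apply: hn => /=.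
have B1 : 1 <= Num.max 1 n0%:R :> R by rewrite le_max lexx.
have [_ _ _ _] := regime_facts B1 rg.
by rewrite ge_max => /andP[_]; rewrite ler_nat.
Qed.

Lemma negl_weighted_error : negl P weighted_error.
Proof.
apply: negl_add.
  apply: (negl_small_score N var_gt0) => delta delta0.
  apply: regime_of_near.
  have d2 : 0 < delta / 2 by rewrite divr_gt0.
  move/cvgrPdist_lt : sum_weights_cvg => /(_ _ d2) h.
  near=> n; rewrite normrM ger0_norm// mulrC -ltr_pdivlMr// distrC.
  by near: n; exact: h.
apply: negl_sum => l lM; apply: (@negl_scale _ _ _ _ (`|alim l| + 1)).
- by rewrite ltr_wpDl.
- apply: regime_of_near; move/cvgrPdist_lt : (a_cvg lM) => /(_ _ ltr01) h.
  near=> n.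
  have h1 : `|alim l - a l n| < 1 by near: n; exact: h.
  rewrite -lerBlDl; apply: le_trans (ltW h1); rewrite distrC.
  exact: lerB_dist.
- exact: negl_cov_error N var_gt0 l.
Unshelve. all: by end_near. Qed.

End weighted_covariances.

Theorem theorem2p2 (d : measure_display) (T : measurableType d) (R : realType)
    (P : probability T R) (xi : int -> {RV P >-> R})
    (xi_iid : iid xi)
    (xi_mean : ('E_P[(xi 0)%R] = 0)%E)
    (xi_var : (0 < 'E_P[(fun w => xi 0 w ^+ 2)%R])%E)
    (xi_exp : exists2 alpha : R, 0 < alpha &
       ('E_P[(fun w => expR (alpha * xi 0 w ^+ 2))%R] < +oo)%E)
    (theta : nat -> R)
    (theta_itv : forall n : nat, (1 <= n)%N -> 0 <= theta n < 1)
    (theta_cvg : theta n @[n --> \oo] --> (1 : R))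
    (b : nat -> R)
    (b_gt0 : forall n : nat, (1 <= n)%N -> 0 < b n)
    (b_cvg : b n @[n --> \oo] --> +oo)
    (theta_b_cvg :
       Num.sqrt (n%:R : R) * (1 - theta n) ^+ 2 / b n @[n --> \oo] --> +oo)
    (M : nat) (a : nat -> nat -> R) (alim : nat -> R)
    (a_cvg : forall l : nat, (l <= M)%N -> a l n @[n --> \oo] --> alim l)
    (a_neq0 : exists2 l : nat, (l <= M)%N & alim l != 0)
    (r : R) (r_gt0 : 0 < r) :
  (((b n ^+ 2)^-1)%:E *
   lne (P [set w : T |
     (r <= ((1 - theta n ^+ 2) `^ (3 / 2) * Num.sqrt n%:R / b n) *
          `| \sum_(0 <= l < M.+1)
               a l n * (empirical_cov theta xi l n w -
                        fine ('E_P[empirical_cov theta xi l n])%E) |)%R]))%E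
    @[n --> \oo]
  --> gaussian_rate
        (4 * (\sum_(0 <= j < M.+1) alim j) ^+ 2 *
         fine ('E_P[(fun w => xi 0 w ^+ 2)%R])%E ^+ 2) r.

Proof.
case: xi_exp => al al0 exp_fin; rewrite unlock in exp_fin.
rewrite unlock in xi_mean; rewrite unlock in xi_var.
have [K N] := exp_noise_exists xi_iid xi_mean al0 exp_fin.
set v := \int[distribution P (xi 0%R)]_x (x ^+ 2).
have vE : \int[P]_w (xi 0 w ^+ 2) = v by exact: noise_square_integral N 0.
have v0 : 0 < v.
  have i2 := noise_square_integrable N 0.
  by rewrite -lte_fin -vE fineK//; exact: integrable_fin_num.
rewrite [X in gaussian_rate (_ * X ^+ 2) _](_ : _ = v); last by rewrite unlock -vE.
set A := \sum_(0 <= j < M.+1) alim j.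
pose Y := weighted_cov xi M a.
pose p n := P [set w | r <= `|Y n (theta n) (b n) w|].
pose q n := P [set w | r <= ((1 - theta n ^+ 2) `^ (3 / 2) * Num.sqrt n%:R / b n) *
  `| \sum_(0 <= l < M.+1) a l n * (empirical_cov theta xi l n w -
       fine ('E_P[empirical_cov theta xi l n])%E) |].
have pq n : (1 <= n)%N -> q n = p n.
  move=> n1; rewrite /q /p; congr (P _); apply/seteqP.
  have /andP[t0 t1] := theta_itv _ n1; have bn := b_gt0 _ n1.
  have t01 : 0 <= theta n < 1 by rewrite t0.
  have nR : 0 < n%:R :> R by rewrite ltr0n.
  have /andP[x0 _] := one_sub_sqr t01.
  have sn : 0 < Num.sqrt n%:R :> R by rewrite sqrtr_gt0.
  have e : (1 - theta n ^+ 2) `^ (3 / 2) * Num.sqrt n%:R / b n =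
      n%:R * (1 - theta n ^+ 2) * gfac n (theta n) (b n).
    have -> : 3 / 2 = 1 + 2^-1 :> R by field.
    rewrite powRD ?gt_eqF ?implybT// powRr1 ?(ltW x0)// powR12_sqrt ?(ltW x0)//.
    rewrite /gfac -{2}[n%:R](@sqr_sqrtr _) ?(ltW nR)//.
    by move: (Num.sqrt _) (Num.sqrt n%:R) sn => y z z0; field; rewrite !gt_eqF.
  have yE w : ((1 - theta n ^+ 2) `^ (3 / 2) * Num.sqrt n%:R / b n) *
       `| \sum_(0 <= l < M.+1) a l n * (empirical_cov theta xi l n w -
                 fine ('E_P[empirical_cov theta xi l n])%E) | = `|Y n (theta n) (b n) w|.
    rewrite e /Y /weighted_cov normrM [in RHS]ger0_norm; last first.
      by apply: mulr_ge0; [apply: mulr_ge0; exact: ltW|apply: ltW; exact: gfac_gt0].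
    congr (_ * `|_|); apply: eq_bigr => l _; rewrite unlock.
    by [].
  by split => w /=; rewrite yE.
have q0 n : (0 <= q n)%E by exact: measure_ge0.
have bpos : \forall n \near \oo, 0 < b n.
  by near=> n; apply: b_gt0; near: n; exact: nbhs_infty_ge.
have ev (Q : nat -> Prop) :
    (exists B, forall n, regime B n (theta n) (b n) -> Q n) -> \forall n \near \oo, (1 <= n)%N /\ Q n.
  move=> [B hB]; near=> n; split; first by near: n; exact: nbhs_infty_ge.
  by apply: hB; near: n; exact: regime_near.
have mY := @measurable_weighted_cov _ _ _ P xi M a.
have nW := negl_weighted_error N v0 a_cvg.
have YE := @weighted_covE _ _ _ P xi M a alim.
have [A0|A0] := eqVneq A 0.
  rewrite /gaussian_rate A0 expr0n mulr0 mul0r eqxx.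
  apply: (log_limitNy (p := q)) => // L L0.
  have [B hB] := deviation_degenerate mY YE nW A0 r_gt0 L0.
  have := ev _ (ex_intro _ B (fun n => hB n (theta n) (b n))).
  by apply: filterS => n [n1 h]; rewrite pq.
rewrite /gaussian_rate; set s := 4 * _ * _.
have s0 : s != 0 by rewrite !mulf_neq0// ?expf_neq0// gt_eqF.
rewrite (negbTE s0); apply: (log_limit (p := q)) => // delta delta0.
  have [B hB] := deviation_upper N v0 mY YE nW A0 r_gt0 delta0.
  have := ev _ (ex_intro _ B (fun n => hB n (theta n) (b n))).
  by apply: filterS => n [n1 h]; rewrite pq.
have [B hB] := deviation_lower N v0 mY YE nW A0 r_gt0 delta0.
have := ev _ (ex_intro _ B (fun n => hB n (theta n) (b n))).
by apply: filterS => n [n1 h]; rewrite pq.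
Unshelve. all: by end_near. Qed.
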